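(* Let $L:G\to\mathbb R$ be a discrete Lagrangian on a Lie groupoid $G\rightrightarrows M$, and let $\xi:G\to G$ be a smooth second order operator, i.e. a smooth map with $(g,\xi(g))\in G_2$ for all $g\in G$. Then: (i) $\xi$ is a discrete Lagrangian evolution operator for $L$ if and only if $(\mathcal P^\tau\xi,\xi)^*\Theta_L^-=\Theta_L^+$. (ii) $\xi$ is a discrete Lagrangian evolution operator for $L$ if and only if $(\mathcal P^\tau\xi,\xi)^*\Theta_L^--\Theta_L^-=dL$. (iii) If $\xi$ is a discrete Lagrangian evolution operator for $L$, then $(\mathcal P^\tau\xi,\xi)^*\Omega_L=\Omega_L$.
   Context: A Lie groupoid $G\rightrightarrows M$ has source $\alpha$ and target $\beta$ (surjective submersions $G\to M$), identity section $\epsilon:M\to G$, inversion $i(g)=g^{-1}$, and a product $gh$ defined for $(g,h)\in G_2=\{(g,h):\beta(g)=\alpha(h)\}$, with $\alpha(gh)=\alpha(g)$, $\beta(gh)=\beta(h)$. Translations: $l_g:\alpha^{-1}(\beta(g))\to\alpha^{-1}(\alpha(g))$, $h\mapsto gh$, and $r_g:\beta^{-1}(\alpha(g))\to\beta^{-1}(\beta(g))$, $h\mapsto hg$. Put $V\alpha=\ker T\alpha$, $V\beta=\ker T\beta$. The Lie algebroid $\tau:AG\to M$ of $G$ has fibre $A_xG=V_{\epsilon(x)}\alpha$. For $X\in\Gamma(\tau)$ define vector fields on $G$ by $\overleftarrow X(g)=(T_{\epsilon(\beta(g))}l_g)(X(\beta(g)))$ (a section of $V\alpha$) and $\overrightarrow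 X(g)=-(T_{\epsilon(\alpha(g))}(r_g\circ i))(X(\alpha(g)))$ (a section of $V\beta$). The bracket and anchor of $AG$ are given by $\overleftarrow{[\![X,Y]\!]}=[\overleftarrow X,\overleftarrow Y]$ and $\rho(X)(x)=(T_{\epsilon(x)}\beta)(X(x))$. The vector bundle $\pi^\tau:\mathcal P^\tau G\equiv V\beta\oplus_G V\alpha\to G$ carries the Lie algebroid structure with anchor $(X_g,Y_g)\mapsto X_g+Y_g$ and bracket characterized by $[\![(\overrightarrow X,\overleftarrow Y),(\overrightarrow{X'},\overleftarrow{Y'})]\!]=(-\overrightarrow{[\![X,X']\!]},\overleftarrow{[\![Y,Y']\!]})$ for $X,Y,X',Y'\in\Gamma(\tau)$. $d$ is the differential of this Lie algebroid: $dF(Z)=\rho(Z)F$ for functions, $d\mu(Z,W)=\rho(Z)(\mu(W))-\rho(W)(\mu(Z))-\mu([\![Z,W]\!])$ for sections $\mu$ of the dual bundle. A discrete Lagrangian is a smooth function $L:G\to\mathbb R$. The Poincaré–Cartan 1-sections $\Theta_L^\pm\in\Gamma((\pi^\tau)^* )$ are $\Theta_L^-(g)(X_g,Y_g)=-X_g(L)$ and $\Theta_L^+(g)(X_g,Y_g)=Y_g(L)$ for $(X_g,Y_g)\in V_g\beta\oplus V_g\alpha$. One has $dL=\Theta_L^+-\Theta_L^-$, and the Poincaré–Cartan 2-section is $\Omega_L=-d\Theta_L^+=-d\Theta_L^-$. A pair $(g,h)\in G_2$ solves the discrete Euler–Lagrange equations for $L$ if $\overleftarrow X(g)(L)-\overrightarrow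 X(h)(L)=0$ for all $X\in\Gamma(\tau)$. A discrete Lagrangian evolution operator for $L$ is a smooth map $\xi:G\to G$ such that for all $g\in G$, $(g,\xi(g))\in G_2$ and $(g,\xi(g))$ solves the discrete Euler–Lagrange equations for $L$. For a smooth second order operator $\xi$, the prolongation $\mathcal P^\tau\xi:V\beta\oplus_GV\alpha\to V\beta\oplus_GV\alpha$ (a vector bundle map over $\xi$) is $$\mathcal P^\tau_g\xi(X_g,Y_g)=\bigl(T_g(r_{g\xi(g)}\circ i)(Y_g),\ (T_g\xi)(X_g)+(T_g\xi)(Y_g)-T_g(r_{g\xi(g)}\circ i)(Y_g)\bigr).$$ For a vector bundle map $\Psi$ over $\Psi_0$, the pullback is $((\Psi,\Psi_0)^*\phi)(g)(a_1,\dots,a_k)=\phi(\Psi_0(g))(\Psi a_1,\dots,\Psi a_k)$. *)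

(* Defs.v *)
From HB Require Import structures.
From mathcomp Require Import all_boot all_order all_algebra.
From mathcomp Require Import all_classical all_reals all_analysis.

Set Implicit Arguments.
Unset Strict Implicit.
Unset Printing Implicit Defensive.

Import Order.TTheory GRing.Theory Num.Theory.
Import numFieldNormedType.Exports.

Local Open Scope classical_set_scope.
Local Open Scope ring_scope.

(** * Smooth manifolds *)

Section SmoothEuclidean.
Variables (R : realType) (n : nat) (W : normedModType R).

(* Class C^k on U; only meant for open U. *)
Fixpoint class_C (k : nat) (U : set 'rV[R]_n) (f : 'rV[R]_n -> W) : Prop :=
  if k is k'.+1 then
    (forall x, U x -> differentiable f x) /\
    (forall v : 'rV[R]_n, class_C k' U ('D_v f))
  else forall x, U x -> {for x, continuous f}.

Definition smooth_on (U : set 'rV[R]_n) (f : 'rV[R]_n -> W) : Prop :=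
  forall k, class_C k U f.

End SmoothEuclidean.

(* Charts are total maps; [chart_map] is meaningful on [chart_dom] only, and
   [chart_inv] on [chart_cod] only. *)
Record chart (R : realType) (n : nat) (M : topologicalType) := Chart {
  chart_dom : set M;
  chart_map : M -> 'rV[R]_n;
  chart_inv : 'rV[R]_n -> M }.

Definition chart_cod R n M (c : chart R n M) : set 'rV[R]_n :=
  chart_map c @` chart_dom c.

Record is_chart R n M (c : chart R n M) : Prop := {
  open_chart_dom : open (chart_dom c);
  open_chart_cod : open (chart_cod c);
  chart_mapK : forall p, chart_dom c p -> chart_inv c (chart_map c p) = p;
  chart_map_cont : {within chart_dom c, continuous (chart_map c)};
  chart_inv_cont : {within chart_cod c, continuous (chart_inv c)} }.

Record chartedSpace (R : realType) (n : nat) := ChartedSpace {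
  cs_space :> topologicalType;
  atlas : set (chart R n cs_space) }.
Arguments atlas {R n} c.

Record is_manifold R n (M : chartedSpace R n) : Prop := {
  mfd_hausdorff : hausdorff_space M;
  mfd_second_countable : @second_countable M;
  mfd_chart : forall c, atlas M c -> is_chart c;
  mfd_cover : forall p : M, exists2 c, atlas M c & chart_dom c p;
  mfd_compat : forall c d, atlas M c -> atlas M d ->
    smooth_on (chart_map c @` (chart_dom c `&` chart_dom d))
              (chart_map d \o chart_inv c) }.

Record manifold (R : realType) (n : nat) := Manifold {
  mfd_space :> chartedSpace R n;
  mfdP : is_manifold mfd_space }.

Definition prod_chart R n k (M N : topologicalType)
    (c : chart R n M) (d : chart R k N) : chart R (n + k) (M * N)%type :=
  Chart (chart_dom c `*` chart_dom d)
        (fun p => row_mx (chart_map c p.1) (chart_map d p.2))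
        (fun v => (chart_inv c (lsubmx v), chart_inv d (rsubmx v))).

Definition prod_space R n k (M : chartedSpace R n) (N : chartedSpace R k) :
    chartedSpace R (n + k) :=
  @ChartedSpace R (n + k) (M * N)%type
    [set e | exists c d, [/\ atlas M c, atlas N d & e = prod_chart c d]].

Definition smooth_fun R n (M : chartedSpace R n) (f : M -> R) : Prop :=
  forall c, atlas M c -> smooth_on (chart_cod c) (f \o chart_inv c).

Section SmoothMaps.
Variables (R : realType) (n k : nat).
Variables (M : chartedSpace R n) (N : chartedSpace R k).

Definition smooth_map_on_open (U : set M) (f : M -> N) : Prop :=
  forall p, U p ->
  exists (c : chart R n M) (d : chart R k N) (V : set M),
    [/\ atlas M c /\ atlas N d, open V /\ V p, V `<=` U `&` chart_dom c,
        f @` V `<=` chart_dom d &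
        smooth_on (chart_map c @` V) (chart_map d \o f \o chart_inv c)].

Definition smooth_map (f : M -> N) : Prop := smooth_map_on_open setT f.

(* A map on an arbitrary subset D is smooth when it extends to a smooth map
   around each point of D.  For an embedded submanifold D this is smoothness
   for the submanifold structure. *)
Definition smooth_map_on (D : set M) (f : M -> N) : Prop :=
  forall p, D p ->
  exists (U : set M) (F : M -> N),
    [/\ open U, U p, smooth_map_on_open U F &
        forall q, D q -> U q -> F q = f q].

End SmoothMaps.

(** * Tangent vectors *)

Section Tangent.
Variables (R : realType) (n : nat) (M : chartedSpace R n).

(* Tangent vectors are derivations of the algebra of smooth functions.  They
   are carried by total functionals, with value 0 on non-smooth functions, so
   that equality of tangent vectors is equality of functionals. *)
Definition tvec := (M -> R) -> R.

Record tangent (p : M) (v : tvec) : Prop := {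
  tangent_linear : forall (a : R) f g, smooth_fun f -> smooth_fun g ->
    v (a *: f + g) = a * v f + v g;
  tangent_leibniz : forall f g, smooth_fun f -> smooth_fun g ->
    v (f * g) = f p * v g + g p * v f;
  tangent_junk : forall f, ~ smooth_fun f -> v f = 0 }.

Definition vector_field (X : M -> tvec) : Prop :=
  (forall p, tangent p (X p)) /\
  (forall f, smooth_fun f -> smooth_fun (fun p => X p f)).

Definition vf_bracket (X Y : M -> tvec) : M -> tvec :=
  fun p f => X p (fun q => Y q f) - Y p (fun q => X q f).

End Tangent.
Arguments tvec {R n} M.

Section TangentMap.
Variables (R : realType) (n k : nat).
Variables (M : chartedSpace R n) (N : chartedSpace R k).

(* T phi; the base point is not needed, v being a functional. *)
Definition tmap (phi : M -> N) (v : tvec M) : tvec N :=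
  fun f => if `[< smooth_fun f >] then v (f \o phi) else 0.

(* T_p phi for a map phi defined on an embedded submanifold S of M through p,
   where T_p S is seen as a subspace of T_p M: a vector tangent to S acts on a
   smooth function of S through any smooth extension of it to M around p.
   The values of phi outside S are irrelevant. *)
Definition tmap_along (S : set M) (phi : M -> N) (p : M) (v : tvec M) :
    tvec N :=
  fun f => if `[< smooth_fun f >] then
    v (get [set F : M -> R | smooth_fun F /\
                             \forall q \near p, S q -> F q = f (phi q)])
  else 0.

Record surjective_submersion (phi : M -> N) : Prop := {
  subm_smooth : smooth_map phi;
  subm_surj : forall y, exists x, phi x = y;
  subm_tangent : forall p w, tangent (phi p) w ->
    exists2 v, tangent p v & tmap phi v = w }.

End TangentMap.

(** * Lie groupoids *)

(* [gmul] is total, but only its values on composable pairs, i.e. pairs (g, h)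
   with tgt g = src h, are constrained and used. *)
Record lieGroupoid (R : realType) (n m : nat)
    (G : manifold R n) (M : manifold R m) := LieGroupoid {
  src : G -> M;
  tgt : G -> M;
  gid : M -> G;
  ginv : G -> G;
  gmul : G -> G -> G;
  src_subm : surjective_submersion src;
  tgt_subm : surjective_submersion tgt;
  gid_smooth : smooth_map gid;
  ginv_smooth : smooth_map ginv;
  gmul_smooth :
    @smooth_map_on R (n + n) n (prod_space G G) G
      [set gh : G * G | tgt gh.1 = src gh.2] (fun gh => gmul gh.1 gh.2);
  src_gid : forall x, src (gid x) = x;
  tgt_gid : forall x, tgt (gid x) = x;
  src_gmul : forall g h, tgt g = src h -> src (gmul g h) = src g;
  tgt_gmul : forall g h, tgt g = src h -> tgt (gmul g h) = tgt h;
  gmulA : forall g h l, tgt g = src h -> tgt h = src l ->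
    gmul g (gmul h l) = gmul (gmul g h) l;
  gmul1g : forall g, gmul (gid (src g)) g = g;
  gmulg1 : forall g, gmul g (gid (tgt g)) = g;
  src_ginv : forall g, src (ginv g) = tgt g;
  tgt_ginv : forall g, tgt (ginv g) = src g;
  gmulgV : forall g, gmul g (ginv g) = gid (src g);
  gmulVg : forall g, gmul (ginv g) g = gid (tgt g) }.

Section DiscreteMechanics.
Variables (R : realType) (n m : nat) (G : manifold R n) (M : manifold R m).
Variable Gd : lieGroupoid G M.

Definition composable (g h : G) : Prop := tgt Gd g = src Gd h.

Definition Vsrc (g : G) (v : tvec G) : Prop :=
  tangent g v /\ tmap (src Gd) v = 0.
Definition Vtgt (g : G) (v : tvec G) : Prop :=
  tangent g v /\ tmap (tgt Gd) v = 0.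

Definition src_fibre (x : M) : set G := [set g | src Gd g = x].

(* T_h l_g, on vectors tangent at h to the source fibre of tgt g. *)
Definition Tleft (g h : G) (v : tvec G) : tvec G :=
  tmap_along (src_fibre (tgt Gd g)) (gmul Gd g) h v.

(* T_h (r_g o i), on vectors tangent at h to the source fibre of src g. *)
Definition Tright_inv (g h : G) (v : tvec G) : tvec G :=
  tmap_along (src_fibre (src Gd g)) (fun q => gmul Gd (ginv Gd q) g) h v.

(** ** The Lie algebroid AG *)

(* AG is a subbundle of the pullback of TG along the identity section, so a
   section of it is a vector field along [gid]. *)
Definition AG_section (X : M -> tvec G) : Prop :=
  (forall x, Vsrc (gid Gd x) (X x)) /\
  (forall f, smooth_fun f -> smooth_fun (fun x => X x f)).

Definition left_inv (X : M -> tvec G) (g : G) : tvec G :=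
  Tleft g (gid Gd (tgt Gd g)) (X (tgt Gd g)).
Definition right_inv (X : M -> tvec G) (g : G) : tvec G :=
  - Tright_inv g (gid Gd (src Gd g)) (X (src Gd g)).

(* Z is the Lie algebroid bracket of X and Y. *)
Definition AG_bracket (X Y Z : M -> tvec G) : Prop :=
  AG_section Z /\ left_inv Z = vf_bracket (left_inv X) (left_inv Y).

(** ** The Lie algebroid V beta (+) V alpha *)

Definition pvec := (tvec G * tvec G)%type.

Definition prol_fibre (g : G) (a : pvec) : Prop := Vtgt g a.1 /\ Vsrc g a.2.

Definition prol_section (Z : G -> pvec) : Prop :=
  [/\ (forall g, prol_fibre g (Z g)),
      vector_field (fun g => (Z g).1) & vector_field (fun g => (Z g).2)].

Definition anchor (a : pvec) : tvec G := a.1 + a.2.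

Definition inv_section (X Y : M -> tvec G) (g : G) : pvec :=
  (right_inv X g, left_inv Y g).

Record is_prol_bracket (br : (G -> pvec) -> (G -> pvec) -> (G -> pvec)) :
    Prop := {
  br_section : forall Z W, prol_section Z -> prol_section W ->
    prol_section (br Z W);
  br_linear : forall (a : R) Z Z' W,
    prol_section Z -> prol_section Z' -> prol_section W ->
    br (a *: Z + Z') W = a *: br Z W + br Z' W;
  br_skew : forall Z W, prol_section Z -> prol_section W ->
    br Z W = - br W Z;
  br_jacobi : forall Z W T,
    prol_section Z -> prol_section W -> prol_section T ->
    br Z (br W T) + br W (br T Z) + br T (br Z W) = 0;
  br_leibniz : forall Z W (f : G -> R),
    prol_section Z -> prol_section W -> smooth_fun f ->
    br Z (fun g => f g *: W g) =
      (fun g => f g *: br Z W g + anchor (Z g) f *: W g);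
  br_inv_section : forall X Y X' Y' XX' YY',
    AG_section X -> AG_section Y -> AG_section X' -> AG_section Y' ->
    AG_bracket X X' XX' -> AG_bracket Y Y' YY' ->
    br (inv_section X Y) (inv_section X' Y') =
      (fun g => (- right_inv XX' g, left_inv YY' g)) }.

(* k-sections of the dual bundle, k = 1, 2, as functions on all of [pvec];
   only their values on the fibres of the bundle matter. *)
Definition form1 := G -> pvec -> R.
Definition form2 := G -> pvec -> pvec -> R.

Definition eq_form1 (mu nu : form1) : Prop :=
  forall g a, prol_fibre g a -> mu g a = nu g a.
Definition eq_form2 (mu nu : form2) : Prop :=
  forall g a b, prol_fibre g a -> prol_fibre g b -> mu g a b = nu g a b.

Definition pullback1 (Psi : G -> pvec -> pvec) (psi : G -> G) (mu : form1) :
    form1 :=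
  fun g a => mu (psi g) (Psi g a).
Definition pullback2 (Psi : G -> pvec -> pvec) (psi : G -> G) (mu : form2) :
    form2 :=
  fun g a b => mu (psi g) (Psi g a) (Psi g b).

Definition d0 (F : G -> R) : form1 := fun g a => anchor a F.

Definition d1_sections (br : (G -> pvec) -> (G -> pvec) -> (G -> pvec))
    (mu : form1) (Z W : G -> pvec) (g : G) : R :=
  anchor (Z g) (fun h => mu h (W h)) - anchor (W g) (fun h => mu h (Z h))
  - mu g (br Z W g).

(* The value of d mu at (a, b) is computed from any sections through a, b. *)
Definition d1 (br : (G -> pvec) -> (G -> pvec) -> (G -> pvec))
    (mu : form1) : form2 :=
  fun g a b => get [set r | exists Z W,
    [/\ prol_section Z, prol_section W, Z g = a, W g = b &
        r = d1_sections br mu Z W g]].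

(** ** Discrete Lagrangians *)

Definition Theta_minus (L : G -> R) : form1 := fun g a => - a.1 L.
Definition Theta_plus (L : G -> R) : form1 := fun g a => a.2 L.

Definition Omega (br : (G -> pvec) -> (G -> pvec) -> (G -> pvec))
    (L : G -> R) : form2 :=
  fun g a b => - d1 br (Theta_plus L) g a b.

Definition solves_DEL (L : G -> R) (g h : G) : Prop :=
  composable g h /\
  forall X, AG_section X -> left_inv X g L - right_inv X h L = 0.

Definition second_order (xi : G -> G) : Prop :=
  smooth_map xi /\ forall g, composable g (xi g).

Definition evolution_operator (L : G -> R) (xi : G -> G) : Prop :=
  smooth_map xi /\ forall g, solves_DEL L g (xi g).

Definition prol_map (xi : G -> G) (g : G) (a : pvec) : pvec :=
  let u := Tright_inv (gmul Gd g (xi g)) g a.2 in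
  (u, tmap xi a.1 + tmap xi a.2 - u).

End DiscreteMechanics.

(* Main.v *)
From HB Require Import structures.
Require Import Defs.
From mathcomp Require Import all_boot all_order all_algebra perm.
From mathcomp Require Import all_classical all_reals all_analysis.
From mathcomp Require Import ring lra.

(** Every vector of [Vsrc g] is the value [left_inv Y g] of a left-invariant
    field, and every vector of [Vtgt g] the value [right_inv X g] of a
    right-invariant one ([left_inv_surj], [right_inv_surj]). On such values
    everything becomes explicit. Since [(g k)^-1 (g h) = k^-1 h], the first
    component of the prolongation of [(v, left_inv Y g)] is
    [- right_inv Y (xi g)] ([Tright_inv_left_inv]), so the equality of
    one-forms in (i) says that [right_inv Y (xi g) L = left_inv Y g L] for all
    [g] and [Y]: these are the discrete Euler-Lagrange equations. As
    [d0 L = Theta_plus L - Theta_minus L], (ii) is the same equality.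

    For (iii), the differential of [Theta_plus L] is tensorial
    ([d1_sections_eq]), hence it can be computed on invariant sections, where
    the bracket is given; the result, [Omega_inv_section], consists of the
    mixed second derivatives [right_inv X (left_inv Y L)]. The image of the
    prolongation at [xi g] is expressed by invariant sections too, and the
    equality follows by differentiating the Euler-Lagrange equations. It uses
    that left- and right-invariant fields commute ([right_left_comm]) and that
    inversion exchanges the two families up to sign ([right_inv_bracket]).

    The differential geometry below serves these statements. Tangent vectors are
    derivations of global smooth functions, so bump functions are needed to make
    them local ([tangent_local]) and Hadamard's lemma to make them directional
    derivatives ([tangent_chain], [tangent_coord_vecE]). Translations are only
    defined on source fibres: their tangent maps are computed through arbitrary
    smooth extensions, which is legitimate because a vector tangent to a fibre
    of a submersion kills the functions vanishing on this fibre
    ([vertical_vanish]). This form of the implicit function theorem follows from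
    a fixed point argument in coordinates ([level_set_tangent]). Finally,
    vertical vectors are extended to global vertical fields by a projection onto
    the kernel of the submersion ([exists_vertical_frame]); it gives both the
    sections of [AG] through a given vector and the spanning families behind
    tensoriality. *)

Set Implicit Arguments.
Unset Strict Implicit.
Unset Printing Implicit Defensive.

Import Order.TTheory GRing.Theory Num.Theory.
Import numFieldNormedType.Exports.

Local Open Scope classical_set_scope.
Local Open Scope ring_scope.

Local Opaque derive.

(** * Functions of class C^k *)

(** The Frechet derivative through an error estimate, for maps whose derivative
    is known beforehand. *)
Lemma differentiable_epsP (R : realType) (V W : normedModType R) (f : V -> W)
    (x : V) (df : {linear V -> W}) : continuous df ->
  (forall e, 0 < e -> \forall h \near (0 : V),
    `|f (h + x) - (f x + df h)| <= e * `|h|) ->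
  is_diff x f df.
Proof.
move=> dfc H.
have E : f \o shift x = cst (f x) + df +o_ (0 : V) id.
  by apply/eqaddoP => e e0; near do rewrite /=; exact: (H _ e0).
have d := diff_unique dfc E.
by apply: DiffDef => //; apply/diff_locallyP; rewrite d.
Unshelve. all: by end_near. Qed.

Lemma differentiable_eps (R : realType) (V W : normedModType R) (f : V -> W)
    (x : V) : differentiable f x ->
  forall e, 0 < e -> \forall h \near (0 : V),
    `|f (h + x) - (f x + 'd f x h)| <= e * `|h|.
Proof. by move=> /diff_locallyP[_ /eqaddoP H] e e0; exact: H. Qed.

Lemma near_eq_differentiable (R : realType) (V W : normedModType R)
    (f g : V -> W) (x : V) : (\near x, f x = g x) ->
  differentiable f x -> differentiable g x.
Proof.
move=> fg df; suff: is_diff x g ('d f x) by case.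
apply: differentiable_epsP; first exact: diff_continuous.
move=> e e0; have H := differentiable_eps df e0.
have fgx : f x = g x := nbhs_singleton fg.
have fg' : \forall h \near (0 : V), f (h + x) = g (h + x).
  by move: fg; rewrite (near_shift 0 x) /=; apply: filterS => h /=; rewrite subr0.
by near do rewrite -(near fg')// -fgx; exact: H.
Unshelve. all: by end_near. Qed.

Section ClassC.
Variable R : realType.
Implicit Types (n k : nat).

Lemma open_near n (U : set 'rV[R]_n) x : open U -> U x -> \forall y \near x, U y.
Proof. by move=> oU Ux; exact: open_nbhs_nbhs. Qed.

Section ext.
Variables (n : nat) (W : normedModType R).
Implicit Types (U : set 'rV[R]_n) (f g : 'rV[R]_n -> W).

Lemma class_C_ext k U f g : open U -> (forall x, U x -> f x = g x) ->
  class_C k U f -> class_C k U g.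
Proof.
move=> oU fg.
have near_fg f' g' : (forall x, U x -> f' x = g' x) ->
    forall x, U x -> \near x, f' x = g' x :> W.
  by move=> E x /(open_near oU); apply: filterS.
elim: k f g fg => [|k IH] f g fg /=.
  move=> cf x Ux; suff: g @ x --> f x by rewrite fg.
  apply: cvg_trans (cf x Ux).
  have fgx := near_fg _ _ fg x Ux. apply: (near_eq_cvg fgx).
have fg' := near_fg _ _ fg.
move=> [df Df]; split=> [x Ux|v].
  exact: near_eq_differentiable (fg' x Ux) (df x Ux).
by apply: IH (Df v) => x Ux; apply: near_eq_derive; exact: fg'.
Qed.

Lemma class_C_sub k U V f : V `<=` U -> class_C k U f -> class_C k V f.
Proof.
move=> VU; elim: k f => [|k IH] f /=; first by move=> cf x /VU; exact: cf.
by move=> [df Df]; split=> [x /VU Ux|v]; [exact: df|exact: IH (Df v)].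
Qed.

Lemma class_C_local k U f :
  (forall x, U x -> exists2 V, V x & class_C k V f) -> class_C k U f.
Proof.
elim: k f => [|k IH] f H /=.
  by move=> x Ux; have [V Vx cf] := H x Ux; exact: cf.
split=> [x Ux|v].
  by have [V Vx [df _]] := H x Ux; exact: df.
by apply: IH => x Ux; have [V Vx [_ Df]] := H x Ux; exists V => //; exact: Df.
Qed.

Lemma class_CW k U f : class_C k.+1 U f -> class_C k U f.
Proof.
elim: k f => [|k IH] f [df Df].
  by move=> x Ux; apply: differentiable_continuous; exact: df.
by split=> // v; apply: IH; exact: Df.
Qed.

Lemma class_C_le k l U f : (k <= l)%N -> class_C l U f -> class_C k U f.
Proof.
move=> /subnKC <-; elim: (l - k)%N f => [|d IH] f; first by rewrite addn0.
by rewrite addnS => /class_CW; exact: IH.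
Qed.

Lemma class_C_cst k U (a : W) : class_C k U (cst a).
Proof.
elim: k a => [|k IH] a /=; first by move=> x _; exact: cst_continuous.
split=> [x _|v]; first exact: differentiable_cst.
rewrite (_ : (fun _ => _) = cst 0); first exact: IH.
by apply/funext => x; rewrite derive_cst.
Qed.

Lemma class_C_add k U f g : open U -> class_C k U f -> class_C k U g ->
  class_C k U (f + g).
Proof.
move=> oU; elim: k f g => [|k IH] f g /=.
  by move=> cf cg x Ux; apply: continuousD; [exact: cf|exact: cg].
move=> [df Df] [dg Dg]; split=> [x Ux|v].
  by apply: differentiableD; [exact: df|exact: dg].
apply: class_C_ext (IH _ _ (Df v) (Dg v)) => // x Ux.
by rewrite /= deriveD//; apply: diff_derivable; [exact: df|exact: dg].
Qed.

Lemma class_C_sum k U (I : Type) (r : seq I) (P : pred I) (F : I -> 'rV[R]_n -> W) :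
  open U -> (forall l : I, P l -> class_C k U (F l)) ->
  class_C k U (fun x => \sum_(l <- r | P l) F l x).
Proof.
move=> oU H; rewrite (_ : (fun _ => _) = \sum_(l <- r | P l) F l); last first.
  by apply/funext => x; rewrite fct_sumE.
elim/big_rec: _ => [|i f Pi Cf]; first exact: class_C_cst.
by apply: class_C_add => //; exact: H.
Qed.

End ext.

Section mul.
Variables (n : nat).
Implicit Types (U : set 'rV[R]_n) (f g : 'rV[R]_n -> R).

Lemma class_C_mul k U f g : open U -> class_C k U f -> class_C k U g ->
  class_C k U (f * g).
Proof.
move=> oU; elim: k f g => [|k IH] f g.
  by move=> cf cg x Ux; apply: continuousM; [exact: cf|exact: cg].
move=> Cf Cg; have [df Df] := Cf; have [dg Dg] := Cg.
split=> [x Ux|v].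
  by apply: differentiableM; [exact: df|exact: dg].
apply: (@class_C_ext _ _ _ _ (f * ('D_v g) + g * ('D_v f))) => //; last first.
  apply: class_C_add => //; apply: IH => //.
  - exact: class_CW.
  - exact: Dg.
  - exact: class_CW.
  - exact: Df.
move=> x Ux; rewrite /= deriveM//; apply: diff_derivable.
  exact: df.
exact: dg.
Qed.

Lemma class_C_opp k U f : open U -> class_C k U f -> class_C k U (- f).
Proof.
move=> oU Cf; rewrite (_ : - f = cst (-1) * f).
  by apply: class_C_mul => //; exact: class_C_cst.
by apply/funext => x; rewrite fctE/= mulN1r.
Qed.

Lemma derive_coord (a v : 'rV[R]_n) j : 'D_v (fun x : 'rV[R]_n => x 0 j) a = v 0 j.
Proof.
have @f : {linear 'rV[R]_n -> R}.
  by exists (fun N : 'rV[R]_n => N 0 j); do 2![eexists]; do ?[constructor];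
     rewrite ?mxE// => ? *; rewrite ?mxE//; move=> ?; rewrite !mxE.
rewrite deriveE; last exact: differentiable_coord.
rewrite (_ : (fun _ => _) = f)//.
by rewrite diff_lin//; exact: coord_continuous.
Qed.

Lemma class_C_coord k U j : class_C k U (fun x : 'rV[R]_n => x 0 j).
Proof.
case: k => [|k] /=; first by move=> x _; exact: coord_continuous.
split=> [x _|v]; first exact: differentiable_coord.
rewrite (_ : (fun _ => _) = cst (v 0 j)); first exact: class_C_cst.
by apply/funext => x; rewrite derive_coord.
Qed.

End mul.

Lemma row_norm_le n (x : 'rV[R]_n) c :
  0 <= c -> (forall j, `|x 0 j| <= c) -> `|x| <= c.
Proof.
move=> c0 H; rewrite [leLHS]/Num.Def.normr/= mx_normrE (bigmax_le _ c0)//=.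
by move=> [i j] _ /=; rewrite ord1.
Qed.

Lemma row_coord_norm n (x : 'rV[R]_n) j : `|x 0 j| <= `|x|.
Proof.
rewrite [leRHS]/Num.Def.normr/= mx_normrE.
by apply: le_trans; last exact: (le_bigmax _ _ (0, j)).
Qed.

Lemma cvg_row (T : Type) (F : set_system T) {FF : Filter F} n
    (f : T -> 'rV[R]_n) (l : 'rV[R]_n) :
  (forall j, f x 0 j @[x --> F] --> l 0 j) -> f @ F --> l.
Proof.
move=> H; apply/cvgrPdist_le => e e0.
near=> x; apply: row_norm_le; first exact: ltW.
move=> j; rewrite !mxE; move: j; near: x; apply: filter_forall => j.
exact: ((cvgrPdist_le _ _).1 (H j)).
Unshelve. all: by end_near. Qed.

Lemma rowE_delta n (x : 'rV[R]_n) : x = \sum_j x 0 j *: delta_mx 0 j.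
Proof. by rewrite [LHS]row_sum_delta. Qed.

Lemma differentiable_row (V : normedModType R) n (f : V -> 'rV[R]_n) x :
  (forall j, differentiable (fun y => f y 0 j) x) -> differentiable f x.
Proof.
move=> H.
rewrite (_ : f = \sum_(j < n) (fun y => f y 0 j *: delta_mx 0 j)).
  by apply: differentiable_sum => j; exact: differentiableZl.
by apply/funext => y; rewrite fct_sumE -rowE_delta.
Qed.

Lemma diff_sum_partial n (W : normedModType R) (f : 'rV[R]_n -> W) x v :
  differentiable f x ->
  'D_v f x = \sum_j v 0 j *: 'D_(delta_mx 0 j) f x.
Proof.
move=> df; rewrite deriveE// {1}(rowE_delta v) linear_sum/=.
by apply: eq_bigr => j _; rewrite linearZ/= deriveE.
Qed.

Lemma derive_row (V : normedModType R) n (f : V -> 'rV[R]_n) x v j :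
  differentiable f x -> ('D_v f x) 0 j = 'D_v (fun y => f y 0 j) x.
Proof. by move=> df; rewrite derive_mx ?mxE//; exact: diff_derivable. Qed.

Lemma derive_chain (V : normedModType R) n (W : normedModType R)
    (f : V -> 'rV[R]_n) (g : 'rV[R]_n -> W) x v :
  differentiable f x -> differentiable g (f x) ->
  'D_v (g \o f) x
    = \sum_j 'D_v (fun y => f y 0 j) x *: 'D_(delta_mx 0 j) g (f x).
Proof.
move=> df dg; rewrite deriveE; last exact: differentiable_comp.
rewrite diff_comp//= -!deriveE// diff_sum_partial//.
by apply: eq_bigr => j _; rewrite derive_row.
Qed.

(** By the chain rule a directional derivative of the composite is a sum of
    products of derivatives of the coordinates of [f] by composites of partial
    derivatives of [g]; the induction on [k] therefore runs over all [g]. *)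
Lemma class_C_comp k n p (U : set 'rV[R]_n) (V : set 'rV[R]_p)
    (f : 'rV[R]_n -> 'rV[R]_p) (g : 'rV[R]_p -> R) :
  open U -> open V -> (forall x, U x -> V (f x)) ->
  (forall j, class_C k U (fun x => f x 0 j)) -> class_C k V g ->
  class_C k U (g \o f).
Proof.
move=> oU oV UV; elim: k g => [|k IH] g Cf Cg.
  move=> x Ux; apply: continuous_comp; last exact: Cg (UV _ Ux).
  by apply: (@cvg_row _ _ (nbhs_filter x)) => j; exact: (Cf j x Ux).
have df x : U x -> differentiable f x.
  by move=> Ux; apply: differentiable_row => j; have [d _] := Cf j; exact: d.
have [dg Dg] := Cg.
split=> [x Ux|v].
  by apply: differentiable_comp; [exact: df|exact: dg (UV _ Ux)].
apply: (@class_C_ext _ _ _ _ (fun x => \sum_j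
   ((fun x => 'D_v (fun y => f y 0 j) x) * ('D_(delta_mx 0 j) g \o f)) x)) => //.
  by move=> x Ux; rewrite derive_chain//; [exact: df|exact: dg (UV _ Ux)].
apply: class_C_sum => // j _; apply: class_C_mul => //.
  by have [_] := Cf j; exact.
by apply: IH; [move=> i; exact: class_CW|exact: Dg].
Qed.

Lemma class_C_row k n p (U : set 'rV[R]_n) (f : 'rV[R]_n -> 'rV[R]_p) j :
  open U -> class_C k U f -> class_C k U (fun x => f x 0 j).
Proof.
move=> oU; elim: k f => [|k IH] f /=.
  move=> Cf x Ux.
  apply: (@continuous_comp _ _ _ f (fun y : 'rV[R]_p => y 0 j)); first exact: Cf.
  exact: coord_continuous.
move=> [df Df]; split=> [x Ux|v].
  apply: (@differentiable_comp _ _ _ _ f (fun y : 'rV[R]_p => y 0 j)).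
    exact: df.
  exact: differentiable_coord.
apply: class_C_ext (IH _ (Df v)) => // x Ux.
by rewrite derive_row//; exact: df.
Qed.

End ClassC.

(** * Mean values and mixed derivatives *)

Section MeanValue.
Variable R : realType.

Lemma near_distP (V : normedModType R) (x : V) (P : V -> Prop) :
  (\forall y \near x, P y) <->
  exists2 r : R, 0 < r & forall y, `|y - x| <= r -> P y.
Proof.
split=> [/nbhs_normP[r /= r0 Hr]|[r r0 Hr]].
  exists (r / 2); first by rewrite divr_gt0.
  move=> y yr; apply: Hr => /=; rewrite distrC (le_lt_trans yr)//.
  by rewrite ltr_pdivrMr// mulr_natr mulr2n ltrDl.
apply/nbhs_normP; exists r => //= y /= yr; apply: Hr.
by rewrite distrC ltW.
Qed.

Lemma rV_nearP n (x : 'rV[R]_n) (P : 'rV[R]_n -> Prop) :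
  (\forall y \near x, P y) <->
  exists2 r : R, 0 < r & forall y, `|y - x| <= r -> P y.
Proof. exact: near_distP. Qed.

Lemma R_nearP (x : R) (P : R -> Prop) :
  (\forall y \near x, P y) <->
  exists2 r : R, 0 < r & forall y, `|y - x| <= r -> P y.
Proof. exact: near_distP. Qed.

Lemma rV_near_forall (I : finType) n (x : 'rV[R]_n) (P : I -> 'rV[R]_n -> Prop) :
  (forall j, \forall y \near x, P j y) -> \forall y \near x, forall j, P j y.
Proof. by move=> H; exact: (@filter_forall _ _ P _ _ H). Qed.

Lemma R_near_forall (I : finType) (x : R) (P : I -> R -> Prop) :
  (forall j, \forall y \near x, P j y) -> \forall y \near x, forall j, P j y.
Proof. by move=> H; exact: (@filter_forall _ _ P _ _ H). Qed.

Lemma is_derive_line (V : normedModType R) (f : V -> R) (x v : V) (t : R) :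
  differentiable f (x + t *: v) ->
  is_derive t 1 (fun s => f (x + s *: v)) ('D_v f (x + t *: v)).
Proof.
move=> df.
have dl : is_diff t (fun s : R => x + s *: v) ( *:%R^~ v).
  by apply: is_diff_eq; rewrite add0r.
have dc : differentiable (f \o (fun s : R => x + s *: v)) t.
  by apply: differentiable_comp => //; case: dl.
apply: DeriveDef; first exact/derivable1_diffP.
by rewrite deriveE// diff_comp//= ?diff_val/= ?scale1r ?deriveE//; case: dl.
Qed.

Lemma line_MVT (V : normedModType R) (f : V -> R) (x v : V) :
  (forall t, 0 <= t <= 1 -> differentiable f (x + t *: v)) ->
  exists2 t, 0 < t < 1 & f (x + v) - f x = 'D_v f (x + t *: v).
Proof.
move=> df.
have [||t] := @MVT R (fun s => f (x + s *: v)) (fun t => 'D_v f (x + t *: v))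
  0 1 ltr01.
- move=> t; rewrite in_itv/= => /andP[t0 t1]; apply: is_derive_line.
  by apply: df; rewrite !ltW.
- apply: derivable_within_continuous => t; rewrite in_itv/= => t01.
  by have [] := is_derive_line (df _ t01).
rewrite in_itv/= scale1r scale0r addr0 subr0 mulr1 => t01 E.
by exists t.
Qed.

Lemma derive_scale (V W : normedModType R) (f : V -> W) (x v : V) (c : R) :
  differentiable f x -> 'D_(c *: v) f x = c *: 'D_v f x.
Proof. by move=> df; rewrite !deriveE// linearZ. Qed.

(** Two mean values, along [u] for [y |-> f (y + s *: v) - f y], then along [v].
    The left-hand side is symmetric in [u] and [v], so that both mixed
    derivatives occur in this way. *)
Lemma second_difference (V : normedModType R) (f : V -> R) (x u v : V) r s :
  0 < s ->
  (forall y, `|y - x| <= r -> differentiable f y) ->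
  (forall y, `|y - x| <= r -> differentiable ('D_u f) y) ->
  s * (`|u| + `|v|) <= r ->
  exists2 z, `|z - x| <= s * (`|u| + `|v|) &
    f (x + s *: u + s *: v) - f (x + s *: u) - (f (x + s *: v) - f x)
      = s ^+ 2 * 'D_v ('D_u f) z.
Proof.
move=> s0 df dDf sr.
have bnd a b : 0 <= a <= 1 -> 0 <= b <= 1 ->
    `|x + a *: (s *: u) + b *: (s *: v) - x| <= s * (`|u| + `|v|).
  move=> /andP[a0 a1] /andP[b0 b1].
  rewrite addrAC (addrAC x) subrr add0r (le_trans (ler_normD _ _))//.
  rewrite !normrZ (ger0_norm a0) (ger0_norm b0) (gtr0_norm s0) mulrDr.
  by apply: lerD; rewrite ler_piMl// mulr_ge0// ltW.
have c01 : 0 <= (1 : R) <= 1 by rewrite ler01 lexx.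
have c00 : 0 <= (0 : R) <= 1 by rewrite ler01 lexx.
pose phi y := f (y + s *: v) - f y.
have dphi t : 0 <= t <= 1 ->
    is_diff (x + t *: (s *: u)) phi
      ('d f (x + t *: (s *: u) + s *: v) \- 'd f (x + t *: (s *: u))).
  move=> t01.
  have d1 : differentiable f (x + t *: (s *: u) + s *: v).
    by apply: df; rewrite -[s *: v]scale1r (le_trans _ sr)// bnd.
  have d2 : differentiable f (x + t *: (s *: u)).
    apply: df; have := bnd _ 0 t01 c00.
    by rewrite scale0r addr0 => /le_trans; apply.
  have ds : is_diff (x + t *: (s *: u)) (fun y => y + s *: v) id.
    by apply: is_diff_eq; rewrite addr0.
  have dc : is_diff (x + t *: (s *: u)) (fun y => f (y + s *: v))
      ('d f (x + t *: (s *: u) + s *: v)).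
    have dd : differentiable (f \o (fun y => y + s *: v)) (x + t *: (s *: u)).
      by apply: differentiable_comp => //; case: ds.
    apply: DiffDef => //.
    by rewrite diff_comp//= ?diff_val//; case: ds.
  have dd : differentiable phi (x + t *: (s *: u)).
    by apply: (@differentiableB _ _ _ (fun y => f (y + s *: v)) f).
  apply: DiffDef => //.
  rewrite (@diffB _ _ _ (fun y => f (y + s *: v)) f)//.
  by rewrite [X in X \- _]diff_val.
have [|t t01 E1] := @line_MVT V phi x (s *: u).
  by move=> t /dphi [].
have t01' : 0 <= t <= 1 by case/andP: t01 => *; rewrite !ltW.
have d1 : differentiable f (x + t *: (s *: u) + s *: v).
  by apply: df; rewrite -[s *: v]scale1r (le_trans _ sr)// bnd.
have d2 : differentiable f (x + t *: (s *: u)).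
  apply: df; have := bnd _ 0 t01' c00.
  by rewrite scale0r addr0 => /le_trans; apply.
have [|t' t01'' E2] := @line_MVT V ('D_u f) (x + t *: (s *: u)) (s *: v).
  by move=> t' t'01; apply: dDf; rewrite (le_trans _ sr)// bnd.
have t01b : 0 <= t' <= 1 by case/andP: t01'' => *; rewrite !ltW.
exists (x + t *: (s *: u) + t' *: (s *: v)); first exact: bnd.
rewrite -/(phi (x + s *: u)) -/(phi x) E1.
have -> : 'D_(s *: u) phi (x + t *: (s *: u))
    = s * ('D_u f (x + t *: (s *: u) + s *: v) - 'D_u f (x + t *: (s *: u))).
  have [dp Dp] := dphi _ t01'.
  by rewrite deriveE// Dp/= -!deriveE// !derive_scale// mulrBr.
rewrite E2 derive_scale ?mulrA//.
by apply: dDf; rewrite (le_trans _ sr)// bnd.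
Qed.

(** Divided by [s ^+ 2], the second difference of steps [s] is a value of both
    mixed derivatives, at points that tend to [x] with [s]. *)
Lemma derive_comm n (U : set 'rV[R]_n) (f : 'rV[R]_n -> R) (x u v : 'rV[R]_n) :
  open U -> U x -> class_C 2 U f -> 'D_v ('D_u f) x = 'D_u ('D_v f) x.
Proof.
move=> oU Ux [df Df]; have [dDu cu] := Df u; have [dDv cv] := Df v.
apply/eqP; rewrite -subr_eq0; apply/eqP; apply/normr0_eq0/le_anti.
rewrite normr_ge0 andbT; apply/ler_addgt0Pl => e e0; rewrite addr0.
have e20 : 0 < e / 2 by rewrite divr_gt0.
have H1 : \forall y \near x, `|'D_v ('D_u f) x - 'D_v ('D_u f) y| <= e / 2.
  by move/cvgrPdist_le: (cu v x Ux); apply.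
have H2 : \forall y \near x, `|'D_u ('D_v f) x - 'D_u ('D_v f) y| <= e / 2.
  by move/cvgrPdist_le: (cv u x Ux); apply.
have [r r0 Hr] : exists2 r : R, 0 < r & forall y, `|y - x| <= r ->
    [/\ U y, `|'D_v ('D_u f) x - 'D_v ('D_u f) y| <= e / 2 &
       `|'D_u ('D_v f) x - 'D_u ('D_v f) y| <= e / 2].
  by apply/rV_nearP; apply: filterS3 (open_near oU Ux) H1 H2 => y Uy h1 h2.
pose s := r / (`|u| + `|v| + 1).
have D0 : 0 < `|u| + `|v| + 1 by rewrite ltr_wpDl// addr_ge0.
have s0 : 0 < s by rewrite divr_gt0.
have sr : s * (`|u| + `|v|) <= r.
  by rewrite mulrAC ler_pdivrMr// ler_pM2l// lerDl.
have dfr y : `|y - x| <= r -> differentiable f y.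
  by move=> yr; have [Uy _ _] := Hr _ yr; exact: df.
have dDur y : `|y - x| <= r -> differentiable ('D_u f) y.
  by move=> yr; have [Uy _ _] := Hr _ yr; exact: dDu.
have dDvr y : `|y - x| <= r -> differentiable ('D_v f) y.
  by move=> yr; have [Uy _ _] := Hr _ yr; exact: dDv.
have [z1 z1r E1] := second_difference s0 dfr dDur sr.
have sr' : s * (`|v| + `|u|) <= r by rewrite (addrC `|v|).
have [z2 z2r E2] := second_difference s0 dfr dDvr sr'.
have E : 'D_v ('D_u f) z1 = 'D_u ('D_v f) z2.
  apply: (mulfI (lt0r_neq0 (exprn_gt0 2 s0))).
  apply: (etrans (esym E1)); apply: etrans E2.
  by rewrite (addrAC x (s *: v)); ring.
have [_ h1 _] := Hr _ (le_trans z1r sr).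
have [_ _ h2] := Hr _ (le_trans z2r sr').
have h2' : `|'D_v ('D_u f) z1 - 'D_u ('D_v f) x| <= e / 2 by rewrite E distrC.
move: h1 h2'.
move: ('D_v ('D_u f) x) ('D_v ('D_u f) z1) ('D_u ('D_v f) x) => A B C h1 h2'.
apply: le_trans (ler_distD B _ _) _; rewrite (splitr e).
exact: lerD.
Qed.

End MeanValue.

(** * Tangent vectors of level sets *)

Section LevelSet.
Variable R : realType.

Lemma compact_rball n (a : 'rV[R]_n) (r : R) : 0 <= r ->
  compact [set x : 'rV[R]_n | `|x - a| <= r].
Proof.
move=> r0.
rewrite (_ : [set _ | _] = [set v : 'rV[R]_n |
    forall i, v ord0 i \in `[a 0 i - r, a 0 i + r]%R]).
  apply: (@rV_compact _ _ (fun i => `[a 0 i - r, a 0 i + r]%classic)).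
  by move=> i; exact: segment_compact.
apply/seteqP; split=> x /= H.
  move=> i; rewrite in_itv/= -ler_distl.
  by have := row_coord_norm (x - a) i; rewrite !mxE => /le_trans; apply.
apply: row_norm_le => // j; have := H j.
by rewrite in_itv/= -ler_distl !mxE.
Qed.

(** The distance [`|S y - y|] reaches its minimum by compactness; the minimum is
    zero since [S] would halve it. *)
Lemma ball_fixpoint n (r : R) (S : 'rV[R]_n -> 'rV[R]_n) : 0 <= r ->
  (forall y z : 'rV[R]_n, `|y| <= r -> `|z| <= r -> `|S y - S z| <= 2^-1 * `|y - z|) ->
  (forall y : 'rV[R]_n, `|y| <= r -> `|S y| <= r) ->
  exists2 y, `|y| <= r & S y = y.
Proof.
move=> r0 lipS Sr; pose B := [set x : 'rV[R]_n | `|x - 0| <= r].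
have BE y : B y <-> `|y| <= r by rewrite /B/= subr0.
have B0 : B !=set0 by exists 0; rewrite BE normr0.
have cg : {within B, continuous (fun y => `|S y - y|)}.
  apply/subspace_continuousP => y By; apply/cvgrPdist_le => e e0.
  rewrite near_withinE.
  suff H : \forall z \near y, B z ->
      `| `|S y - y| - `|S z - z| | <= e by exact: H.
  apply/rV_nearP; exists (e / 2).
    by rewrite divr_gt0.
  move=> z zd Bz.
  apply: (le_trans (ler_dist_dist _ _)).
  rewrite opprB (addrC z) addrACA (addrC (- y)) (splitr e).
  apply: (le_trans (ler_normD _ _)); apply: lerD => //.
  apply: le_trans (lipS _ _ _ _) _; [exact/BE|exact/BE|].
  rewrite distrC (le_trans _ zd)// ler_piMl// invf_le1//.
  by rewrite ler1n.
have [c] := EVT_min_rV B0 (compact_rball r0) cg.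
move=> /set_mem/BE cB minc; exists c => //; apply/eqP.
rewrite -subr_eq0 -normr_eq0; apply/negP => /negP Sc.
have : `|S c - c| <= `|S (S c) - S c|.
  by apply: minc; apply/mem_set/BE; exact: Sr.
move=> /le_trans /(_ (lipS _ _ (Sr _ cB) cB)).
by rewrite leNgt gtr_pMl ?invf_lt1 ?ltr1n// normr_gt0 -normr_eq0.
Qed.

Lemma mulmx_norm_le m n (y : 'rV[R]_m) (A : 'M[R]_(m, n)) :
  `|y *m A| <= `|y| * \sum_j `|row j A|.
Proof.
rewrite mulmx_sum_row (le_trans (ler_norm_sum _ _ _))// mulr_sumr.
by apply: ler_sum => j _; rewrite normrZ ler_wpM2r// row_coord_norm.
Qed.

Lemma derive_mulmx m n (f : 'rV[R]_n -> R) x (y : 'rV[R]_m) (A : 'M[R]_(m, n)) :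
  differentiable f x ->
  'D_(y *m A) f x = \sum_j y 0 j * 'D_(row j A) f x.
Proof.
move=> df; rewrite mulmx_sum_row deriveE// linear_sum/=.
by apply: eq_bigr => j _; rewrite linearZ/= -deriveE.
Qed.

(** When [u] is tangent to the level set of the [A k] through [x0], the point
    [x0 + t *: u] is at distance [o(t)] from this level set: a correction in the
    transverse directions [row j V] is the fixed point of the Newton map with
    derivative frozen at [x0], a contraction whose initial error is [o(t)]. *)
Lemma level_set_solve m n (U : set 'rV[R]_n) (A : 'I_m -> 'rV[R]_n -> R)
    (V : 'M[R]_(m, n)) x0 (u : 'rV[R]_n) :
  open U -> U x0 -> (forall k, class_C 1 U (A k)) ->
  (forall j k, 'D_(row j V) (A k) x0 = (j == k)%:R) ->
  (forall k, 'D_u (A k) x0 = 0) ->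
  forall e : R, 0 < e -> \forall t \near (0 : R),
    exists2 y : 'rV[R]_m, `|y| <= e * `|t| &
      forall k, A k (x0 + t *: u + y *m V) = A k x0.
Proof.
move=> oU Ux CA DV Du e e0.
have dA k x : U x -> differentiable (A k) x by have [+ _] := CA k; exact.
(* [q] makes the sum of [m] error terms at most one half *)
pose q : R := (2 * (m%:R + 1))^-1.
have q0 : 0 < q by rewrite invr_gt0 mulr_gt0// ltr_wpDl.
have [r r0 Hr] : exists2 r, 0 < r & forall x, `|x - x0| <= r ->
    U x /\ forall j k, `|(j == k)%:R - 'D_(row j V) (A k) x| <= q.
  apply/rV_nearP; apply: filter_app (open_near oU Ux).
  have H : \forall x \near x0, forall j k,
      `|(j == k)%:R - 'D_(row j V) (A k) x| <= q.
    apply: rV_near_forall => j; apply: rV_near_forall => k.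
    rewrite -(DV j k).
    have [_ /(_ (row j V) x0 Ux)] := CA k.
    by move/cvgrPdist_le; apply.
  by apply: filterS H => x H Ux'; split.
(* the map whose fixed points solve the equation, for a fixed time t *)
pose S t (y : 'rV[R]_m) : 'rV[R]_m :=
  \row_k (y 0 k - (A k (x0 + t *: u + y *m V) - A k x0)).
pose K := \sum_j `|row j V|.
have K0 : 0 <= K by apply: sumr_ge0.
have small t y : `|t| * `|u| <= r / 2 -> `|y| * K <= r / 2 ->
    `|x0 + t *: u + y *m V - x0| <= r.
  move=> ht hy; rewrite addrAC (addrAC x0) subrr add0r.
  rewrite (le_trans (ler_normD _ _))// (splitr r) lerD ?normrZ//.
  exact: le_trans (mulmx_norm_le _ _) hy.
have lipS t y z : `|t| * `|u| <= r / 2 ->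
    `|y| * K <= r / 2 -> `|z| * K <= r / 2 ->
    `|S t y - S t z| <= 2^-1 * `|y - z|.
  move=> ht hy hz; apply: row_norm_le; first by rewrite mulr_ge0.
  move=> k; rewrite !mxE.
  pose p s := x0 + t *: u + z *m V + s *: ((y - z) *m V).
  have pE s : p s = x0 + t *: u + (z + s *: (y - z)) *m V.
    by rewrite /p (mulmxDl z) -scalemxAl addrA.
  have pU s : 0 <= s <= 1 -> `|p s - x0| <= r.
    move=> /andP[s0 s1]; rewrite pE; apply: small => //.
    have -> : z + s *: (y - z) = (1 - s) *: z + s *: y.
      by rewrite scalerBr scalerBl scale1r addrA addrAC.
    apply: (@le_trans _ _ ((1 - s) * (`|z| * K) + s * (`|y| * K))).
      rewrite !mulrA -mulrDl ler_wpM2r// (le_trans (ler_normD _ _))//.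
      by rewrite !normrZ (ger0_norm s0) ger0_norm// subr_ge0.
    apply: (@le_trans _ _ ((1 - s) * (r / 2) + s * (r / 2))).
      by apply: lerD; apply: ler_wpM2l => //; rewrite subr_ge0.
    by rewrite -mulrDl subrK mul1r.
  have [s s01|s /andP[s0 s1] E] :=
      @line_MVT R _ (A k) (x0 + t *: u + z *m V) ((y - z) *m V).
    by apply: dA; have [] := Hr _ (pU s s01).
  have s01 : 0 <= s <= 1 by rewrite !ltW.
  have [Up HD] := Hr _ (pU s s01).
  have Ey : x0 + t *: u + z *m V + (y - z) *m V = x0 + t *: u + y *m V.
    by rewrite -addrA -mulmxDl (addrC z) subrK.
  move: E; rewrite Ey derive_mulmx; last exact: dA.
  rewrite -/(p s) => E.
  have -> : y 0 k - (A k (x0 + t *: u + y *m V) - A k x0)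
     - (z 0 k - (A k (x0 + t *: u + z *m V) - A k x0))
     = (y - z) 0 k - (A k (x0 + t *: u + y *m V) - A k (x0 + t *: u + z *m V)).
    by rewrite !mxE; ring.
  rewrite E.
  have -> : (y - z) 0 k = \sum_j (y - z) 0 j * (j == k)%:R.
    rewrite (bigD1 k)//= eqxx mulr1 big1 ?addr0// => j /negPf ->.
    by rewrite mulr0.
  rewrite -sumrB (le_trans (ler_norm_sum _ _ _))//.
  apply: (@le_trans _ _ (\sum_(j < m) `|y - z| * q)).
    apply: ler_sum => j _; rewrite -mulrBr normrM ler_pM//.
    exact: row_coord_norm.
  rewrite sumr_const card_ord -mulrnAr mulrC ler_wpM2r//.
  rewrite /q -mulr_natl invfM mulrCA ler_piMr ?invr_ge0//.
  by rewrite ler_pdivrMr ?mul1r ?lerDl// ltr_wpDl.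
(* the initial error is o(t), since u is tangent to the level sets *)
have S0 : \forall t \near (0 : R), `|S t 0| <= e / 2 * `|t|.
  have H : \forall t \near (0 : R), forall k,
      `|A k (x0 + t *: u) - A k x0| <= e / 2 * `|t|.
    apply: R_near_forall => k.
    have [dl Dl] : is_derive (0 : R) (1 : R) (fun t => A k (x0 + t *: u)) 0.
      have := @is_derive_line R _ (A k) x0 u 0; rewrite scale0r addr0 Du.
      by apply; exact: dA.
    have e20 : 0 < e / 2 by rewrite divr_gt0.
    have := differentiable_eps ((derivable1_diffP _ _).1 dl) e20.
    apply: filterS => t; rewrite addr0 scale0r addr0.
    rewrite (_ : 'd _ _ t = 0) ?addr0//.
    rewrite deriv1E//= derive1E Dl.
    by rewrite scaler0.
  apply: filterS H => t H; apply: row_norm_le; first by rewrite mulr_ge0// ltW// divr_gt0.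
  by move=> k; rewrite !mxE mul0mx addr0 sub0r normrN.
have T1 : \forall t \near (0 : R), `|t| * `|u| <= r / 2.
  apply/R_nearP; exists (r / 2 / (`|u| + 1)).
    by rewrite !divr_gt0// ltr_wpDl.
  move=> t; rewrite subr0 ler_pdivlMr ?ltr_wpDl// mulrDr mulr1.
  by apply: le_trans; rewrite lerDl.
have eK : 0 < e * K + 1 by rewrite ltr_wpDl// mulr_ge0// ltW.
have T2 : \forall t \near (0 : R), e * `|t| * K <= r / 2.
  apply/R_nearP; exists (r / 2 / (e * K + 1)).
    by rewrite !divr_gt0.
  move=> t; rewrite subr0 ler_pdivlMr// mulrDr mulr1.
  apply: le_trans; rewrite -[leLHS]addr0 lerD//.
  by rewrite mulrAC [leRHS]mulrC.
near=> t.
have t1 : `|t| * `|u| <= r / 2 by near: t; exact: T1.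
have t2 : e * `|t| * K <= r / 2 by near: t; exact: T2.
have t3 : `|S t 0| <= e / 2 * `|t| by near: t; exact: S0.
have et0 : 0 <= e * `|t| by rewrite mulr_ge0// ltW.
have inK (y : 'rV[R]_m) : `|y| <= e * `|t| -> `|y| * K <= r / 2.
  by move=> h; apply: le_trans t2; rewrite ler_wpM2r.
have [y z hy hz|y hy|y yr Sy] := @ball_fixpoint m (e * `|t|) (S t) et0.
- by apply: lipS => //; exact: inK.
- have h0 : `|0 : 'rV[R]_m| <= e * `|t| by rewrite normr0.
  rewrite -(subrK (S t 0) (S t y)) (le_trans (ler_normD _ _))//.
  have -> : e * `|t| = 2^-1 * (e * `|t|) + e / 2 * `|t| by field.
  apply: lerD => //.
  apply: le_trans (lipS _ _ _ t1 (inK _ hy) (inK _ h0)) _.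
  by rewrite subr0 ler_wpM2l.
- exists y => // k; move/rowP/(_ k): Sy; rewrite mxE => /eqP.
  by rewrite subr_eq -subr_eq0 opprD addrA subrr add0r oppr_eq0 subr_eq0 => /eqP.
Unshelve. all: by end_near. Qed.

(** [F] vanishes at points [x0 + t *: u + o(t)] of the level set, hence so does
    its derivative along [u]. *)
Lemma level_set_tangent m n (U : set 'rV[R]_n) (A : 'I_m -> 'rV[R]_n -> R)
    (V : 'M[R]_(m, n)) x0 (u : 'rV[R]_n) (F : 'rV[R]_n -> R) :
  open U -> U x0 -> (forall k, class_C 1 U (A k)) ->
  (forall j k, 'D_(row j V) (A k) x0 = (j == k)%:R) ->
  (forall k, 'D_u (A k) x0 = 0) ->
  differentiable F x0 ->
  (\forall x \near x0, (forall k, A k x = A k x0) -> F x = 0) ->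
  'D_u F x0 = 0.
Proof.
move=> oU Ux CA DV Du dF F0.
have F00 : F x0 = 0 by exact: (nbhs_singleton F0).
pose K := \sum_j `|row j V|.
have K0 : 0 <= K by apply: sumr_ge0.
pose L := \sum_j `|'D_(row j V) F x0|.
have L0 : 0 <= L by apply: sumr_ge0.
suff H e : 0 < e -> e <= 1 -> `|'D_u F x0| <= e * (`|u| + K + L).
  apply/normr0_eq0/le_anti; rewrite normr_ge0 andbT.
  apply/ler_addgt0Pl => e e0; rewrite addr0.
  pose c := `|u| + K + L + 1.
  have c0 : 0 < c by rewrite ltr_wpDl// !addr_ge0.
  pose d := Num.min 1 (e / c).
  have d0 : 0 < d by rewrite lt_min ltr01 divr_gt0.
  have d1 : d <= 1 by rewrite ge_min lexx.
  have dc : d <= e / c by rewrite ge_min lexx orbT.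
  apply: (le_trans (H _ d0 d1)); move: dc; rewrite ler_pdivlMr//.
  by apply: le_trans; rewrite ler_wpM2l ?lerDl// ltW.
move=> e0 e1.
have [r r0 Hr] := (rV_nearP _ _).1 F0.
have [r' r'0 Hr'] := (rV_nearP _ _).1 (differentiable_eps dF e0).
have Hy := level_set_solve oU Ux CA DV Du e0.
have [s s0 Hs] := (R_nearP _ _).1 Hy.
pose M := `|u| + K + 1.
have M0 : 0 < M by rewrite ltr_wpDl// addr_ge0.
pose t := Num.min s (Num.min (r / M) (r' / M)).
have t0 : 0 < t by rewrite !lt_min s0 !divr_gt0.
have [|y hy Ay] := Hs t.
  by rewrite subr0 gtr0_norm// ge_min lexx.
rewrite (gtr0_norm t0) in hy.
have hb : `|t *: u + y *m V| <= t * (`|u| + K).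
  rewrite mulrDr (le_trans (ler_normD _ _))// lerD//.
    by rewrite normrZ gtr0_norm.
  apply: le_trans (mulmx_norm_le _ _) _; rewrite ler_wpM2r//.
  by rewrite (le_trans hy)// ler_piMl// ltW.
have tM c : t <= c / M -> t * (`|u| + K) <= c.
  rewrite ler_pdivlMr//; apply: le_trans.
  by rewrite ler_wpM2l ?lerDl// ltW.
have hr : `|t *: u + y *m V| <= r.
  by apply: le_trans hb _; apply: tM; rewrite !ge_min lexx orbT.
have hr' : `|t *: u + y *m V| <= r'.
  by apply: le_trans hb _; apply: tM; rewrite !ge_min lexx !orbT.
have F1 : F (t *: u + y *m V + x0) = 0.
  apply: Hr; first by rewrite addrK.
  by move=> k; rewrite addrC addrA Ay.
have := Hr' (t *: u + y *m V); rewrite subr0 => /(_ hr').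
rewrite F1 F00 sub0r add0r normrN linearD linearZ/= -!deriveE//.
rewrite derive_mulmx// => h.
have h2 : t * `|'D_u F x0| <= t * (e * (`|u| + K) + e * L).
  rewrite -{1}(gtr0_norm t0) -normrM.
  rewrite -[X in `|X|](addrK (\sum_j y 0 j * 'D_(row j V) F x0)).
  apply: (le_trans (ler_normB _ _)); rewrite mulrDr; apply: lerD.
    apply: (le_trans h); rewrite mulrCA ler_wpM2l//; exact: ltW.
  apply: (le_trans (ler_norm_sum _ _ _)).
  rewrite mulrA mulr_sumr; apply: ler_sum => j _.
  rewrite normrM ler_wpM2r// (le_trans (row_coord_norm _ _))//.
  by rewrite mulrC.
by move: h2; rewrite ler_pM2l// -mulrDr.
Qed.

End LevelSet.

(** * Bump functions *)

Section Bump.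
Variable R : realType.

(** This family contains the derivatives of [x |-> exp (- 1 / x)], extended by
    zero to [x <= 0]: it is stable by differentiation up to linear
    combinations, see [is_derive_flat]. *)
Definition flat (m : nat) (x : R) : R :=
  if 0 < x then x^-1 ^+ m * expR (- x^-1) else 0.

Lemma flat_le0 m x : x <= 0 -> flat m x = 0.
Proof. by rewrite /flat leNgt => /negPf ->. Qed.

Lemma flat_gt0 m x : 0 < x -> 0 < flat m x.
Proof.
by move=> x0; rewrite /flat x0 mulr_gt0 ?expR_gt0// exprn_gt0// invr_gt0.
Qed.

Lemma flat_ge0 m x : 0 <= flat m x.
Proof. by case: (leP x 0) => [/flat_le0 ->|/flat_gt0/ltW]. Qed.

(* [expR y >= y ^+ (m + 2) / (m + 2)`!] for [y = x^-1] *)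
Lemma flat_bound m x : flat m x <= (m.+2)`!%:R * x ^+ 2.
Proof.
case: (leP x 0) => x0; first by rewrite flat_le0// mulr_ge0// sqr_ge0.
rewrite /flat x0 expRN ler_pdivrMr ?expR_gt0//.
have y0 : 0 <= x^-1 by rewrite invr_ge0 ltW.
have h : x^-1 ^+ m.+2 / (m.+2)`!%:R <= expR x^-1.
  by apply: le_trans (expR_ge1Dxn m.+1 y0); rewrite lerDr.
have c0 : 0 <= (m.+2)`!%:R * x ^+ 2 by rewrite mulr_ge0// sqr_ge0.
apply: le_trans (ler_wpM2l c0 h).
rewrite mulrA -(mulrA _%:R) -[m.+2]add2n exprD (mulrA (x ^+ 2)) -exprMn.
rewrite mulfV ?gt_eqF// expr1n mul1r mulrAC mulfV ?mul1r//.
Qed.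

(** At the origin the derivative vanishes because [flat m] is bounded by a
    multiple of the square. *)
Lemma is_derive_flat m (x : R) :
  is_derive x (1 : R) (flat m) (flat m.+2 x - m%:R * flat m.+1 x).
Proof.
case: (ltgtP x 0) => [x0|x0|->].
- rewrite !flat_le0 1?ltW// mulr0 subr0.
  have dc := is_derive_cst (0 : R) x 1; apply: near_eq_is_derive dc.
  apply/R_nearP; exists (- x); first by rewrite oppr_gt0.
  move=> y; rewrite ler_distl subrr => /andP[_ y0].
  by rewrite flat_le0//; move: y0; rewrite addrN.
- have xn0 : x != 0 by rewrite gt_eqF.
  have dV : is_derive x (1 : R) (fun y : R => y^-1) (- x^-1 ^+ 2).
    apply: DeriveDef; first exact: derivableV.
    by rewrite deriveV// derive_id scaler1 exprVn.
  have dE : is_derive x (1 : R) (fun y : R => expR (- y^-1)) (x^-1 ^+ 2 * expR (- x^-1)).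
    have dN : is_derive x (1 : R) (fun y : R => - y^-1) (x^-1 ^+ 2).
      by have := is_deriveN dV; rewrite opprK.
    by have := @is_derive1_comp _ expR (fun y : R => - y^-1) x _ _
      (is_derive_expR _) dN; rewrite mulrC.
  have dX := is_deriveX m dV.
  have H : is_derive x (1 : R) (fun y : R => y^-1 ^+ m * expR (- y^-1))
      (flat m.+2 x - m%:R * flat m.+1 x).
    have [dM DM] := is_deriveM dX dE.
    have E : (fun y : R => y^-1 ^+ m * expR (- y^-1))
      = (fun y => y^-1) ^+ m * (fun y => expR (- y^-1)).
      by apply/funext => y; rewrite !fctE.
    rewrite E; apply: DeriveDef => //; rewrite DM /GRing.scale/= /flat x0.
    rewrite exprfctE.
    case: (m) => [|k]; first by rewrite expr0 mulr0n; ring.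
    by rewrite /= !exprS /=; ring.
  apply: near_eq_is_derive H.
  apply/R_nearP; exists (x / 2); first by rewrite divr_gt0.
  move=> y; rewrite ler_distl => /andP[h _].
  have y0 : 0 < y by apply: lt_le_trans h; lra.
  by rewrite /flat y0.
- rewrite !flat_le0// mulr0 subr0.
  have z0 : continuous (\0 : R -> R) by exact: cst_continuous.
  have [] := @differentiable_epsP R R R (flat m) 0 \0 z0.
    move=> e e0; apply/R_nearP; exists (e / (m.+2)`!%:R).
      by rewrite divr_gt0// ltr0n fact_gt0.
    move=> h; rewrite subr0 => hb.
    have -> : flat m (h + 0) - (flat m 0 + \0 h) = flat m h.
      by rewrite addr0 (@flat_le0 m 0)//= addr0 subr0.
    rewrite ger0_norm ?flat_ge0// (le_trans (flat_bound _ _))//.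
    rewrite -real_normK ?num_real// expr2 mulrA ler_wpM2r//.
    by move: hb; rewrite ler_pdivlMr ?ltr0n ?fact_gt0// mulrC.
  move=> df dE; apply: DeriveDef; first exact/derivable1_diffP.
  by rewrite deriveE// dE.
Qed.

Section comp.
Variable n : nat.
Implicit Types (U : set 'rV[R]_n) (g : 'rV[R]_n -> R).

Lemma derive_comp1 (f : R -> R) f' g x v :
  is_derive (g x) (1 : R) f f' -> differentiable g x ->
  differentiable (f \o g) x /\ 'D_v (f \o g) x = f' * 'D_v g x.
Proof.
move=> [df Df] dg; have dfd := (derivable1_diffP _ _).1 df.
have dc : differentiable (f \o g) x by exact: differentiable_comp.
split => //; rewrite deriveE// diff_comp//= (deriv1E df) derive1E Df -deriveE//.
by rewrite /GRing.scale/= mulrC.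
Qed.

Lemma class_C_flat k m U g : open U -> class_C k U g ->
  class_C k U (flat m \o g).
Proof.
move=> oU; elim: k m g => [|k IH] m g Cg.
  move=> x Ux; apply: continuous_comp; first exact: Cg.
  have [d _] := is_derive_flat m (g x).
  exact/differentiable_continuous/derivable1_diffP.
have [dg Dg] := Cg; split=> [x Ux|v].
  by have [] := derive_comp1 0 (is_derive_flat m (g x)) (dg x Ux).
pose h := (flat m.+2 \o g) + cst (- m%:R) * (flat m.+1 \o g).
apply: (@class_C_ext _ _ _ _ _ (h * 'D_v g)) => //.
  move=> x Ux; have [_ ->] := derive_comp1 v (is_derive_flat m (g x)) (dg x Ux).
  by rewrite /h !fctE/= mulNr.
apply: class_C_mul => //; last exact: Dg.
apply: class_C_add => //.
  by apply: IH; exact: class_CW.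
apply: class_C_mul => //; first exact: class_C_cst.
by apply: IH; exact: class_CW.
Qed.

Lemma class_C_inv k U g : open U -> (forall x, U x -> g x != 0) ->
  class_C k U g -> class_C k U (fun x => (g x)^-1).
Proof.
move=> oU g0; elim: k => [|k IH] Cg.
  by move=> x Ux; apply: continuousV; [exact: g0|exact: Cg].
have [dg Dg] := Cg.
split=> [x Ux|v].
  by apply: differentiableV; [exact: dg|exact: g0].
pose h := cst (-1) * ((fun x => (g x)^-1) * (fun x => (g x)^-1)).
apply: (@class_C_ext _ _ _ _ _ (h * 'D_v g)) => //.
  move=> x Ux; rewrite deriveV ?g0//; last exact/diff_derivable/dg.
  by rewrite /h !fctE/= mulN1r -invfM expr2.
have Ci := IH (class_CW Cg).
apply: class_C_mul => //; last exact: Dg.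
by apply: class_C_mul => //; [exact: class_C_cst|exact: class_C_mul].
Qed.

End comp.

(** The bump is [A / (A + B)], where [A] is positive exactly in the Euclidean
    ball of radius [r] and [B] exactly outside the closed ball of radius
    [r / 2]. *)
Lemma exists_bump n (a : 'rV[R]_n) (r : R) : 0 < r ->
  exists b : 'rV[R]_n -> R, [/\ smooth_on setT b,
    exists2 r' : R, 0 < r' & forall x, `|x - a| <= r' -> b x = 1 &
    forall x, b x != 0 -> `|x - a| <= r].
Proof.
move=> r0.
pose s (x : 'rV[R]_n) := \sum_j (x 0 j - a 0 j) ^+ 2.
have Cs k : class_C k setT s.
  apply: class_C_sum => [|j _]; first exact: openT.
  apply: (@class_C_ext _ _ _ _ _ (((fun x => x 0 j) + cst (- a 0 j)) *
    ((fun x => x 0 j) + cst (- a 0 j)))) => //; first exact: openT.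
  have C1 : class_C k setT ((fun x : 'rV[R]_n => x 0 j) + cst (- a 0 j)).
    apply: class_C_add; first exact: openT.
      exact: class_C_coord.
    exact: class_C_cst.
  by apply: class_C_mul => //; exact: openT.
pose A x := flat 0 (r ^+ 2 - s x).
pose B x := flat 0 (s x - r ^+ 2 / 4).
have CA k : class_C k setT A.
  apply: (@class_C_flat _ k 0 setT (fun x => r ^+ 2 - s x)); first exact: openT.
  apply: (@class_C_add _ _ _ _ _ (cst (r ^+ 2)) (- s)); first exact: openT.
    exact: class_C_cst.
  by apply: class_C_opp; [exact: openT|exact: Cs].
have CB k : class_C k setT B.
  apply: (@class_C_flat _ k 0 setT (fun x => s x - r ^+ 2 / 4)).
    exact: openT.
  apply: (@class_C_add _ _ _ _ _ s (cst (- (r ^+ 2 / 4)))); first exact: openT.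
    exact: Cs.
  exact: class_C_cst.
have AB x : 0 < A x + B x.
  case: (ltP (s x) (r ^+ 2)) => h.
    by rewrite ltr_wpDr ?flat_ge0// flat_gt0// subr_gt0.
  rewrite ltr_wpDl ?flat_ge0// flat_gt0// subr_gt0 (lt_le_trans _ h)//.
  by rewrite ltr_pdivrMr// ltr_pMr ?exprn_gt0// ltr1n.
exists (fun x => A x * (A x + B x)^-1); split.
- move=> k; apply: (@class_C_mul _ _ _ _ A (fun x => (A x + B x)^-1)) => //.
    exact: openT.
  apply: class_C_inv; first exact: openT.
    by move=> x _; rewrite gt_eqF.
  by apply: class_C_add; [exact: openT|exact: CA|exact: CB].
(* a ball for the maximum norm inside the Euclidean ball of radius [r / 2] *)
- exists (r / 2 / (n%:R + 1)).
    by rewrite !divr_gt0// ltr_wpDl.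
  move=> x hx; have B0 : B x = 0.
    rewrite /B flat_le0// subr_le0.
    have h j : (x 0 j - a 0 j) ^+ 2 <= (r / 2 / (n%:R + 1)) ^+ 2.
      rewrite -real_normK ?num_real// lerXn2r ?nnegrE//.
        by rewrite !divr_ge0// ltW.
      by have := row_coord_norm (x - a) j; rewrite !mxE => /le_trans; apply.
    apply: le_trans (ler_sum _ (fun j _ => h j)) _.
    rewrite sumr_const card_ord -[leLHS]mulr_natl !exprMn.
    have -> : r ^+ 2 / 4 = r ^+ 2 * 2^-1 ^+ 2 by rewrite exprVn; field.
    rewrite mulrCA ler_piMr ?mulr_ge0 ?sqr_ge0 ?exprn_ge0 ?(ltW r0)//.
    rewrite exprVn ler_pdivrMr ?exprn_gt0 ?ltr_wpDl// mul1r.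
    rewrite sqrrD mulr1 expr1n; have n0 : 0 <= n%:R :> R by [].
    have := sqr_ge0 (n%:R : R); lra.
  by rewrite B0 addr0 mulfV// gt_eqF//; have := AB x; rewrite B0 addr0.
- move=> x; apply: contra_neqT; rewrite -ltNge => hx.
  suff -> : A x = 0 by rewrite mul0r.
  rewrite /A flat_le0// subr_le0.
  have : exists j, r < `|(x - a) 0 j|.
    apply/existsP; apply: contraTT hx; rewrite negb_exists => /forallP h.
    rewrite -leNgt; apply: row_norm_le; first exact: ltW.
    by move=> j; rewrite leNgt h.
  move=> [j]; rewrite !mxE => hj.
  rewrite /s (bigD1 j)//= -[leLHS]addr0 lerD//; last first.
    by apply: sumr_ge0 => i _; exact: sqr_ge0.
  by rewrite -(real_normK (num_real (x 0 j - a 0 j))) lerXn2r ?nnegrE// ltW.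
Qed.

End Bump.

(** * Hadamard's lemma *)

Section Hadamard.
Variable R : realType.
Local Notation mu := lebesgue_measure.

Definition int01 (f : R -> R) : R := (\int[mu]_(t in `[0%R, 1%R]) f t)%R.
Definition cont01 (f : R -> R) : Prop :=
  forall t, 0 <= t <= 1 -> {for t, continuous f}.

Lemma cont01_within f : cont01 f -> {within `[0 : R, 1], continuous f}.
Proof.
move=> cf; apply: continuous_in_subspaceT => t; rewrite inE/= in_itv/=.
exact: cf.
Qed.

Lemma cont01_integrable f : cont01 f ->
  mu.-integrable (`[0%R, 1%R] : set R) (EFin \o f).
Proof.
move=> cf; apply: continuous_compact_integrable; first exact: segment_compact.
exact: cont01_within.
Qed.

Lemma cont01D f g : cont01 f -> cont01 g -> cont01 (fun t => f t + g t).
Proof. by move=> cf cg t t01; apply: continuousD; [exact: cf|exact: cg]. Qed.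

Lemma cont01M f g : cont01 f -> cont01 g -> cont01 (fun t => f t * g t).
Proof. by move=> cf cg t t01; apply: continuousM; [exact: cf|exact: cg]. Qed.

Lemma cont01_cst c : cont01 (fun=> c).
Proof. by move=> t _; exact: cst_continuous. Qed.

Lemma cont01Z c f : cont01 f -> cont01 (fun t => c * f t).
Proof. by move=> cf; apply: cont01M => //; exact: cont01_cst. Qed.

Lemma cont01X l : cont01 (fun t => t ^+ l).
Proof. by move=> t _; exact: exprn_continuous. Qed.

Lemma int01D f g : cont01 f -> cont01 g ->
  int01 (fun t => f t + g t) = int01 f + int01 g.
Proof.
by move=> cf cg; rewrite /int01 RintegralD//; exact: cont01_integrable.
Qed.

Lemma int01Z c f : cont01 f -> int01 (fun t => c * f t) = c * int01 f.
Proof. by move=> cf; rewrite /int01 RintegralZl//; exact: cont01_integrable. Qed.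

Lemma cont01_sum (I : Type) (r : seq I) (F : I -> R -> R) :
  (forall i, cont01 (F i)) -> cont01 (fun t => \sum_(i <- r) F i t).
Proof.
move=> cF; elim: r => [|i r IH].
  rewrite (_ : (fun _ => _) = fun=> 0); first exact: cont01_cst.
  by apply/funext => t; rewrite big_nil.
rewrite (_ : (fun _ => _) = fun t => F i t + \sum_(i <- r) F i t).
  exact: cont01D.
by apply/funext => t; rewrite big_cons.
Qed.

Lemma int01_cst c : int01 (fun=> c) = c.
Proof.
have m1 : mu (`[0%R, 1%R]%classic : set R) = 1%E.
  by rewrite lebesgue_measure_itv/= lte_fin ltr01 oppr0 adde0.
rewrite /int01 Rintegral_cst; last exact: measurable_itv.
by rewrite [X in fine X]m1 mulr1.
Qed.

Lemma int01_sum (I : Type) (r : seq I) (F : I -> R -> R) :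
  (forall i, cont01 (F i)) ->
  int01 (fun t => \sum_(i <- r) F i t) = \sum_(i <- r) int01 (F i).
Proof.
move=> cF; elim: r => [|i r IH].
  rewrite big_nil (_ : (fun _ => _) = fun=> 0) ?int01_cst//.
  by apply/funext => t; rewrite big_nil.
rewrite big_cons -IH -int01D//; last exact: cont01_sum.
by congr int01; apply/funext => t; rewrite big_cons.
Qed.

Lemma eq_int01 f g : (forall t, 0 <= t <= 1 -> f t = g t) -> int01 f = int01 g.
Proof.
by move=> fg; apply: eq_Rintegral => t; rewrite inE/= in_itv/=; exact: fg.
Qed.

Lemma int01_norm_le f c : cont01 f -> (forall t, 0 <= t <= 1 -> `|f t| <= c) ->
  `|int01 f| <= c.
Proof.
move=> cf H.
have cn : cont01 (fun t => `|f t|).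
  by move=> t t01; apply: (@continuous_comp _ _ _ f (fun x => `|x|)); [exact: cf|exact: norm_continuous].
apply: le_trans (le_normr_Rintegral _ (cont01_integrable cf)) _ => //.
rewrite -[leRHS]int01_cst; apply: le_Rintegral => //.
- exact: cont01_integrable.
- by apply: cont01_integrable; exact: cont01_cst.
Qed.

Lemma int01_derive (F f : R -> R) : cont01 f ->
  (forall t : R, 0 <= t <= 1 -> is_derive t (1 : R) F (f t)) ->
  int01 f = F 1 - F 0.
Proof.
move=> cf dF; rewrite /int01 /Rintegral.
have dF' (t : R) : 0 <= t <= 1 -> derivable F t 1 by move=> /dF[].
have cF t : 0 <= t <= 1 -> {for t, continuous F}.
  by move=> /dF'/derivable1_diffP/differentiable_continuous.
rewrite (@continuous_FTC2 _ f F)//.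
- exact: cont01_within.
- split.
  + by move=> t; rewrite in_itv/= => /andP[t0 t1]; apply: dF'; rewrite !ltW.
  + by apply: cvg_at_right_filter; apply: cF; rewrite lexx ler01.
  + by apply: cvg_at_left_filter; apply: cF; rewrite lexx ler01.
- move=> t; rewrite in_itv/= => /andP[t0 t1]; rewrite derive1E.
  by have [] := dF t; rewrite ?ltW.
Qed.

Section radial.
Variables (n : nat) (a : 'rV[R]_n) (r : R).
Let B := [set x : 'rV[R]_n | `|x - a| < r].

Definition segpt (x : 'rV[R]_n) (t : R) := a + t *: (x - a).

Lemma open_rball : open B.
Proof.
move=> x Bx; apply/rV_nearP; exists ((r - `|x - a|) / 2).
  by rewrite divr_gt0// subr_gt0.
move=> y yx; rewrite /B/= -(subrK x y) -addrA (le_lt_trans (ler_normD _ _))//.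
have : 0 < r - `|x - a| by rewrite subr_gt0.
lra.
Qed.

Lemma segpt_ball x t : B x -> 0 <= t <= 1 -> B (segpt x t).
Proof.
move=> Bx /andP[t0 t1]; rewrite /B/= /segpt addrC addKr normrZ ger0_norm//.
by apply: le_lt_trans Bx; rewrite ler_piMl.
Qed.

Lemma segptB x y t : segpt x t - segpt y t = t *: (x - y).
Proof.
by rewrite /segpt opprD addrACA subrr add0r -scalerBr opprB addrA subrK.
Qed.

Lemma segpt_continuous x : continuous (segpt x).
Proof.
move=> t; apply: cvgD; first exact: cvg_cst.
by apply: cvgZr_tmp; exact: cvg_id.
Qed.

Lemma cont01_segpt (h : 'rV[R]_n -> R) x l : class_C 0 B h -> B x ->
  cont01 (fun t => t ^+ l * h (segpt x t)).
Proof.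
move=> Ch Bx; apply: cont01M; first exact: cont01X.
move=> t t01; apply: continuous_comp; first exact: segpt_continuous.
by apply: Ch; exact: segpt_ball.
Qed.

(** Continuity is uniform along the segment from [a] to [x], which is compact. *)
Lemma segpt_unif (h : 'rV[R]_n -> R) (x : 'rV[R]_n) (e : R) : class_C 0 B h -> B x -> 0 < e ->
  exists2 d : R, 0 < d & forall (y : 'rV[R]_n) (t : R), `|y - x| <= d -> 0 <= t <= 1 ->
    `|h (segpt y t) - h (segpt x t)| <= e.
Proof.
move=> Ch Bx e0.
pose P (d t : R) := forall y, `|y - x| <= d -> `|h (segpt y t) - h (segpt x t)| <= e.
suff : \forall d \near (0 : R), `[0 : R, 1] `<=` P d.
  move/R_nearP => [d d0 Hd]; exists d => // y t yx t01.
  by apply: (Hd d) => //=; rewrite ?subr0 ?gtr0_norm// in_itv.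
have cov := (compact_near_coveringP _).1 (@segment_compact R 0 1).
apply: (cov R (nbhs (0 : R)) P) => t; rewrite /= in_itv/= => t01.
have e20 : 0 < e / 2 by rewrite divr_gt0.
have ch : {for segpt x t, continuous h} by apply: Ch; exact: segpt_ball.
have [s s0 Hs] : exists2 s : R, 0 < s &
    forall z, `|z - segpt x t| <= s -> `|h (segpt x t) - h z| <= e / 2.
  by apply/rV_nearP; move/cvgrPdist_le: ch; exact.
have M0 : 0 < `|x - a| + 1 by rewrite ltr_wpDl.
have N0 : 0 < `|t| + 1 by rewrite ltr_wpDl.
pose d1 := Num.min 1 (s / 2 / (`|x - a| + 1)).
pose d2 := s / 2 / (`|t| + 1).
have d10 : 0 < d1 by rewrite lt_min ltr01 !divr_gt0.
have d20 : 0 < d2 by rewrite !divr_gt0.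
exists ([set t' | `|t' - t| <= d1], [set d | `|d - 0| <= d2]) => /=.
  by split; apply/R_nearP; [exists d1|exists d2].
move=> [t' d] /= [t'1 dd2] y yx.
have t1 : `|t' - t| <= 1 by rewrite (le_trans t'1)// ge_min lexx.
have tM : `|t' - t| * `|x - a| <= s / 2.
  have : `|t' - t| <= s / 2 / (`|x - a| + 1) by rewrite (le_trans t'1)// ge_min lexx orbT.
  rewrite ler_pdivlMr//; apply: le_trans.
  by rewrite ler_wpM2l// lerDl.
have hx z : `|z - x| <= d -> `|segpt z t' - segpt x t| <= s.
  move=> zx.
  have -> : segpt z t' - segpt x t = t' *: (z - x) + (t' - t) *: (x - a).
    have <- : segpt x t' - segpt x t = (t' - t) *: (x - a).
      by rewrite /segpt opprD addrACA subrr add0r -scalerBl.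
    by rewrite -segptB addrA subrK.
  rewrite (le_trans (ler_normD _ _))// !normrZ (splitr s) lerD//.
  apply: (@le_trans _ _ ((`|t| + 1) * d2)).
    apply: ler_pM => //.
      rewrite -(subrK t t') addrC (le_trans (ler_normD _ _))// lerD//.
    by rewrite (le_trans zx)// (le_trans (ler_norm d))//; move: dd2; rewrite subr0.
  by rewrite /d2 mulrC divfK// gt_eqF.
have h1 := Hs _ (hx y yx).
have h2 : `|h (segpt x t) - h (segpt x t')| <= e / 2.
  apply: Hs; apply: hx; rewrite subrr normr0.
  by apply: le_trans yx.
rewrite (splitr e) (le_trans (ler_distD (h (segpt x t)) _ _))//.
by rewrite lerD// distrC.
Qed.

Lemma linear_form (c : 'I_n -> R) : exists2 df : {linear 'rV[R]_n -> R},
  (forall w, df w = \sum_j w 0 j * c j) & continuous df.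
Proof.
pose f (w : 'rV[R]_n) := \sum_j w 0 j * c j.
have lf : linear f.
  move=> b u v; rewrite /f scaler_sumr -big_split/=.
  by apply: eq_bigr => j _; rewrite !mxE mulrDl /GRing.scale/= mulrA.
pose lM := GRing.isLinear.Build _ _ _ _ f lf.
pose lL : {linear 'rV[R]_n -> R} := HB.pack f lM.
exists lL => // w.
suff H : class_C 0 setT f by exact: H.
apply: class_C_sum => [|j _]; first exact: openT.
apply: (@class_C_mul _ _ _ _ (fun w => w 0 j) (cst (c j))).
- exact: openT.
- exact: class_C_coord.
- exact: class_C_cst.
Qed.

(** The weight [t ^+ l] absorbs the factors [t] produced by the chain rule, so
    that differentiating in [x] gives an average of the same form. *)
Definition ravg (l : nat) (h : 'rV[R]_n -> R) (x : 'rV[R]_n) : R :=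
  int01 (fun t => t ^+ l * h (segpt x t)).

Lemma ravg_continuous l h : class_C 0 B h -> class_C 0 B (ravg l h).
Proof.
move=> Ch x Bx; suff H : ravg l h @ x --> ravg l h x by exact: H.
apply/(@cvgrPdist_le _ _ _ (nbhs x) (nbhs_filter x)) => e e0.
have [d d0 Hd] := segpt_unif Ch Bx e0.
have [d' d'0 Hd'] := (rV_nearP _ _).1 (open_near open_rball Bx).
suff H : \forall y \near x, `|ravg l h x - ravg l h y| <= e by exact: H.
apply/rV_nearP; exists (Num.min d d'); first by rewrite lt_min d0.
move=> y; rewrite le_min => /andP[yd /Hd' By].
have c1 := cont01_segpt (l := l) Ch Bx; have c2 := cont01_segpt (l := l) Ch By.
have -> : ravg l h x - ravg l h y = int01 (fun t => t ^+ l * h (segpt x t)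
    + (-1) * (t ^+ l * h (segpt y t))).
  rewrite int01D//; last by apply: cont01M => //; exact: cont01_cst.
  by rewrite int01Z// mulN1r.
apply: int01_norm_le.
  by apply: cont01D => //; apply: cont01M => //; exact: cont01_cst.
move=> t t01; rewrite mulN1r -mulrBr normrM distrC -[leRHS]mul1r ler_pM//.
  by case/andP: t01 => t0 t1; rewrite normrX ger0_norm// exprn_ile1.
exact: Hd.
Qed.

(** Differentiation under the integral sign: by the mean value theorem and
    [segpt_unif], the first order expansion of [h] is uniform in [t]. *)
Lemma ravg_diff l h (x v : 'rV[R]_n) : class_C 1 B h -> B x ->
  differentiable (ravg l h) x /\ 'D_v (ravg l h) x = ravg l.+1 ('D_v h) x.
Proof.
move=> Ch Bx; have [dh Dh] := Ch; have C0 := class_CW Ch.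
pose c j := ravg l.+1 ('D_(delta_mx 0 j) h) x.
have [df dfE' dfc] := linear_form c.
have DhE y w : B y -> 'D_w h y = \sum_j w 0 j * 'D_(delta_mx 0 j) h y.
  by move=> By; rewrite diff_sum_partial//; exact: dh.
have dfE w : df w = ravg l.+1 ('D_w h) x.
  rewrite dfE' /c /ravg.
  under eq_bigr => j _ do rewrite -(int01Z _ (cont01_segpt (l := l.+1) (Dh _) Bx)).
  rewrite -int01_sum; last first.
    move=> j /=.
    apply: cont01Z.
    have H := cont01_segpt (l := l.+1) (Dh (delta_mx 0 j)) Bx; exact H.
  apply: eq_int01 => t t01; rewrite DhE; last exact: segpt_ball.
  by rewrite mulr_sumr; apply: eq_bigr => j _; rewrite mulrCA.
suff [d Dd] : is_diff x (ravg l h) df.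
  by split=> //; rewrite deriveE// Dd dfE.
apply: differentiable_epsP => // e e0.
pose e' := e / (n%:R + 1).
have e'0 : 0 < e' by rewrite divr_gt0// ltr_wpDl.
have [d d0 Hd] : exists2 d : R, 0 < d & forall (y : 'rV[R]_n) (t : R) j, `|y - x| <= d ->
   0 <= t <= 1 -> `|'D_(delta_mx 0 j) h (segpt y t)
                    - 'D_(delta_mx 0 j) h (segpt x t)| <= e'.
  pose Q (j : 'I_n) (d : R) := forall (y : 'rV[R]_n) (t : R), `|y - x| <= d ->
     0 <= t <= 1 -> `|'D_(delta_mx 0 j) h (segpt y t)
                    - 'D_(delta_mx 0 j) h (segpt x t)| <= e'.
  have HQ (j : 'I_n) : \forall d \near (0 : R), Q j d.
    have [d d0 Hd] := segpt_unif (Dh (delta_mx 0 j)) Bx e'0.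
    apply/R_nearP; exists d => // z; rewrite subr0 => zd y t yz t01.
    by apply: Hd => //; rewrite (le_trans yz)// (le_trans (ler_norm _)).
  have [d d0 Hd] := (R_nearP _ _).1 (R_near_forall HQ).
  exists d => // y t j; apply: Hd.
  by rewrite subr0 gtr0_norm.
have [d' d'0 Hd'] := (rV_nearP _ _).1 (open_near open_rball Bx).
suff H : \forall w \near (0 : 'rV[R]_n),
  `|ravg l h (w + x) - (ravg l h x + df w)| <= e * `|w| by exact: H.
apply/rV_nearP; exists (Num.min d d'); first by rewrite lt_min d0.
move=> w; rewrite subr0 le_min => /andP[wd wd'].
have Bs s : 0 <= s <= 1 -> B (x + s *: w).
  move=> /andP[s0 s1]; apply: Hd'; rewrite addrC addKr normrZ ger0_norm//.
  by rewrite (le_trans _ wd')// ler_piMl.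
have Bw : B (w + x) by have := Bs 1; rewrite scale1r addrC lexx ler01; apply.
have Cw : class_C 0 B ('D_w h) by exact: Dh.
have c1 := cont01_segpt (l := l) C0 Bw; have c2 := cont01_segpt (l := l) C0 Bx.
have c3 := cont01_segpt (l := l.+1) Cw Bx.
have cN f : cont01 f -> cont01 (fun t => (-1) * f t).
  by move=> cf; exact: cont01Z.
have -> : ravg l h (w + x) - (ravg l h x + df w) = int01 (fun t =>
   t ^+ l * h (segpt (w + x) t) + ((-1) * (t ^+ l * h (segpt x t))
      + (-1) * (t ^+ l.+1 * 'D_w h (segpt x t)))).
  rewrite int01D//; last by apply: cont01D; exact: cN.
  rewrite int01D//; [|exact: cN|exact: cN].
  by rewrite !int01Z// dfE !mulN1r opprD.
apply: int01_norm_le.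
  by apply: cont01D => //; apply: cont01D; exact: cN.
move=> t t01; have [t0 t1] := andP t01.
have segE s : segpt (x + s *: w) t = segpt x t + s *: (t *: w).
  rewrite -[LHS](subrK (segpt x t)) segptB (addrC x) addrK addrC.
  by rewrite !scalerA mulrC.
have [s s01|s /andP[s0 s1] E] := @line_MVT R _ h (segpt x t) (t *: w).
  by apply: dh; rewrite -segE; apply: segpt_ball => //; exact: Bs.
have s01 : 0 <= s <= 1 by rewrite !ltW.
have Bsw := segpt_ball (Bs _ s01) t01.
move: E; rewrite -segE derive_scale; last exact: dh.
have -> : segpt x t + t *: w = segpt (w + x) t.
  by have := segE 1; rewrite !scale1r addrC => <-; rewrite addrC.
move=> E.
have -> : t ^+ l * h (segpt (w + x) t) +
   (-1 * (t ^+ l * h (segpt x t)) + -1 * (t ^+ l.+1 * 'D_w h (segpt x t)))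
   = t ^+ l.+1 * ('D_w h (segpt (x + s *: w) t) - 'D_w h (segpt x t)).
  rewrite exprSr.
  have -> : t ^+ l * t * ('D_w h (segpt (x + s *: w) t) - 'D_w h (segpt x t)) =
    t ^+ l * (t * 'D_w h (segpt (x + s *: w) t)) - t ^+ l * t * 'D_w h (segpt x t).
    by rewrite mulrBr !mulrA.
  by move: E; rewrite /GRing.scale/= => <-; ring.
rewrite normrM normrX ger0_norm//.
rewrite -[leRHS]mul1r ler_pM ?exprn_ge0 ?exprn_ile1//.
rewrite !DhE//; last exact: segpt_ball.
rewrite -sumrB (le_trans (ler_norm_sum _ _ _))//.
apply: (@le_trans _ _ (\sum_(j < n) `|w| * e')).
  apply: ler_sum => j _; rewrite -mulrBr normrM ler_pM//.
    exact: row_coord_norm.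
  apply: Hd => //; rewrite addrC addKr normrZ (ger0_norm (ltW s0)).
  by rewrite (le_trans _ wd)// ler_piMl// ltW.
rewrite sumr_const card_ord -mulrnAr mulrC ler_wpM2r//.
rewrite /e' -mulr_natl mulrCA ler_piMr ?(ltW e0)//.
by rewrite ler_pdivrMr ?mul1r ?lerDl// ltr_wpDl.
Qed.

Lemma class_C_ravg k l h : class_C k B h -> class_C k B (ravg l h).
Proof.
elim: k l h => [|k IH] l h Ch; first exact: ravg_continuous.
have C1 : class_C 1 B h by apply: class_C_le Ch.
split=> [x Bx|v]; first by have [] := ravg_diff l 0 C1 Bx.
apply: (@class_C_ext _ _ _ _ _ (ravg l.+1 ('D_v h))); first exact: open_rball.
  by move=> x Bx; have [_ ->] := ravg_diff l v C1 Bx.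
by apply: IH; have [_] := Ch; exact.
Qed.

End radial.

(** The derivative of [f] along the segment from [a] to [x] is integrated: the
    coefficients [H j] are the radial averages of the partial derivatives. *)
Lemma hadamard n (U : set 'rV[R]_n) (f : 'rV[R]_n -> R) a :
  open U -> U a -> smooth_on U f ->
  exists (V : set 'rV[R]_n) (H : 'I_n -> 'rV[R]_n -> R),
    [/\ open V, V a /\ V `<=` U, forall j, smooth_on V (H j),
        forall j, H j a = 'D_(delta_mx 0 j) f a &
        forall x, V x -> f x = f a + \sum_j (x 0 j - a 0 j) * H j x].
Proof.
move=> oU Ua Cf.
have [r r0 Hr] := (rV_nearP _ _).1 (open_near oU Ua).
pose V := [set x : 'rV[R]_n | `|x - a| < r].
have VU : V `<=` U by move=> x /ltW; exact: Hr.
have Va : V a by rewrite /V/= subrr normr0.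
exists V, (fun j => ravg a 0 ('D_(delta_mx 0 j) f)); split.
- exact: open_rball.
- by [].
- move=> j k; apply: class_C_ravg; apply: class_C_sub VU _.
  by have [_] := Cf k.+1; exact.
- move=> j; rewrite /ravg /segpt subrr.
  rewrite -[RHS]int01_cst; apply: eq_int01 => t _.
  by rewrite scaler0 addr0 mul1r.
- move=> x Vx.
  have df t : 0 <= t <= 1 -> differentiable f (a + t *: (x - a)).
    move=> t01; have [d _] := Cf 1; apply: d; apply: VU.
    exact: (@segpt_ball _ a r x t Vx t01).
  have Cj j : class_C 0 V ('D_(delta_mx 0 j) f).
    by apply: class_C_sub VU _; have [_] := Cf 1; exact.
  have C := fun j => cont01_segpt (l := 0) (Cj j) Vx.
  under eq_bigr => j _ do rewrite -(int01Z _ (C j)).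
  rewrite -int01_sum; last first.
    by move=> j /=; apply: cont01Z; exact: C.
  apply/eqP; rewrite addrC -subr_eq eq_sym; apply/eqP.
  apply: etrans (@int01_derive (fun t => f (a + t *: (x - a))) _ _ _) _; last first.
  + by rewrite scale1r scale0r addr0 (addrC a) subrK.
  + move=> t t01; have H := is_derive_line (df t t01).
    apply: is_derive_eq H _; rewrite diff_sum_partial; last exact: df.
    by apply: eq_bigr => j _; rewrite !mxE mul1r.
  + by apply: cont01_sum => j; apply: cont01Z; exact: C.
Qed.

End Hadamard.

(** * Smooth functions on manifolds *)

Section SmoothOn.
Variable R : realType.

Lemma rV_near_open n (x : 'rV[R]_n) (P : 'rV[R]_n -> Prop) :
  (\forall y \near x, P y) -> exists U, [/\ open U, U x & U `<=` P].
Proof.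
move/rV_nearP=> [r r0 Hr]; exists [set y | `|y - x| < r]; split.
- exact: open_rball.
- by rewrite /= subrr normr0.
- by move=> y /= /ltW; exact: Hr.
Qed.

Lemma rV_filterS n (x : 'rV[R]_n) (P Q : 'rV[R]_n -> Prop) :
  (forall y, P y -> Q y) -> (\forall y \near x, P y) -> \forall y \near x, Q y.
Proof.
move=> PQ /rV_nearP[r r0 Hr]; apply/rV_nearP; exists r => // y yr.
by apply: PQ; exact: Hr.
Qed.

Lemma smooth_on_continuous n (U : set 'rV[R]_n) (f : 'rV[R]_n -> R) x :
  smooth_on U f -> U x -> {for x, continuous f}.
Proof. by move=> /(_ 0%N); apply. Qed.

Lemma smooth_on_comp n k (U : set 'rV[R]_n) (V : set 'rV[R]_k)
    (f : 'rV[R]_n -> 'rV[R]_k) (g : 'rV[R]_k -> R) :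
  open U -> open V -> (forall x, U x -> V (f x)) ->
  (forall j, smooth_on U (fun x => f x 0 j)) -> smooth_on V g ->
  smooth_on U (g \o f).
Proof.
move=> oU oV UV Cf Cg l; apply: class_C_comp oU oV UV _ (Cg l).
by move=> j; exact: Cf.
Qed.

Lemma smooth_on_derive n (U : set 'rV[R]_n) (f : 'rV[R]_n -> R) v :
  smooth_on U f -> smooth_on U ('D_v f).
Proof. by move=> Cf k; have [_] := Cf k.+1; exact. Qed.

End SmoothOn.

Section Charts.
Variables (R : realType) (n : nat) (M : manifold R n).
Implicit Types (p q : M) (f g : M -> R) (c d : chart R n M).

Let atP c (Ac : atlas M c) : is_chart c := mfd_chart (mfdP M) Ac.

Lemma chart_cod_map c q : chart_dom c q -> chart_cod c (chart_map c q).
Proof. by move=> cq; exists q. Qed.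

Lemma chart_dom_inv c x : atlas M c -> chart_cod c x ->
  chart_dom c (chart_inv c x).
Proof. by move=> Ac [q cq <-]; rewrite (chart_mapK (atP Ac)). Qed.

Lemma chart_invK c x : atlas M c -> chart_cod c x ->
  chart_map c (chart_inv c x) = x.
Proof. by move=> Ac [q cq <-]; rewrite (chart_mapK (atP Ac)). Qed.

Lemma chart_map_near c q (P : 'rV[R]_n -> Prop) : atlas M c -> chart_dom c q ->
  (\forall x \near chart_map c q, P x) -> \forall q' \near q, P (chart_map c q').
Proof.
move=> Ac cq Pq; have oc := open_chart_dom (atP Ac).
have := chart_map_cont (atP Ac).
rewrite continuous_open_subspace// => /(_ q (mem_set cq)) cont.
exact: cont.
Qed.

Lemma chart_inv_near c q (P : M -> Prop) : atlas M c -> chart_dom c q ->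
  (\forall q' \near q, P q') ->
  \forall x \near chart_map c q, P (chart_inv c x).
Proof.
move=> Ac cq Pq; have oc := open_chart_cod (atP Ac).
have := chart_inv_cont (atP Ac).
rewrite continuous_open_subspace// => /(_ _ (mem_set (chart_cod_map cq))) cont.
by apply: cont; rewrite (chart_mapK (atP Ac)).
Qed.

Lemma chart_dom_near c q : atlas M c -> chart_dom c q ->
  \forall q' \near q, chart_dom c q'.
Proof. by move=> Ac cq; apply: open_nbhs_nbhs; split=> //; apply: (open_chart_dom (atP Ac)). Qed.

Lemma chart_cod_near c q : atlas M c -> chart_dom c q ->
  \forall x \near chart_map c q, chart_cod c x.
Proof.
by move=> Ac cq; apply: open_near; [apply: (open_chart_cod (atP Ac))|exact: chart_cod_map].
Qed.

Definition smooth_near (q : M) (f : M -> R) : Prop :=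
  forall c, atlas M c -> chart_dom c q ->
  exists U, [/\ open U, U (chart_map c q) & smooth_on U (f \o chart_inv c)].

Lemma smooth_funP f : smooth_fun f <-> forall q, smooth_near q f.
Proof.
split=> [Sf q c Ac cq|Sf c Ac k].
  exists (chart_cod c); split; [apply: (open_chart_cod (atP Ac))|exact: chart_cod_map|exact: Sf].
apply: class_C_local => x [q cq <-].
by have [U [oU Uq SU]] := Sf q c Ac cq; exists U.
Qed.

(** One chart is enough, because the transition maps are smooth. *)
Lemma smooth_nearE q c f : atlas M c -> chart_dom c q ->
  (exists U, [/\ open U, U (chart_map c q) & smooth_on U (f \o chart_inv c)]) ->
  smooth_near q f.
Proof.
move=> Ac cq [U [oU Uq SU]] d Ad dq.
have S := mfd_compat (mfdP M) Ad Ac.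
have [W [oW Wq HW]] : exists W, [/\ open W, W (chart_map d q) &
    forall x, W x -> [/\ chart_cod d x, chart_dom c (chart_inv d x) &
      U (chart_map c (chart_inv d x))]].
  apply: rV_near_open.
  have h1 := chart_cod_near Ad dq.
  have h2 := chart_inv_near Ad dq (chart_dom_near Ac cq).
  have h3 := chart_inv_near Ad dq (chart_map_near Ac cq (open_near oU Uq)).
  by apply: filterS3 h1 h2 h3.
exists W; split=> // k.
have WS x : W x -> (chart_map d @` (chart_dom d `&` chart_dom c)) x.
  move=> /HW[dx cx _]; exists (chart_inv d x); last exact: chart_invK.
  by split=> //; exact: chart_dom_inv.
apply: (@class_C_ext _ _ _ _ _ ((f \o chart_inv c) \o (chart_map c \o chart_inv d))).
- exact: oW.
- by move=> x /HW[_ cx _] /=; rewrite (chart_mapK (atP Ac)).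
- apply: (class_C_comp oW oU); [by move=> x /HW[]| |exact: SU].
  move=> j; apply: (@class_C_row _ _ _ _ _ (chart_map c \o chart_inv d)) => //.
  exact: class_C_sub WS (S k).
Qed.

Lemma smooth_near_ext q f g : (\forall q' \near q, f q' = g q') ->
  smooth_near q f -> smooth_near q g.
Proof.
move=> fg Sf c Ac cq; have [U [oU Uq SU]] := Sf c Ac cq.
have h := chart_inv_near Ac cq fg.
have [V [oV Vq HV]] := rV_near_open (filterI h (open_near oU Uq)).
exists V; split=> // k; apply: (@class_C_ext _ _ _ _ _ (f \o chart_inv c)) => //.
  by move=> x /HV[].
by apply: class_C_sub (SU k) => x /HV[].
Qed.

Lemma exists_chart q : exists2 c, atlas M c & chart_dom c q.
Proof. exact: (mfd_cover (mfdP M)). Qed.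

Lemma smooth_near_continuous q f : smooth_near q f -> {for q, continuous f}.
Proof.
move=> Sf; have [c Ac cq] := exists_chart q.
have [U [oU Uq SU]] := Sf c Ac cq.
have C := smooth_on_continuous SU Uq.
suff H : f @ q --> f q by exact: H.
move=> A Af; have : \forall x \near chart_map c q, A (f (chart_inv c x)).
  by apply: C; rewrite /= (chart_mapK (atP Ac)).
move=> /(chart_map_near Ac cq) h.
apply: filterS2 h (chart_dom_near Ac cq) => q' + cq'.
by rewrite (chart_mapK (atP Ac)).
Qed.

Lemma smooth_near_comp q (k : nat) (f : 'I_k -> M -> R)
    (V : set 'rV[R]_k) (F : 'rV[R]_k -> R) :
  open V -> V (\row_j f j q) -> smooth_on V F -> (forall j, smooth_near q (f j)) ->
  smooth_near q (fun x => F (\row_j f j x)).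
Proof.
move=> oV Vq SF Sf c Ac cq.
have /choice[U HU] : forall j, exists U, [/\ open U, U (chart_map c q) &
    smooth_on U (f j \o chart_inv c)] by move=> j; exact: Sf.
have h1 : \forall x \near chart_map c q, forall j, U j x.
  by apply: rV_near_forall => j; have [oU Uq _] := HU j; exact: open_near.
have h2 : \forall x \near chart_map c q, V (\row_j f j (chart_inv c x)).
  apply: (chart_inv_near Ac cq (P := fun x => V (\row_j f j x))).
  have : (fun x => \row_j f j x) @ q --> \row_j f j q.
    apply: cvg_row => j.
    rewrite (_ : (fun x => _) = f j); last by apply/funext => x; rewrite mxE.
    by rewrite mxE; exact: smooth_near_continuous (Sf j).
  by apply; exact: open_near.
have [W [oW Wq HW]] := rV_near_open (filterI h1 h2).
exists W; split=> //.
apply: (@smooth_on_comp _ _ _ W V (fun x => \row_j f j (chart_inv c x)) F) => //.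
  by move=> x /HW[].
move=> j l; rewrite (_ : (fun x => _) = f j \o chart_inv c).
  by have [_ _ SU] := HU j; apply: class_C_sub (SU l) => x /HW[h _]; exact: h.
by apply/funext => x; rewrite mxE.
Qed.

Lemma smooth_near_op2 (op : (M -> R) -> (M -> R) -> M -> R) :
  (forall (k : nat) (U : set 'rV[R]_n) c f g, open U -> class_C k U (f \o chart_inv c) ->
     class_C k U (g \o chart_inv c) -> class_C k U (op f g \o chart_inv c)) ->
  forall q f g, smooth_near q f -> smooth_near q g -> smooth_near q (op f g).
Proof.
move=> Hop q f g Sf Sg c Ac cq.
have [U [oU Uq SU]] := Sf c Ac cq; have [V [oV Vq SV]] := Sg c Ac cq.
exists (U `&` V); split=> [||k]; [exact: openI|by []|].
apply: Hop; first exact: openI.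
  by apply: class_C_sub (SU k) => x [].
by apply: class_C_sub (SV k) => x [].
Qed.

Lemma smooth_nearD q f g : smooth_near q f -> smooth_near q g ->
  smooth_near q (f + g).
Proof.
apply: (smooth_near_op2 (op := fun f g => f + g)).
move=> k U c f' g'; exact: class_C_add.
Qed.

Lemma smooth_nearM q f g : smooth_near q f -> smooth_near q g ->
  smooth_near q (f * g).
Proof.
apply: (smooth_near_op2 (op := fun f g => f * g)).
move=> k U c f' g'; exact: class_C_mul.
Qed.

Lemma smooth_near_cst q (a : R) : smooth_near q (cst a).
Proof.
move=> c Ac cq; exists setT; split=> //; first exact: openT.
move=> k; exact: class_C_cst.
Qed.

Lemma smooth_fun_cst (a : R) : smooth_fun (cst a : M -> R).
Proof. by apply/smooth_funP => q; exact: smooth_near_cst. Qed.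

Lemma smooth_funD f g : smooth_fun f -> smooth_fun g -> smooth_fun (f + g).
Proof.
by move=> /smooth_funP Sf /smooth_funP Sg; apply/smooth_funP => q; exact: smooth_nearD.
Qed.

Lemma smooth_funM f g : smooth_fun f -> smooth_fun g -> smooth_fun (f * g).
Proof.
by move=> /smooth_funP Sf /smooth_funP Sg; apply/smooth_funP => q; exact: smooth_nearM.
Qed.

Lemma smooth_funZ (a : R) f : smooth_fun f -> smooth_fun (a *: f).
Proof. by move=> Sf; apply: (@smooth_funM (cst a) f) => //; exact: smooth_fun_cst. Qed.

Lemma smooth_funN f : smooth_fun f -> smooth_fun (- f).
Proof. by move=> Sf; rewrite -scaleN1r; exact: smooth_funZ. Qed.

Lemma smooth_funB f g : smooth_fun f -> smooth_fun g -> smooth_fun (f - g).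
Proof. by move=> Sf Sg; apply: smooth_funD => //; exact: smooth_funN. Qed.

Lemma smooth_fun_sum (I : Type) (r : seq I) (P : pred I) (F : I -> M -> R) :
  (forall i, P i -> smooth_fun (F i)) -> smooth_fun (\sum_(i <- r | P i) F i).
Proof.
move=> H; elim/big_rec: _ => [|i f Pi Sf]; first exact: smooth_fun_cst.
by apply: smooth_funD => //; exact: H.
Qed.

Lemma smooth_near_sum q (I : Type) (r : seq I) (P : pred I) (F : I -> M -> R) :
  (forall i, P i -> smooth_near q (F i)) -> smooth_near q (\sum_(i <- r | P i) F i).
Proof.
move=> H; elim/big_rec: _ => [|i f Pi Sf]; first exact: smooth_near_cst.
by apply: smooth_nearD => //; exact: H.
Qed.

Lemma smooth_fun_prod (I : Type) (r : seq I) (P : pred I) (F : I -> M -> R) :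
  (forall i, P i -> smooth_fun (F i)) -> smooth_fun (\prod_(i <- r | P i) F i).
Proof.
move=> H; elim/big_rec: _ => [|i f Pi Sf]; first exact: smooth_fun_cst.
by apply: smooth_funM => //; exact: H.
Qed.

(** The support of a bump function of a chart is compact, hence closed in the
    Hausdorff space [M], so that its extension by zero is smooth. *)
Lemma mfd_bump p (O : set M) : open O -> O p -> exists (b : M -> R) (K : set M),
  [/\ smooth_fun b, \forall q \near p, b q = 1, closed K, K `<=` O &
      forall q, ~ K q -> b q = 0].
Proof.
move=> oO Op; have [c Ac cp] := exists_chart p.
have h1 := chart_cod_near Ac cp.
have h2 := chart_inv_near Ac cp (open_nbhs_nbhs (conj oO Op)).
have [r r0 Hr] := (rV_nearP _ _).1 (filterI h1 h2).
have [b [Sb [r' r'0 b1] b0]] := exists_bump (chart_map c p) r0.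
pose B := [set x | `|x - chart_map c p| <= r].
pose K := chart_inv c @` B.
have cK : compact K.
  apply: continuous_compact; last by apply: compact_rball; exact: ltW.
  apply: continuous_subspaceW (chart_inv_cont (atP Ac)) => x.
  by move=> /Hr[].
have clK : closed K by apply: compact_closed cK; exact: (mfd_hausdorff (mfdP M)).
exists (fun q => if `[< chart_dom c q >] then b (chart_map c q) else 0), K.
have bK q : ~ K q -> (if `[< chart_dom c q >] then b (chart_map c q) else 0) = 0.
  move=> Kq; case: asboolP => // cq.
  apply/eqP; apply: contraT => /b0 h; exfalso; apply: Kq.
  by exists (chart_map c q) => //; rewrite (chart_mapK (atP Ac)).
split=> //.
- apply/smooth_funP => q; have [cq|cq] := pselect (chart_dom c q).
    apply: (@smooth_near_ext _ (b \o chart_map c)).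
      by apply: filterS (chart_dom_near Ac cq) => q' cq'; rewrite asboolT.
    apply: (smooth_nearE Ac cq); exists (chart_cod c); split.
    + exact: (open_chart_cod (atP Ac)).
    + exact: chart_cod_map.
    + move=> k; apply: (@class_C_ext _ _ _ _ _ b).
      * exact: (open_chart_cod (atP Ac)).
      * by move=> x cx /=; rewrite chart_invK.
      * by apply: class_C_sub (Sb k).
  apply: (@smooth_near_ext _ (cst 0)); last exact: smooth_near_cst.
  have : \forall q' \near q, ~ K q'.
    apply: open_nbhs_nbhs; split; first exact: closed_openC.
    by move=> -[x Bx xq]; apply: cq; rewrite -xq; apply: chart_dom_inv => //; have [] := Hr x Bx.
  by apply: filterS => q' /bK ->.
- have h : \forall x \near chart_map c p, b x = 1.
    by apply/rV_nearP; exists r'.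
  apply: filterS2 (chart_map_near Ac cp h) (chart_dom_near Ac cp) => q bq cq.
  by rewrite asboolT.
- by move=> _ [x Bx <-]; have [] := Hr x Bx.
Qed.

Lemma smooth_fun_cutoff (O : set M) (b f : M -> R) (K : set M) :
  smooth_fun b -> closed K -> K `<=` O -> (forall q, ~ K q -> b q = 0) ->
  (forall q, O q -> smooth_near q f) -> smooth_fun (b * f).
Proof.
move=> Sb cK KO bK Sf; apply/smooth_funP => q.
have [Kq|Kq] := pselect (K q).
  by apply: smooth_nearM; [exact: (smooth_funP _).1|apply: Sf; exact: KO].
apply: (@smooth_near_ext _ (cst 0)); last exact: smooth_near_cst.
have : \forall q' \near q, ~ K q'.
  by apply: open_nbhs_nbhs; split => //; exact: closed_openC.
by apply: filterS => q' /bK bq; rewrite /= !fctE bq mul0r.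
Qed.

Lemma smooth_near_open p f : smooth_near p f ->
  exists O, [/\ open O, O p & forall q, O q -> smooth_near q f].
Proof.
move=> Sf; have [c Ac cp] := exists_chart p.
have [U [oU Up SU]] := Sf c Ac cp.
have : nbhs p (fun q => chart_dom c q /\ U (chart_map c q)).
  apply: filterI; first exact: chart_dom_near.
  by apply: chart_map_near => //; exact: open_near.
rewrite nbhsE => -[W [oW Wp] HW]; exists W; split => // q /HW[cq Uq].
by apply: (smooth_nearE Ac cq); exists U.
Qed.

(** Tangent vectors act on global smooth functions only; this lets them act on
    functions that are smooth near [p], such as coordinates. *)
Lemma smooth_near_germ p f : smooth_near p f ->
  exists2 F, smooth_fun F & \forall q \near p, F q = f q.
Proof.
move=> /smooth_near_open[W [oW Wp Sf]].
have [b [K [Sb b1 cK KO bK]]] := mfd_bump oW Wp.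
exists (b * f); first exact: (smooth_fun_cutoff Sb cK KO bK Sf).
by apply: filterS b1 => q bq; rewrite !fctE bq mul1r.
Qed.

End Charts.

(** * Smooth maps *)

Section Maps.
Variables (R : realType) (n k : nat) (M : manifold R n) (N : manifold R k).
Implicit Types (p q : M) (phi : M -> N).

Section open_domain.
Variables (U : set M) (phi : M -> N).
Hypothesis Sphi : smooth_map_on_open U phi.

Lemma smooth_map_near q f : U q -> smooth_near (phi q) f ->
  smooth_near q (f \o phi).
Proof.
move=> Uq Sf; have [c [d [V [[Ac Ad] [oV Vq] VU Vd S]]]] := Sphi Uq.
have cq : chart_dom c q by have [] := VU _ Vq.
have dq : chart_dom d (phi q) by apply: Vd; exists q.
have [U' [oU' U'q SU']] := Sf d Ad dq.
apply: (smooth_nearE Ac cq).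
have cVq : (chart_map c @` V) (chart_map c q) by exists q.
have ct : (chart_map d \o phi \o chart_inv c) @ chart_map c q
    --> chart_map d (phi q).
  have := S 0%N _ cVq; rewrite /prop_for /continuous_at /=.
  by rewrite (chart_mapK (mfd_chart (mfdP M) Ac) cq).
have h1 := chart_inv_near Ac cq (open_nbhs_nbhs (conj oV Vq)).
have h2 := chart_cod_near Ac cq.
have h3 : \forall x \near chart_map c q,
    U' (chart_map d (phi (chart_inv c x))).
  by apply: ct; exact: open_near.
have [W [oW Wq HW]] := rV_near_open (filterI h1 (filterI h2 h3)).
exists W; split=> // l.
have WS x : W x -> (chart_map c @` V) x.
  by move=> /HW[Vx [cx _]]; exists (chart_inv c x) => //; exact: chart_invK.
apply: (@class_C_ext _ _ _ _ _
    ((f \o chart_inv d) \o (chart_map d \o phi \o chart_inv c))) => //.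
  move=> x /HW[Vx _] /=; rewrite (chart_mapK (mfd_chart (mfdP N) Ad))//.
  by apply: Vd; exists (chart_inv c x).
apply: (class_C_comp oW oU'); [by move=> x /HW[_ []]| |exact: SU'].
move=> j; apply: (@class_C_row _ _ _ _ _ (chart_map d \o phi \o chart_inv c)) => //.
exact: class_C_sub WS (S l).
Qed.

Lemma smooth_map_cont q : U q -> {for q, continuous phi}.
Proof.
move=> Uq; have [c [d [V [[Ac Ad] [oV Vq] VU Vd S]]]] := Sphi Uq.
have cq : chart_dom c q by have [] := VU _ Vq.
have dq : chart_dom d (phi q) by apply: Vd; exists q.
have cVq : (chart_map c @` V) (chart_map c q) by exists q.
have ct : (chart_map d \o phi \o chart_inv c) @ chart_map c q
    --> chart_map d (phi q).
  have := S 0%N _ cVq; rewrite /prop_for /continuous_at /=.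
  by rewrite (chart_mapK (mfd_chart (mfdP M) Ac) cq).
suff H : phi @ q --> phi q by exact: H.
move=> A /(chart_inv_near Ad dq) hA.
have : \forall x \near chart_map c q,
    A (chart_inv d (chart_map d (phi (chart_inv c x)))) by exact: (ct _ hA).
move=> /(chart_map_near Ac cq) h.
apply: filterS2 h (open_nbhs_nbhs (conj oV Vq)) => q' + Vq'.
rewrite (chart_mapK (mfd_chart (mfdP M) Ac)); last by have [] := VU _ Vq'.
by rewrite (chart_mapK (mfd_chart (mfdP N) Ad))//; apply: Vd; exists q'.
Qed.

End open_domain.

Lemma smooth_fun_map phi f : smooth_map phi -> smooth_fun f ->
  smooth_fun (f \o phi).
Proof.
move=> Sphi /smooth_funP Sf; apply/smooth_funP => q.
by apply: (smooth_map_near Sphi).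
Qed.

Lemma smooth_map_continuous phi : smooth_map phi -> continuous phi.
Proof. by move=> Sphi q; exact: (smooth_map_cont Sphi). Qed.

End Maps.

(** * Tangent vectors as derivations *)

Section Derivations.
Variables (R : realType) (n : nat) (M : manifold R n).
Implicit Types (p q : M) (f g : M -> R) (v w : tvec M).

Lemma tangentD p v f g : tangent p v -> smooth_fun f -> smooth_fun g ->
  v (f + g) = v f + v g.
Proof.
by move=> Tv Sf Sg; have := tangent_linear Tv 1 Sf Sg; rewrite scale1r mul1r.
Qed.

Lemma tangent0 p v : tangent p v -> v 0 = 0.
Proof.
move=> Tv; have S0 := smooth_fun_cst (M := M) 0.
have /eqP := tangentD Tv S0 S0.
by rewrite addr0 -subr_eq0 opprD addrA subrr sub0r oppr_eq0 => /eqP.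
Qed.

Lemma tangentZ p v a f : tangent p v -> smooth_fun f -> v (a *: f) = a * v f.
Proof.
move=> Tv Sf; have S0 := smooth_fun_cst (M := M) 0.
by have := tangent_linear Tv a Sf S0; rewrite addr0 (tangent0 Tv) addr0.
Qed.

Lemma tangentB p v f g : tangent p v -> smooth_fun f -> smooth_fun g ->
  v (f - g) = v f - v g.
Proof.
move=> Tv Sf Sg; rewrite (tangentD Tv Sf (smooth_funN Sg)).
by rewrite -scaleN1r (tangentZ _ Tv)// mulN1r.
Qed.

Lemma tangentN p v f : tangent p v -> smooth_fun f -> v (- f) = - v f.
Proof. by move=> Tv Sf; rewrite -scaleN1r (tangentZ _ Tv)// mulN1r. Qed.

Lemma tangent_cst p v a : tangent p v -> v (cst a) = 0.
Proof.
move=> Tv; have S1 := smooth_fun_cst (M := M) 1.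
have E1 : cst 1 * cst 1 = cst 1 :> (M -> R).
  by apply/funext => x; rewrite !fctE mulr1.
have := tangent_leibniz Tv S1 S1; rewrite E1 /= mul1r => /eqP.
rewrite -subr_eq0 opprD addrA subrr sub0r oppr_eq0 => /eqP v1.
rewrite (_ : cst a = a *: cst 1); first by rewrite (tangentZ _ Tv)// v1 mulr0.
by apply/funext => x; exact: (esym (mulr1 a)).
Qed.

Lemma tangent_sum p v (I : Type) (r : seq I) (P : pred I) (F : I -> M -> R) :
  tangent p v -> (forall i, smooth_fun (F i)) ->
  v (\sum_(i <- r | P i) F i) = \sum_(i <- r | P i) v (F i).
Proof.
move=> Tv SF.
suff [] : smooth_fun (\sum_(i <- r | P i) F i) /\
  v (\sum_(i <- r | P i) F i) = \sum_(i <- r | P i) v (F i) by [].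
elim/big_rec2: _ => [|i a f Pi [Sf <-]].
  by split; [exact: smooth_fun_cst|exact: tangent0 Tv].
by split; [exact: smooth_funD|rewrite (tangentD Tv)].
Qed.

(** For a bump function [b] at [p] supported where [f] and [g] agree,
    [b * (f - g) = 0], and the Leibniz rule gives [v (f - g) = 0]. *)
Lemma tangent_local p v f g : tangent p v -> smooth_fun f -> smooth_fun g ->
  (\forall q \near p, f q = g q) -> v f = v g.
Proof.
move=> Tv Sf Sg fg; apply/eqP; rewrite -subr_eq0 -(tangentB Tv)//; apply/eqP.
have : nbhs p (fun q => f q = g q) by [].
rewrite nbhsE => -[W [oW Wp] HW].
have [b [K [Sb b1 cK KW bK]]] := mfd_bump oW Wp.
have Sh := smooth_funB Sf Sg.
have E : b * (f - g) = 0.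
  apply/funext => q; have [Kq|/bK] := pselect (K q).
    by rewrite !fctE /= (HW _ (KW _ Kq)) subrr mulr0.
  by rewrite !fctE => ->; rewrite mul0r.
have := tangent_leibniz Tv Sb Sh.
rewrite E (tangent0 Tv) (nbhs_singleton b1) mul1r.
by rewrite !fctE (HW _ Wp) subrr mul0r addr0 => <-.
Qed.

(** The chain rule. By Hadamard's lemma [F] is a constant plus a combination of
    the [f j - f j p], whose coefficients at [p] are the partial derivatives of
    [Phi]; the Leibniz rule leaves these coefficients only. *)
Lemma tangent_chain p v (k : nat) (f : 'I_k -> M -> R) (V : set 'rV[R]_k)
    (Phi : 'rV[R]_k -> R) F :
  tangent p v -> (forall j, smooth_fun (f j)) ->
  open V -> V (\row_j f j p) -> smooth_on V Phi ->
  smooth_fun F -> (\forall q \near p, F q = Phi (\row_j f j q)) ->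
  v F = \sum_j 'D_(delta_mx 0 j) Phi (\row_j f j p) * v (f j).
Proof.
move=> Tv Sf oV Vp SPhi SF HF.
have [W [H [oW [Wp WV] SH H0 HE]]] := hadamard oV Vp SPhi.
have /choice[G HG] : forall j, exists G, smooth_fun G /\
    \forall q \near p, G q = H j (\row_j f j q).
  move=> j; have := @smooth_near_comp R n M p k f W (H j) oW Wp (SH j).
  move=> /(_ (fun i => (smooth_funP _).1 (Sf i) p)) /smooth_near_germ[G SG E].
  by exists G.
have SG j : smooth_fun (G j) by have [] := HG j.
pose fp j := f j - cst (f j p).
have Sfp j : smooth_fun (fp j) by apply: smooth_funB => //; exact: smooth_fun_cst.
pose F' := cst (Phi (\row_j f j p)) + \sum_j fp j * G j.
have SS : smooth_fun (\sum_j fp j * G j).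
  by apply: smooth_fun_sum => j _; exact: smooth_funM.
have -> : v F = v F'.
  apply: (tangent_local Tv) => //.
    by apply: smooth_funD => //; exact: smooth_fun_cst.
  have h1 : \forall q \near p, W (\row_j f j q).
    have : (fun x => \row_j f j x) @ p --> \row_j f j p.
      apply: cvg_row => j.
      rewrite (_ : (fun x => _) = f j); last by apply/funext => x; rewrite mxE.
      by rewrite mxE; apply: smooth_near_continuous; exact: (smooth_funP _).1.
    by apply; exact: open_near.
  have h2 : \forall q \near p, forall j, G j q = H j (\row_j f j q).
    apply: (@filter_forall _ _ (fun j q => G j q = H j (\row_j f j q)) (nbhs p) _) => j.
    by have [] := HG j.
  apply: filterS3 HF h1 h2 => q -> /HE -> h2.
  rewrite /F' !fctE fct_sumE; congr (_ + _); apply: eq_bigr => j _.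
  by rewrite /fp !fctE !mxE h2.
rewrite /F' (tangentD Tv)//; last exact: smooth_fun_cst.
rewrite (tangent_cst _ Tv) add0r (tangent_sum _ _ Tv); last first.
  by move=> j; exact: smooth_funM.
apply: eq_bigr => j _; rewrite (tangent_leibniz Tv)// {1}/fp !fctE subrr mul0r add0r.
have [_ /nbhs_singleton ->] := HG j; rewrite H0; congr (_ * _).
by rewrite /fp (tangentB Tv)//; [rewrite (tangent_cst _ Tv) subr0|exact: smooth_fun_cst].
Qed.

Lemma tangent_add p v w : tangent p v -> tangent p w -> tangent p (v + w).
Proof.
move=> Tv Tw; have E h : (v + w) h = v h + w h by [].
split.
- move=> a f g Sf Sg; rewrite !E (tangent_linear Tv)// (tangent_linear Tw)//.
  by ring.
- move=> f g Sf Sg; rewrite !E (tangent_leibniz Tv)// (tangent_leibniz Tw)//.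
  by ring.
- by move=> f Sf; rewrite !E (tangent_junk Tv)// (tangent_junk Tw)// addr0.
Qed.

Lemma tangent_scale p a v : tangent p v -> tangent p (a *: v).
Proof.
move=> Tv; have E h : (a *: v) h = a * v h by [].
split.
- by move=> b f g Sf Sg; rewrite !E (tangent_linear Tv)//; ring.
- by move=> f g Sf Sg; rewrite !E (tangent_leibniz Tv)//; ring.
- by move=> f Sf; rewrite !E (tangent_junk Tv)// mulr0.
Qed.

Lemma tangent_zero p : tangent p (0 : tvec M).
Proof. by split=> *; rewrite /= ?mulr0 ?addr0. Qed.

Lemma tangent_opp p v : tangent p v -> tangent p (- v).
Proof. by move=> Tv; rewrite -scaleN1r; exact: tangent_scale. Qed.

Lemma tangent_bigsum p (I : Type) (r : seq I) (V : I -> tvec M) :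
  (forall i, tangent p (V i)) -> tangent p (\sum_(i <- r) V i).
Proof.
move=> TV; elim/big_rec: _ => [|i v _ Tv]; first exact: tangent_zero.
exact: tangent_add.
Qed.

(** ** Coordinates *)

Definition coords_near p (c : chart R n M) (x : 'I_n -> M -> R) : Prop :=
  (forall j, smooth_fun (x j)) /\
  \forall q \near p, \row_j x j q = chart_map c q.

Lemma exists_coords p c : atlas M c -> chart_dom c p ->
  exists x, coords_near p c x.
Proof.
move=> Ac cp.
have /choice[x Hx] : forall j, exists x, smooth_fun x /\
    \forall q \near p, x q = chart_map c q 0 j.
  move=> j.
  have : smooth_near p (fun q => chart_map c q 0 j).
    apply: (smooth_nearE Ac cp); exists (chart_cod c); split.
    - exact: (open_chart_cod (mfd_chart (mfdP M) Ac)).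
    - exact: chart_cod_map.
    - move=> k; apply: (@class_C_ext _ _ _ _ _ (fun x : 'rV[R]_n => x 0 j)).
      + exact: (open_chart_cod (mfd_chart (mfdP M) Ac)).
      + by move=> x cx /=; rewrite chart_invK.
      + exact: class_C_coord.
  by move=> /smooth_near_germ[F SF HF]; exists F.
exists x; split=> [j|]; first by have [] := Hx j.
have h : \forall q \near p, forall j, x j q = chart_map c q 0 j.
  apply: (@filter_forall _ _ (fun j q => x j q = chart_map c q 0 j) (nbhs p) _) => j.
  by have [] := Hx j.
by apply: filterS h => q hq; apply/rowP => j; rewrite mxE hq.
Qed.

Lemma tangent_coords p c x v f : atlas M c -> chart_dom c p ->
  coords_near p c x -> tangent p v -> smooth_fun f ->
  v f = \sum_j 'D_(delta_mx 0 j) (f \o chart_inv c) (chart_map c p) * v (x j).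
Proof.
move=> Ac cp [Sx xE] Tv Sf; rewrite -(nbhs_singleton xE).
apply: (@tangent_chain p v n x (chart_cod c)) => //.
- exact: (open_chart_cod (mfd_chart (mfdP M) Ac)).
- by rewrite (nbhs_singleton xE); exact: chart_cod_map.
- exact: Sf.
- apply: filterS2 xE (chart_dom_near Ac cp) => q -> cq /=.
  by rewrite (chart_mapK (mfd_chart (mfdP M) Ac)).
Qed.

Definition coord_vec (c : chart R n M) (u : 'rV[R]_n) (p : M) : tvec M :=
  fun f => if `[< smooth_fun f >] then 'D_u (f \o chart_inv c) (chart_map c p)
           else 0.

Lemma coord_vecE c u p f : smooth_fun f ->
  coord_vec c u p f = 'D_u (f \o chart_inv c) (chart_map c p).
Proof. by move=> Sf; rewrite /coord_vec asboolT. Qed.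

Lemma differentiable_chart c p f : atlas M c -> chart_dom c p -> smooth_fun f ->
  differentiable (f \o chart_inv c) (chart_map c p).
Proof.
by move=> Ac cp Sf; have [d _] := Sf c Ac 1%N; apply: d; exact: chart_cod_map.
Qed.

Lemma tangent_coord_vec c u p : atlas M c -> chart_dom c p ->
  tangent p (coord_vec c u p).
Proof.
move=> Ac cp.
have D f : smooth_fun f -> derivable (f \o chart_inv c) (chart_map c p) u.
  by move=> Sf; apply: diff_derivable; exact: differentiable_chart.
have cK := chart_mapK (mfd_chart (mfdP M) Ac) cp.
split.
- move=> a f g Sf Sg; rewrite !coord_vecE//; last first.
    by apply: smooth_funD => //; exact: smooth_funZ.
  rewrite (_ : (_ \o _) = a *: (f \o chart_inv c) + (g \o chart_inv c))//.
  rewrite deriveD; [|apply: derivableZ; exact: D|exact: D].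
  by rewrite deriveZ//; exact: D.
- move=> f g Sf Sg; rewrite !coord_vecE//; last exact: smooth_funM.
  rewrite (_ : (_ \o _) = (f \o chart_inv c) * (g \o chart_inv c))//.
  rewrite deriveM; [|exact: D|exact: D].
  by rewrite /= cK.
- by move=> f Sf; rewrite /coord_vec asboolF.
Qed.

Lemma coord_vec_coords c u p x j : atlas M c -> chart_dom c p ->
  coords_near p c x -> coord_vec c u p (x j) = u 0 j.
Proof.
move=> Ac cp [Sx xE]; rewrite coord_vecE// -(derive_coord (chart_map c p)).
apply: near_eq_derive.
have h := chart_inv_near Ac cp xE.
apply: filterS2 h (chart_cod_near Ac cp) => y h cy /=.
by rewrite -[in RHS](chart_invK Ac cy) -h mxE.
Qed.

(** The derivations at [p] are the directional derivatives in a chart. *)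
Lemma tangent_coord_vecE c p x v : atlas M c -> chart_dom c p ->
  coords_near p c x -> tangent p v -> v = coord_vec c (\row_j v (x j)) p.
Proof.
move=> Ac cp xc Tv; apply/funext => f.
have [Sf|Sf] := pselect (smooth_fun f); last first.
  by rewrite (tangent_junk Tv)// /coord_vec asboolF.
rewrite (tangent_coords Ac cp xc Tv Sf) coord_vecE// diff_sum_partial.
  by apply: eq_bigr => j _; rewrite mxE mulrC.
exact: differentiable_chart.
Qed.

End Derivations.

(** * Vector fields *)

Section VectorFields.
Variables (R : realType) (n : nat) (M : manifold R n).
Implicit Types (p q : M) (f g : M -> R) (v w : tvec M) (X Y : M -> tvec M).

Lemma tvec_sumE (I : Type) (r : seq I) (P : pred I) (V : I -> tvec M) f :
  (\sum_(i <- r | P i) V i) f = \sum_(i <- r | P i) V i f.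
Proof. by rewrite fct_sumE. Qed.

Lemma vector_field_zero : vector_field (fun _ => 0 : tvec M).
Proof. by split=> *; [exact: tangent_zero|exact: smooth_fun_cst]. Qed.

Lemma vector_field_add X Y : vector_field X -> vector_field Y ->
  vector_field (fun q => X q + Y q).
Proof.
move=> [TX SX] [TY SY]; split=> [q|f Sf]; first exact: tangent_add.
by apply: (@smooth_funD _ _ _ (fun q => X q f)); [exact: SX|exact: SY].
Qed.

Lemma vector_field_scale X f : vector_field X -> smooth_fun f ->
  vector_field (fun q => f q *: X q).
Proof.
move=> [TX SX] Sf; split=> [q|g Sg]; first exact: tangent_scale.
by apply: (@smooth_funM _ _ _ f (fun q => X q g)) => //; exact: SX.
Qed.

Lemma vector_field_sum (I : Type) (r : seq I) (V : I -> M -> tvec M) :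
  (forall i, vector_field (V i)) -> vector_field (fun q => \sum_(i <- r) V i q).
Proof.
move=> HV; elim: r => [|i r IH].
  rewrite (_ : (fun _ => _) = fun=> 0); first exact: vector_field_zero.
  by apply/funext => q; rewrite big_nil.
rewrite (_ : (fun _ => _) = fun q => V i q + \sum_(i <- r) V i q).
  exact: vector_field_add.
by apply/funext => q; rewrite big_cons.
Qed.

Lemma vector_field_bracket X Y : vector_field X -> vector_field Y ->
  vector_field (vf_bracket X Y).
Proof.
move=> [TX SX] [TY SY]; split=> [p|f Sf]; last first.
  apply: (@smooth_funB _ _ _ (fun q => X q (fun q' => Y q' f))).
    by apply: SX; exact: SY.
  by apply: SY; exact: SX.
have L Z (TZ : forall p, tangent p (Z p)) a f g : smooth_fun f -> smooth_fun g ->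
    (fun q => Z q (a *: f + g)) = a *: (fun q => Z q f) + (fun q => Z q g).
  by move=> Sf Sg; apply/funext => q; rewrite (tangent_linear (TZ q)).
have P Z (TZ : forall p, tangent p (Z p)) f g : smooth_fun f -> smooth_fun g ->
    (fun q => Z q (f * g)) = f * (fun q => Z q g) + g * (fun q => Z q f).
  by move=> Sf Sg; apply/funext => q; rewrite (tangent_leibniz (TZ q)).
split.
- move=> a f g Sf Sg; rewrite /vf_bracket (L _ TY)// (L _ TX)//.
  rewrite (tangent_linear (TX p)); [|exact: SY|exact: SY].
  rewrite (tangent_linear (TY p)); [|exact: SX|exact: SX].
  by ring.
- move=> f g Sf Sg; rewrite /vf_bracket (P _ TY)// (P _ TX)//.
  have SYf := SY f Sf; have SYg := SY g Sg; have SXf := SX f Sf; have SXg := SX g Sg.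
  rewrite (tangentD (TX p)); [|exact: smooth_funM|exact: smooth_funM].
  rewrite (tangentD (TY p)); [|exact: smooth_funM|exact: smooth_funM].
  by rewrite !(tangent_leibniz (TX p))// !(tangent_leibniz (TY p))//; ring.
- move=> f Sf; rewrite /vf_bracket.
  have Z0 Z (TZ : forall p, tangent p (Z p)) : (fun q => Z q f) = 0.
    by apply/funext => q; rewrite (tangent_junk (TZ q)).
  by rewrite (Z0 _ TX) (Z0 _ TY) (tangent0 (TX p)) (tangent0 (TY p)) subrr.
Qed.

Lemma tangent_tmap (k : nat) (N : manifold R k) (phi : M -> N) p v :
  smooth_map phi -> tangent p v -> tangent (phi p) (tmap phi v).
Proof.
move=> Sphi Tv; have S (f : N -> R) := @smooth_fun_map _ _ _ _ _ phi f Sphi.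
split.
- move=> a f g Sf Sg; rewrite /tmap !asboolT//.
    by rewrite -(tangent_linear Tv)//; exact: S.
  by apply: smooth_funD => //; exact: smooth_funZ.
- move=> f g Sf Sg; rewrite /tmap !asboolT//; last exact: smooth_funM.
  by rewrite -[RHS](@tangent_leibniz _ _ _ _ _ Tv (f \o phi) (g \o phi))//; exact: S.
- by move=> f Sf; rewrite /tmap asboolF.
Qed.

Lemma tmapE (k : nat) (N : manifold R k) (phi : M -> N) v (f : N -> R) :
  smooth_fun f -> tmap phi v f = v (f \o phi).
Proof. by move=> Sf; rewrite /tmap asboolT. Qed.

Lemma tmapD (k : nat) (N : manifold R k) (phi : M -> N) v w :
  tmap phi (v + w) = tmap phi v + tmap phi w.
Proof.
apply/funext => f; rewrite /tmap !fctE; case: asboolP => // _.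
by rewrite addr0.
Qed.

Lemma tmapZ (k : nat) (N : manifold R k) (phi : M -> N) a v :
  tmap phi (a *: v) = a *: tmap phi v.
Proof.
apply/funext => f; rewrite /tmap -[RHS]/(a * _); case: asboolP => // _.
by rewrite mulr0.
Qed.

Lemma tmapN (k : nat) (N : manifold R k) (phi : M -> N) v :
  tmap phi (- v) = - tmap phi v.
Proof. by rewrite -scaleN1r tmapZ scaleN1r. Qed.

(** The fields [E i] are the constant fields of a chart, multiplied by a bump
    function [b] supported where the [x i] are the coordinates of this chart;
    off the support both sides of the decomposition vanish. *)
Lemma exists_local_frame p :
  exists (x : 'I_n -> M -> R) (E : 'I_n -> M -> tvec M) (b : M -> R),
    [/\ forall i, smooth_fun (x i), forall i, vector_field (E i),
        smooth_fun b, b p = 1 &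
        forall q v, tangent q v -> b q *: v = \sum_i v (x i) *: E i q].
Proof.
have [c Ac cp] := exists_chart p; have [x [Sx xE]] := exists_coords Ac cp.
have : nbhs p (fun q => \row_j x j q = chart_map c q /\ chart_dom c q).
  by apply: filterI xE _; exact: chart_dom_near.
rewrite nbhsE => -[W [oW Wp] HW].
have xW q : W q -> coords_near q c x.
  move=> Wq; split=> //.
  by apply: filterS (open_nbhs_nbhs (conj oW Wq)) => q' /HW[].
have cW q : W q -> chart_dom c q by move=> /HW[].
have [b [K [Sb b1 cK KW bK]]] := mfd_bump oW Wp.
have bW q : ~ W q -> b q = 0 by move=> Wq; apply: bK => /KW.
exists x, (fun i q => b q *: coord_vec c (delta_mx 0 i) q), b; split=> //.
- move=> i; split=> [q|f Sf].
    have [Wq|/bW ->] := pselect (W q).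
      by apply: tangent_scale; apply: tangent_coord_vec => //; exact: cW.
    by rewrite scale0r; exact: tangent_zero.
  apply: (@smooth_fun_cutoff _ _ _ W b
    (fun q => coord_vec c (delta_mx 0 i) q f) K) => // q Wq.
  apply: (@smooth_near_ext _ _ _ _
    (('D_(delta_mx 0 i) (f \o chart_inv c)) \o chart_map c)).
    by near=> q'; rewrite coord_vecE.
  apply: (smooth_nearE Ac (cW _ Wq)); exists (chart_cod c); split.
  + exact: (open_chart_cod (mfd_chart (mfdP M) Ac)).
  + by apply: chart_cod_map; exact: cW.
  + move=> k; apply: (@class_C_ext _ _ _ _ _ ('D_(delta_mx 0 i) (f \o chart_inv c))).
    * exact: (open_chart_cod (mfd_chart (mfdP M) Ac)).
    * by move=> y cy /=; rewrite chart_invK.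
    * exact: (smooth_on_derive _ (Sf c Ac)).
- exact: (nbhs_singleton b1).
- move=> q v Tv; have [Wq|/bW ->] := pselect (W q); last first.
    rewrite scale0r big1// => i _.
    by rewrite scale0r scaler0.
  rewrite {1}(tangent_coord_vecE Ac (cW _ Wq) (xW _ Wq) Tv).
  apply/funext => f; rewrite tvec_sumE.
  have [Sf|Sf] := pselect (smooth_fun f); last first.
    transitivity (0 : R).
      by rewrite -[LHS]/(b q * _) /coord_vec asboolF// mulr0.
    rewrite big1// => i _; rewrite -[LHS]/(_ * (_ * _)).
    by rewrite /coord_vec asboolF// !mulr0.
  rewrite -[LHS]/(b q * _) coord_vecE// diff_sum_partial; last first.
    by apply: differentiable_chart => //; exact: cW.
  rewrite mulr_sumr; apply: eq_bigr => i _.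
  by rewrite -[RHS]/(_ * (_ * _)) coord_vecE// mxE /GRing.scale/= mulrCA.
Unshelve. all: by end_near. Qed.

Lemma exists_vector_field p v : tangent p v ->
  exists2 V, vector_field V & V p = v.
Proof.
move=> Tv; have [x [E [b [Sx VE Sb bp H]]]] := exists_local_frame p.
exists (fun q => \sum_i v (x i) *: E i q).
  apply: vector_field_sum => i.
  by apply: (@vector_field_scale (E i) (cst (v (x i)))) => //; exact: smooth_fun_cst.
by rewrite -H// bp scale1r.
Qed.

Lemma smooth_fun_det (k : nat) (a : 'I_k -> 'I_k -> M -> R) :
  (forall i j, smooth_fun (a i j)) ->
  smooth_fun (fun q => \det (\matrix_(i, j) a i j q)).
Proof.
move=> Sa; rewrite (_ : (fun _ => _) = \sum_(s : 'S_k)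
    ((-1) ^+ s *: \prod_i a i (s i))).
  apply: smooth_fun_sum => s _; apply: smooth_funZ.
  by apply: smooth_fun_prod => i _.
apply/funext => q; rewrite fct_sumE; apply: eq_bigr => s _.
rewrite -[RHS]/(_ * _); congr (_ * _).
by rewrite fct_prodE; apply: eq_bigr => i _; rewrite mxE.
Qed.

Lemma smooth_fun_adj (k : nat) (a : 'I_k -> 'I_k -> M -> R) i j :
  (forall i j, smooth_fun (a i j)) ->
  smooth_fun (fun q => (\adj (\matrix_(i, j) a i j q)) i j).
Proof.
move=> Sa; rewrite (_ : (fun _ => _) = (-1) ^+ (j + i) *:
   (fun q => \det (\matrix_(i', j') a (lift j i') (lift i j') q))).
  by apply: smooth_funZ; exact: smooth_fun_det.
apply/funext => q; rewrite mxE /cofactor -[RHS]/(_ * _); congr (_ * \det _).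
by apply/matrixP => i' j'; rewrite !mxE.
Qed.

End VectorFields.

(** * Submersions *)

Section Submersion.
Variables (R : realType) (n m : nat) (M : manifold R n) (N : manifold R m).
Variable phi : M -> N.
Hypothesis Hphi : surjective_submersion phi.
Implicit Types (p q : M) (v w : tvec M).

Let Sphi : smooth_map phi := subm_smooth Hphi.

(** The functions [A k] are coordinates of [N] around [phi p], composed with
    [phi]; the vectors [V j] lift the corresponding coordinate vectors. *)
Lemma submersion_functions p :
  exists (A : 'I_m -> M -> R) (V : 'I_m -> tvec M),
  [/\ forall k, smooth_fun (A k), forall j, tangent p (V j),
      forall j k, V j (A k) = (j == k)%:R,
      (\forall q \near p, (forall k, A k q = A k p) -> phi q = phi p) &
      (\forall q \near p, forall w, tangent q w ->
         (forall k, w (A k) = 0) <-> tmap phi w = 0)].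
Proof.
have [d Ad dp] := exists_chart (phi p).
have [z zc] := exists_coords Ad dp; have [Sz zE] := zc.
have cphi := smooth_map_continuous Sphi.
have T j := tangent_coord_vec (delta_mx 0 j) Ad dp.
have /choice[V HV] : forall j, exists v, tangent p v /\
    tmap phi v = coord_vec d (delta_mx 0 j) (phi p).
  by move=> j; have [v Tv E] := subm_tangent Hphi (T j); exists v.
exists (fun k => z k \o phi), V.
have SA k : smooth_fun (z k \o phi) by exact: smooth_fun_map.
split=> //.
- by move=> j; have [] := HV j.
- move=> j k; have [_ E] := HV j.
  by rewrite -tmapE// E (coord_vec_coords _ _ Ad dp zc) mxE eqxx eq_sym.
- have h : \forall q \near p, \row_j z j (phi q) = chart_map d (phi q) /\
      chart_dom d (phi q).
    exact: (cphi p _ (filterI zE (chart_dom_near Ad dp))).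
  apply: filterS h => q [zq dq] Aq.
  rewrite -(chart_mapK (mfd_chart (mfdP N) Ad) dq).
  rewrite -(chart_mapK (mfd_chart (mfdP N) Ad) dp) -zq -(nbhs_singleton zE).
  by congr (chart_inv d _); apply/rowP => k; rewrite !mxE; exact: Aq.
- have : nbhs (phi p) (fun y => \row_j z j y = chart_map d y /\ chart_dom d y).
    by apply: filterI zE _; exact: chart_dom_near.
  rewrite nbhsE => -[W [oW Wp] HW].
  have h : \forall q \near p, W (phi q).
    exact: (cphi p _ (open_nbhs_nbhs (conj oW Wp))).
  apply: filterS h => q Wq w Tw; split=> [wA|w0 k]; last first.
    by rewrite -tmapE// w0.
  have [_ dq] := HW _ Wq.
  have zq : coords_near (phi q) d z.
    by split=> //; apply: filterS (open_nbhs_nbhs (conj oW Wq)) => y /HW[].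
  rewrite (tangent_coord_vecE Ad dq zq (tangent_tmap Sphi Tw)).
  rewrite (_ : \row_j _ = 0).
    apply/funext => f; have [Sf|Sf] := pselect (smooth_fun f).
      by rewrite coord_vecE// derive0.
    by rewrite /coord_vec asboolF.
  by apply/rowP => k; rewrite !mxE tmapE.
Qed.

(** The infinitesimal form of the implicit function theorem: in a chart it is
    [level_set_tangent], for the functions of [submersion_functions]. *)
Lemma vertical_vanish p v F : tangent p v -> tmap phi v = 0 -> smooth_fun F ->
  (\forall q \near p, phi q = phi p -> F q = 0) -> v F = 0.
Proof.
move=> Tv v0 SF HF.
have [A [V [SA TV VA HA HA']]] := submersion_functions p.
have vA k : v (A k) = 0 by have /(_ v Tv)[_] := nbhs_singleton HA'; exact.
have [c Ac cp] := exists_chart p; have [x xc] := exists_coords Ac cp.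
have cK := chart_mapK (mfd_chart (mfdP M) Ac).
have repr w f : tangent p w -> smooth_fun f ->
    w f = 'D_(\row_i w (x i)) (f \o chart_inv c) (chart_map c p).
  by move=> Tw Sf; rewrite {1}(tangent_coord_vecE Ac cp xc Tw) coord_vecE.
rewrite repr//.
pose B : 'M[R]_(m, n) := \matrix_(j, i) V j (x i).
apply: (@level_set_tangent R m n (chart_cod c) (fun k => A k \o chart_inv c) B).
- exact: (open_chart_cod (mfd_chart (mfdP M) Ac)).
- exact: chart_cod_map.
- by move=> k; exact: (SA k c Ac 1%N).
- move=> j k; rewrite -VA repr//; congr ('D_ _ _ _).
  by apply/rowP => i; rewrite !mxE.
- by move=> k; rewrite -repr.
- exact: differentiable_chart.
- have HAF : \forall q \near p, ((forall k, A k q = A k p) -> phi q = phi p)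
      /\ (phi q = phi p -> F q = 0) by exact: filterI.
  have h := chart_inv_near Ac cp HAF.
  apply: rV_filterS h => y [h1 h2] Ay; apply: h2; apply: h1 => k.
  by have := Ay k; rewrite /= cK.
Qed.

(** The fields [Z i] are obtained from a local frame by the projection onto the
    kernel along fields transverse to the fibres; the projection is scaled by a
    determinant, so that no division occurs. *)
Lemma exists_vertical_frame p :
  exists (x : 'I_n -> M -> R) (Z : 'I_n -> M -> tvec M) (b : M -> R),
    [/\ forall i, smooth_fun (x i),
        forall i, vector_field (Z i) /\ forall q, tmap phi (Z i q) = 0,
        smooth_fun b, b p = 1 &
        forall q v, tangent q v -> tmap phi v = 0 ->
          b q *: v = \sum_i v (x i) *: Z i q].
Proof.
have [A [V0 [SA TV0 VA _ HA]]] := submersion_functions p.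
have /choice[V HV] : forall j, exists V, vector_field V /\ V p = V0 j.
  by move=> j; have [V] := exists_vector_field (TV0 j); exists V.
have VV j : vector_field (V j) by have [] := HV j.
have TV j q : tangent q (V j q) by have [h _] := VV j; exact: h.
pose Nm q : 'M[R]_m := \matrix_(j, k) V j q (A k).
have SN j k : smooth_fun (fun q => V j q (A k)) by have [_ h] := VV j; exact: h.
have [x [E [b1 [Sx VE Sb1 b1p HE]]]] := exists_local_frame p.
have : nbhs p (fun q => forall w, tangent q w ->
         (forall k, w (A k) = 0) <-> tmap phi w = 0) by exact: HA.
rewrite nbhsE => -[W [oW Wp] HW].
have [b2 [K [Sb2 b2p cK KW bK]]] := mfd_bump oW Wp.
pose coef q w j := \sum_k w (A k) * \adj (Nm q) k j.
pose P q (w : tvec M) : tvec M :=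
  \det (Nm q) *: w - \sum_j coef q w j *: V j q.
have PE q w f : P q w f = \det (Nm q) * w f - \sum_j coef q w j * V j q f.
  rewrite /P -[LHS]/(_ * w f - (\sum_j _ *: _) f); congr (_ - _).
  by rewrite tvec_sumE.
have TP q w : tangent q w -> tangent q (P q w).
  move=> Tw; apply: tangent_add; first exact: tangent_scale.
  by apply: tangent_opp; apply: tangent_bigsum => j; exact: tangent_scale.
have PA q w l : P q w (A l) = 0.
  rewrite PE /coef.
  under eq_bigr do rewrite mulr_suml.
  rewrite exchange_big/=; apply/eqP; rewrite subr_eq0 eq_sym; apply/eqP.
  transitivity (\sum_k w (A k) * (\adj (Nm q) *m Nm q) k l).
    apply: eq_bigr => k _; rewrite mxE mulr_sumr; apply: eq_bigr => j _.
    by rewrite mulrA; congr (_ * _); rewrite mxE.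
  rewrite mul_adj_mx (bigD1 l)//= big1 ?addr0; last first.
    by move=> k /negPf kl; rewrite mxE kl mulr0n mulr0.
  by rewrite mxE eqxx mulr1n mulrC.
exists x, (fun i q => b2 q *: P q (E i q)),
  (b2 * (fun q => \det (Nm q)) * b1); split => //.
- move=> i; have [TE SE] := VE i; split; last first.
    move=> q; rewrite tmapZ; have [Kq|/bK ->] := pselect (K q); last first.
      by rewrite scale0r.
    rewrite (_ : tmap phi _ = 0) ?scaler0//.
    by apply/(HW q (KW _ Kq) _ (TP _ _ (TE q))).
  apply: (@vector_field_scale _ _ _ (fun q => P q (E i q))) => //.
  split=> [q|f Sf]; first exact: TP.
  rewrite (_ : (fun q => _) = (fun q => \det (Nm q)) * (fun q => E i q f)
     - \sum_j (\sum_k (fun q => E i q (A k)) * (fun q => \adj (Nm q) k j))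
         * (fun q => V j q f)); last first.
    apply/funext => q; rewrite PE !fctE fct_sumE; congr (_ - _).
    by apply: eq_bigr => j _; rewrite !fctE /coef fct_sumE.
  apply: smooth_funB.
    by apply: smooth_funM; [exact: smooth_fun_det|exact: SE].
  apply: smooth_fun_sum => j _; apply: smooth_funM.
    apply: smooth_fun_sum => k _; apply: smooth_funM; first exact: SE.
    exact: smooth_fun_adj.
  by have [_ h] := VV j; exact: h.
- by apply: smooth_funM => //; apply: smooth_funM => //; exact: smooth_fun_det.
- rewrite !fctE b1p (nbhs_singleton b2p) mul1r mulr1.
  rewrite (_ : Nm p = 1%:M) ?det1//.
  by apply/matrixP => j k; rewrite !mxE; have [_ ->] := HV j; exact: VA.
- move=> q v Tv v0.
  rewrite -[X in X *: v = _]/(b2 q * \det (Nm q) * b1 q).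
  have [Wq|Wq] := pselect (W q); last first.
    have b20 : b2 q = 0 by apply: bK => /KW.
    by rewrite b20 !mul0r scale0r big1// => i _; rewrite scale0r scaler0.
  have vA k : v (A k) = 0 by have [_] := HW q Wq v Tv; exact.
  have PL : \sum_i v (x i) *: P q (E i q) = P q (\sum_i v (x i) *: E i q).
    apply/funext => f; rewrite tvec_sumE PE tvec_sumE.
    rewrite mulr_sumr.
    transitivity (\sum_i (\det (Nm q) * (v (x i) * E i q f)
       - \sum_j v (x i) * coef q (E i q) j * V j q f)).
      apply: eq_bigr => i _; rewrite -[LHS]/(v (x i) * _) PE mulrBr mulrCA.
      by congr (_ - _); rewrite mulr_sumr; apply: eq_bigr => j _; rewrite mulrA.
    rewrite sumrB; congr (_ - _); rewrite exchange_big/=.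
    apply: eq_bigr => j _; rewrite -mulr_suml; congr (_ * _).
    rewrite /coef.
    transitivity (\sum_i \sum_k v (x i) * (E i q (A k) * \adj (Nm q) k j)).
      by apply: eq_bigr => i _; rewrite mulr_sumr.
    rewrite exchange_big/=; apply: eq_bigr => k _.
    rewrite tvec_sumE mulr_suml; apply: eq_bigr => i _.
    by rewrite mulrA.
  transitivity (b2 q *: P q (\sum_i v (x i) *: E i q)); last first.
    rewrite -PL scaler_sumr; apply: eq_bigr => i _.
    by rewrite !scalerA mulrC.
  rewrite -HE//; apply/funext => f.
  rewrite -[LHS]/(_ * _) -[RHS]/(_ * _) PE big1 ?subr0; last first.
    move=> j _; rewrite /coef big1 ?mul0r// => k _.
    by rewrite -[X in X * _]/(b1 q * v (A k)) vA mulr0 mul0r.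
  by rewrite -[X in _ * (_ * X)]/(b1 q * v f); ring.
Qed.

Lemma exists_vertical_field p v : tangent p v -> tmap phi v = 0 ->
  exists V, [/\ vector_field V, forall q, tmap phi (V q) = 0 & V p = v].
Proof.
move=> Tv v0; have [x [Z [b [Sx HZ Sb bp H]]]] := exists_vertical_frame p.
exists (fun q => \sum_i v (x i) *: Z i q); split.
- apply: vector_field_sum => i; have [VZ _] := HZ i.
  by apply: (@vector_field_scale _ _ _ (Z i) (cst (v (x i)))) => //; exact: smooth_fun_cst.
- move=> q; elim/big_rec: _ => [|i w _ w0].
    by apply/funext => f; rewrite /tmap; case: asboolP.
  by rewrite tmapD tmapZ w0 addr0; have [_ ->] := HZ i; rewrite scaler0.
- by rewrite -H// bp scale1r.
Qed.

(** Two extensions differ by a function that vanishes on the fibre, which the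
    vertical vector [v] kills: any extension computes [tmap_along]. *)
Lemma tmap_alongE (k : nat) (Q : manifold R k) (psi : M -> Q) p v f F y :
  tangent p v -> tmap phi v = 0 -> phi p = y -> smooth_fun f -> smooth_fun F ->
  (\forall q \near p, phi q = y -> F q = f (psi q)) ->
  tmap_along [set q | phi q = y] psi p v f = v F.
Proof.
move=> Tv v0 py Sf SF HF; rewrite /tmap_along asboolT//.
set P := [set F' | _].
have [SG HG] : P (get P) by apply: (getPex (ex_intro P F _)).
apply/eqP; rewrite -subr_eq0 -(tangentB Tv)//; apply/eqP.
apply: (vertical_vanish Tv v0 (smooth_funB SG SF)).
apply: filterS2 HG HF => q h1 h2; rewrite py => qy.
by rewrite !fctE h1// h2// subrr.
Qed.

End Submersion.

(** * Smooth functions of a pair *)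

Section Pairs.
Variable R : realType.

Definition catf (T : Type) k l (u : 'I_k -> T) (w : 'I_l -> T) (j : 'I_(k + l)) : T :=
  match fintype.split j with inl i => u i | inr i => w i end.

Lemma catfL (T : Type) k l (u : 'I_k -> T) (w : 'I_l -> T) i :
  catf u w (lshift l i) = u i.
Proof.
rewrite /catf; have := unsplitK (inl i : 'I_k + 'I_l); rewrite /unsplit => E.
by rewrite E.
Qed.

Lemma catfR (T : Type) k l (u : 'I_k -> T) (w : 'I_l -> T) i :
  catf u w (rshift k i) = w i.
Proof.
rewrite /catf; have := unsplitK (inr i : 'I_k + 'I_l); rewrite /unsplit => E.
by rewrite E.
Qed.

Definition pairrow k l (u : 'I_k -> R) (w : 'I_l -> R) : 'rV[R]_(k + l) :=
  row_mx (\row_i u i) (\row_j w j).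

Lemma row_catf (T : Type) k l (u : 'I_k -> T -> R) (w : 'I_l -> T -> R) z :
  \row_j catf u w j z = pairrow (u^~ z) (w^~ z).
Proof.
apply/rowP => j; rewrite !mxE /catf.
by case: (fintype.split j) => i; rewrite mxE.
Qed.

Variables (n : nat) (M : manifold R n).

Lemma smooth_near_pair (z0 : M) k l (u : 'I_k -> M -> R) (w : 'I_l -> M -> R)
    (V : set 'rV[R]_(k + l)) (Phi : 'rV[R]_(k + l) -> R) :
  open V -> V (pairrow (u^~ z0) (w^~ z0)) -> smooth_on V Phi ->
  (forall i, smooth_near z0 (u i)) -> (forall j, smooth_near z0 (w j)) ->
  smooth_near z0 (fun z => Phi (pairrow (u^~ z) (w^~ z))).
Proof.
move=> oV; rewrite -row_catf => Vz SPhi Su Sw.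
have := @smooth_near_comp _ _ _ z0 _ (catf u w) V Phi oV Vz SPhi.
rewrite (_ : (fun x => Phi (\row_j _)) = (fun z => Phi (pairrow (u^~ z) (w^~ z)))).
  by apply => j; rewrite /catf; case: (fintype.split j).
by apply/funext => z; rewrite row_catf.
Qed.

Lemma pair_near (z0 : M) k l (u : 'I_k -> M -> R) (w : 'I_l -> M -> R)
    (V : set 'rV[R]_(k + l)) :
  open V -> V (pairrow (u^~ z0) (w^~ z0)) ->
  (forall i, smooth_near z0 (u i)) -> (forall j, smooth_near z0 (w j)) ->
  \forall z \near z0, V (pairrow (u^~ z) (w^~ z)).
Proof.
move=> oV; rewrite -row_catf => Vz Su Sw.
have C : (fun x => \row_j catf u w j x) @ z0 --> \row_j catf u w j z0.
  apply: cvg_row => j.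
  rewrite (_ : (fun x => _) = catf u w j); last by apply/funext => x; rewrite mxE.
  rewrite mxE; apply: smooth_near_continuous.
  by rewrite /catf; case: (fintype.split j).
have : \forall z \near z0, V (\row_j catf u w j z).
  by apply: C; exact: open_near.
by apply: filterS => z; rewrite row_catf.
Qed.

Lemma tangent_chain_pair (p : M) v k l (u : 'I_k -> M -> R) (w : 'I_l -> M -> R)
    (V : set 'rV[R]_(k + l)) (Phi : 'rV[R]_(k + l) -> R) F :
  tangent p v -> open V -> V (pairrow (u^~ p) (w^~ p)) -> smooth_on V Phi ->
  (forall i, smooth_fun (u i)) -> (forall j, smooth_fun (w j)) -> smooth_fun F ->
  (\forall z \near p, F z = Phi (pairrow (u^~ z) (w^~ z))) ->
  v F = \sum_i 'D_(delta_mx 0 (lshift l i)) Phi (pairrow (u^~ p) (w^~ p)) * v (u i)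
      + \sum_j 'D_(delta_mx 0 (rshift k j)) Phi (pairrow (u^~ p) (w^~ p)) * v (w j).
Proof.
move=> Tv oV Vp SPhi Su Sw SF HF.
rewrite -row_catf in Vp *.
rewrite (@tangent_chain _ _ _ p v _ (catf u w) V Phi F Tv _ oV Vp SPhi SF).
- rewrite big_split_ord/=; congr (_ + _); apply: eq_bigr => i _.
    by rewrite catfL.
  by rewrite catfR.
- by move=> j; rewrite /catf; case: (fintype.split j).
- by apply: filterS HF => z ->; rewrite row_catf.
Qed.

Lemma normr_lsubmx_le k l (z : 'rV[R]_(k + l)) x y :
  `|lsubmx z - x| <= `|z - row_mx x y|.
Proof.
apply: row_norm_le => // j.
have := row_coord_norm (z - row_mx x y) (lshift l j).
by rewrite !mxE (unsplitK (inl j : 'I_k + 'I_l)).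
Qed.

Lemma normr_rsubmx_le k l (z : 'rV[R]_(k + l)) x y :
  `|rsubmx z - y| <= `|z - row_mx x y|.
Proof.
apply: row_norm_le => // j.
have := row_coord_norm (z - row_mx x y) (rshift k j).
by rewrite !mxE (unsplitK (inr j : 'I_k + 'I_l)).
Qed.

End Pairs.

(** * Lie groupoids *)

Section Groupoid.
Variables (R : realType) (n m : nat) (G : manifold R n) (M : manifold R m).
Variable Gd : lieGroupoid G M.
Local Notation src := (src Gd).
Local Notation tgt := (tgt Gd).
Local Notation gid := (gid Gd).
Local Notation ginv := (ginv Gd).
Local Notation gmul := (gmul Gd).
Local Notation Tleft := (Tleft Gd).
Local Notation Tright_inv := (Tright_inv Gd).
Local Notation Vsrc := (Vsrc Gd).
Local Notation Vtgt := (Vtgt Gd).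
Local Notation AG_section := (AG_section Gd).
Local Notation AG_bracket := (AG_bracket Gd).
Local Notation left_inv := (left_inv Gd).
Local Notation right_inv := (right_inv Gd).
Local Notation prol_section := (prol_section Gd).
Local Notation prol_fibre := (prol_fibre Gd).
Local Notation inv_section := (inv_section Gd).
Local Notation Omega := (Omega Gd).
Local Notation prol_map := (prol_map Gd).
Implicit Types (g h q : G) (f F : G -> R) (v w : tvec G) (X Y : M -> tvec G).

Let Ssrc : smooth_map src := subm_smooth (src_subm Gd).
Let Stgt : smooth_map tgt := subm_smooth (tgt_subm Gd).
Let Sinv : smooth_map ginv := @ginv_smooth _ _ _ _ _ Gd.
Let Sgid : smooth_map gid := @gid_smooth _ _ _ _ _ Gd.

Lemma ginv_unique g h : tgt g = src h -> gmul g h = gid (src g) -> h = ginv g.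
Proof.
move=> gh E; rewrite -[LHS](gmul1g Gd) -gh -(gmulVg Gd g) -gmulA//.
  by rewrite E -(tgt_ginv Gd) gmulg1.
by rewrite tgt_ginv.
Qed.

Lemma ginvK : involutive ginv.
Proof.
move=> g; apply/esym/ginv_unique; first by rewrite tgt_ginv.
by rewrite gmulVg src_ginv.
Qed.

Lemma gmulKV g h : src g = src h -> gmul g (gmul (ginv g) h) = h.
Proof.
move=> gh; rewrite gmulA ?src_ginv ?tgt_ginv//.
by rewrite gmulgV gh gmul1g.
Qed.

Lemma gmulVK g h : tgt g = src h -> gmul (ginv g) (gmul g h) = h.
Proof.
move=> gh; rewrite gmulA ?tgt_ginv//.
by rewrite gmulVg gh gmul1g.
Qed.

Lemma ginvM g h : tgt g = src h -> ginv (gmul g h) = gmul (ginv h) (ginv g).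
Proof.
move=> gh.
have ih : tgt (ginv h) = src (ginv g) by rewrite tgt_ginv src_ginv.
apply/esym/ginv_unique.
  by rewrite tgt_gmul// src_gmul// src_ginv.
rewrite src_gmul// -gmulA//; last by rewrite src_gmul// src_ginv.
by rewrite gmulKV ?gmulgV// src_ginv.
Qed.

(** The smoothness of the product, in a form that does not mention charts: on
    composable pairs it is given by a smooth function of smooth functions. *)
Lemma gmul_local f p q : smooth_fun f -> tgt p = src q ->
  exists k l (a : 'I_k -> G -> R) (b : 'I_l -> G -> R)
    (V : set 'rV[R]_(k + l)) (Phi : 'rV[R]_(k + l) -> R),
  [/\ (forall i, smooth_fun (a i)) /\ (forall j, smooth_fun (b j)),
      open V, V (pairrow (a^~ p) (b^~ q)), smooth_on V Phi &
      exists A B, [/\ nbhs p A, nbhs q B & forall x y, A x -> B y ->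
        tgt x = src y -> f (gmul x y) = Phi (pairrow (a^~ x) (b^~ y))]].
Proof.
move=> Sf pq.
have [U [F [oU Upq SF FE]]] := gmul_smooth (l0 := Gd) (p := (p, q)) pq.
have [e [d' [V0 [[[c [d [Ac Ad eE]]] Ad'] [oV0 V0pq] V0U V0d' S]]]] := SF _ Upq.
have [cp dq] : chart_dom c p /\ chart_dom d q.
  by have [_] := V0U _ V0pq; rewrite eE.
have [a ac] := exists_coords Ac cp; have [Sa aE] := ac.
have [b bd] := exists_coords Ad dq; have [Sb bE] := bd.
have [[A0 B0] /= [A0p B0q] AB] : nbhs (p, q) V0 by exact: open_nbhs_nbhs.
have hA0 : \forall x \near chart_map c p, chart_cod c x /\ A0 (chart_inv c x).
  by apply: filterI; [exact: chart_cod_near|exact: chart_inv_near].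
have hB0 : \forall y \near chart_map d q, chart_cod d y /\ B0 (chart_inv d y).
  by apply: filterI; [exact: chart_cod_near|exact: chart_inv_near].
have [r1 r10 H1] := (rV_nearP _ _).1 hA0.
have [r2 r20 H2] := (rV_nearP _ _).1 hB0.
pose w0 := row_mx (chart_map c p) (chart_map d q).
pose V := [set z : 'rV[R]_(n + n) | `|z - w0| < Num.min r1 r2].
have VH z : V z -> [/\ chart_cod c (lsubmx z), chart_cod d (rsubmx z) &
    V0 (chart_inv c (lsubmx z), chart_inv d (rsubmx z))].
  rewrite /V /= lt_min => /andP[z1 z2].
  have [c1 A1] := H1 _ (le_trans (normr_lsubmx_le z _ (chart_map d q)) (ltW z1)).
  have [d1 B1] := H2 _ (le_trans (normr_rsubmx_le z (chart_map c p) _) (ltW z2)).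
  by split=> //; exact: AB.
have oV : open V by exact: open_rball.
have eV z : V z -> (chart_map e @` V0) z.
  move=> /VH[cz dz Vz]; exists (chart_inv c (lsubmx z), chart_inv d (rsubmx z)) => //.
  by rewrite eE /= !chart_invK// hsubmxK.
pose psi := chart_map d' \o F \o chart_inv e.
pose Phi := (f \o chart_inv d') \o psi.
have oc' := open_chart_cod (mfd_chart (mfdP G) Ad').
exists n, n, a, b, V, Phi; split=> //.
- have -> : pairrow (a^~ p) (b^~ q) = w0.
    by rewrite /pairrow (nbhs_singleton aE) (nbhs_singleton bE).
  by rewrite /V/= subrr normr0 lt_min r10.
- move=> k; apply: (class_C_comp oV oc'); last exact: Sf.
    move=> z /VH[cz dz Vz]; apply: chart_cod_map; apply: V0d'.
    by exists (chart_inv c (lsubmx z), chart_inv d (rsubmx z)) => //; rewrite eE.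
  move=> j; apply: (@class_C_row _ _ _ _ _ psi) => //.
  exact: class_C_sub eV (S k).
- exists (fun x => A0 x /\ (\row_j a j x = chart_map c x /\ chart_dom c x)).
  exists (fun y => B0 y /\ (\row_j b j y = chart_map d y /\ chart_dom d y)).
  split.
  + by apply: filterI A0p _; apply: filterI aE _; exact: chart_dom_near.
  + by apply: filterI B0q _; apply: filterI bE _; exact: chart_dom_near.
  + move=> x y [Ax [ax cx]] [By [bY dy]] xy.
    have Vxy : V0 (x, y) by exact: AB.
    have [Uxy _] := V0U _ Vxy.
    have <- := FE (x, y) xy Uxy.
    rewrite /Phi /psi /pairrow ax bY eE /= row_mxKl row_mxKr.
    rewrite (chart_mapK (mfd_chart (mfdP G) Ac) cx).
    rewrite (chart_mapK (mfd_chart (mfdP G) Ad) dy).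
    rewrite (chart_mapK (mfd_chart (mfdP G) Ad'))//.
    by apply: V0d'; exists (x, y).
Qed.

(** ** Left translations *)

Lemma smooth_fun_inv f : smooth_fun f -> smooth_fun (f \o ginv).
Proof. exact: smooth_fun_map. Qed.

Lemma left_ext f g q : smooth_fun f -> src q = tgt g ->
  exists2 F, smooth_fun F & \forall y \near q, src y = tgt g -> F y = f (gmul g y).
Proof.
move=> Sf gq.
have [k [l [a [b [V [Phi [[Sa Sb] oV Vgq SPhi [A [B [Ag Bq HAB]]]]]]]]]] :=
  gmul_local Sf (esym gq).
have SF : smooth_near q (fun y => Phi (pairrow (fun i => cst (a i g) y) (b^~ y))).
  apply: (smooth_near_pair oV) => //.
    by move=> i; exact: smooth_near_cst.
  by move=> j; exact: (smooth_funP _).1.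
have [F SmF HF] := smooth_near_germ SF; exists F => //.
apply: filterS2 HF Bq => y -> By yg.
by rewrite (HAB g y)//; exact: nbhs_singleton Ag.
Qed.

Lemma TleftE g h v f F : src h = tgt g -> Vsrc h v ->
  smooth_fun f -> smooth_fun F ->
  (\forall y \near h, src y = tgt g -> F y = f (gmul g y)) ->
  Tleft g h v f = v F.
Proof.
move=> gh [Tv v0] Sf SF HF.
exact: (tmap_alongE (src_subm Gd) Tv v0 gh Sf SF HF).
Qed.

Lemma Tleft_junk g h v f : ~ smooth_fun f -> Tleft g h v f = 0.
Proof. by move=> Sf; rewrite /Tleft /tmap_along asboolF. Qed.

Lemma Tright_inv_junk g h v f : ~ smooth_fun f -> Tright_inv g h v f = 0.
Proof. by move=> Sf; rewrite /Tright_inv /tmap_along asboolF. Qed.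

Lemma Tleft_vertical g h v : src h = tgt g -> Vsrc h v ->
  Vsrc (gmul g h) (Tleft g h v).
Proof.
move=> gh Vv; have [Tv v0] := Vv.
have E f F := @TleftE g h v f F gh Vv.
split; last first.
  apply/funext => u; have [Su|Su] := pselect (smooth_fun u); last first.
    by rewrite /tmap asboolF.
  rewrite tmapE// (E _ (cst (u (src g)))).
  - by rewrite (tangent_cst _ Tv).
  - exact: smooth_fun_map.
  - exact: smooth_fun_cst.
  - by near=> y => yg /=; rewrite src_gmul.
split.
- move=> a f1 f2 S1 S2.
  have [F1 SF1 H1] := left_ext S1 gh; have [F2 SF2 H2] := left_ext S2 gh.
  rewrite (E _ _ S1 SF1 H1) (E _ _ S2 SF2 H2) -(tangent_linear Tv)//.
  apply: E.
  + by apply: smooth_funD => //; exact: smooth_funZ.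
  + by apply: smooth_funD => //; exact: smooth_funZ.
  + apply: filterS2 H1 H2 => y h1 h2 yg.
    by rewrite !fctE -h1// -h2.
- move=> f1 f2 S1 S2.
  have [F1 SF1 H1] := left_ext S1 gh; have [F2 SF2 H2] := left_ext S2 gh.
  rewrite (E _ _ S1 SF1 H1) (E _ _ S2 SF2 H2).
  rewrite -(nbhs_singleton H1)// -(nbhs_singleton H2)//.
  rewrite -(tangent_leibniz Tv)//; apply: E.
  + exact: smooth_funM.
  + exact: smooth_funM.
  + apply: filterS2 H1 H2 => y h1 h2 yg.
    by rewrite !fctE -h1// -h2.
- by move=> f Sf; exact: Tleft_junk.
Unshelve. all: by end_near. Qed.

(** If [b] is a bump function at [gmul g q] with support in [A], then an
    extension of [b \o gmul g] is nonzero near [q]. *)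
Lemma left_continuous g q (A : set G) : src q = tgt g -> nbhs (gmul g q) A ->
  \forall y \near q, src y = tgt g -> A (gmul g y).
Proof.
move=> gq; rewrite nbhsE => -[W [oW Wq] WA].
have [b [K [Sb b1 cK KW bK]]] := mfd_bump oW Wq.
have [F SF HF] := left_ext Sb gq.
have cF := smooth_near_continuous ((smooth_funP _).1 SF q).
have F1 : F q = 1 by rewrite (nbhs_singleton HF)// (nbhs_singleton b1).
have : \forall y \near q, F y != 0.
  have : \forall z \near F q, z != 0.
    by rewrite F1; apply/R_nearP; exists (1 / 2) => // z; rewrite ler_distl; lra.
  exact: cF.
move=> H; apply: filterS2 H HF => y Fy Fb yg; apply/WA/KW.
by apply: contrapT => /bK by0; move: Fy; rewrite Fb// by0 eqxx.
Qed.

Lemma left_inv_junk X g f : ~ smooth_fun f -> left_inv X g f = 0.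
Proof. exact: Tleft_junk. Qed.

Lemma left_invE X g f F : AG_section X -> smooth_fun f -> smooth_fun F ->
  (\forall y \near gid (tgt g), src y = tgt g -> F y = f (gmul g y)) ->
  left_inv X g f = X (tgt g) F.
Proof. by move=> [VX _] Sf SF; apply: TleftE => //; rewrite src_gid. Qed.

Lemma left_inv_vertical X g : AG_section X -> Vsrc g (left_inv X g).
Proof.
move=> [VX _]; rewrite -{1}(gmulg1 Gd g).
by apply: Tleft_vertical => //; rewrite src_gid.
Qed.

(** In local coordinates [left_inv X g f] is a sum of products of the
    components of [X] by partial derivatives of the product. *)
Lemma left_inv_smooth X f : AG_section X -> smooth_fun f ->
  smooth_fun (fun g => left_inv X g f).
Proof.
move=> AX Sf; have [VX SX] := AX; apply/smooth_funP => g0.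
have gq : tgt g0 = src (gid (tgt g0)) by rewrite src_gid.
have [k [l [a [b [V [Phi [[Sa Sb] oV Vgq SPhi [A [B [Ag Bq HAB]]]]]]]]]] :=
  gmul_local Sf gq.
have Sbgt j : smooth_fun (fun g => b j (gid (tgt g))).
  exact: (smooth_fun_map Stgt (smooth_fun_map Sgid (Sb j))).
pose c g := \sum_j 'D_(delta_mx 0 (rshift k j)) Phi
    (pairrow (a^~ g) (b^~ (gid (tgt g)))) * X (tgt g) (b j).
apply: (@smooth_near_ext _ _ _ _ c).
  have cgt : {for g0, continuous (fun g => gid (tgt g))}.
    apply: continuous_comp; first exact: (smooth_map_continuous Stgt).
    exact: (smooth_map_continuous Sgid).
  have h1 : \forall g \near g0, V (pairrow (a^~ g) (b^~ (gid (tgt g)))).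
    apply: (@pair_near _ _ _ g0 k l a (fun j g => b j (gid (tgt g)))) => //.
      by move=> i; exact: (smooth_funP _).1.
    by move=> j; apply: (smooth_funP _).1; exact: Sbgt.
  have h2 : \forall g \near g0, nbhs (gid (tgt g)) B.
    exact: (cgt _ (nbhs_interior Bq)).
  near=> g.
  have gt : src (gid (tgt g)) = tgt g by rewrite src_gid.
  have Vg : V (pairrow (a^~ g) (b^~ (gid (tgt g)))) by near: g.
  have Bg : nbhs (gid (tgt g)) B by near: g.
  have Ag' : A g by near: g.
  have [F SF HF] := left_ext Sf gt.
  have SF' : smooth_near (gid (tgt g))
     (fun y => Phi (pairrow (fun i => cst (a i g) y) (b^~ y))).
    apply: (smooth_near_pair oV) => //.
      by move=> i; exact: smooth_near_cst.
    by move=> j; exact: (smooth_funP _).1.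
  have [F' SmF' HF'] := smooth_near_germ SF'.
  rewrite (left_invE AX Sf SmF'); last first.
    by apply: filterS2 HF' Bg => y -> By yg; rewrite (HAB g y).
  have [Tv _] := VX (tgt g).
  rewrite (tangent_chain_pair Tv oV _ SPhi _ _ SmF' HF')//; last first.
    by move=> i; exact: smooth_fun_cst.
  rewrite big1 ?add0r// => i _.
  by rewrite (tangent_cst _ Tv) mulr0.
rewrite (_ : c = \sum_j ((fun g => 'D_(delta_mx 0 (rshift k j)) Phi
    (pairrow (a^~ g) (b^~ (gid (tgt g))))) * (fun g => X (tgt g) (b j)))); last first.
  by apply/funext => g; rewrite fct_sumE.
apply: smooth_near_sum => j _; apply: smooth_nearM.
  apply: (@smooth_near_pair _ _ _ g0 k l a (fun j g => b j (gid (tgt g))) V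
    ('D_(delta_mx 0 (rshift k j)) Phi)) => //.
  - exact: smooth_on_derive.
  - by move=> i; exact: (smooth_funP _).1.
  - by move=> i; apply: (smooth_funP _).1; exact: Sbgt.
exact: (smooth_funP _).1 (smooth_fun_map Stgt (SX _ (Sb j))) g0.
Unshelve. all: by end_near. Qed.

Lemma tangent_left_inv X g : AG_section X -> tangent g (left_inv X g).
Proof. by move=> AX; have [] := left_inv_vertical g AX. Qed.

Lemma vector_field_left_inv X : AG_section X -> vector_field (left_inv X).
Proof.
by move=> AX; split=> [g|f Sf]; [exact: tangent_left_inv|exact: left_inv_smooth].
Qed.

Lemma tmap_invK v g : tangent g v -> tmap ginv (tmap ginv v) = v.
Proof.
move=> Tv; apply/funext => f; have [Sf|Sf] := pselect (smooth_fun f).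
  rewrite tmapE// tmapE; last exact: smooth_fun_inv.
  by congr v; apply/funext => q /=; rewrite ginvK.
by rewrite (tangent_junk Tv)// /tmap asboolF.
Qed.

(** ** Right translations *)

(** This reduces right translations to left ones: [(g^-1 h)^-1 = h^-1 g]. *)
Lemma Tright_invE g h v : src h = src g -> Vsrc h v ->
  Tright_inv g h v = tmap ginv (Tleft (ginv g) h v).
Proof.
move=> hg Vv; have [Tv v0] := Vv.
apply/funext => f; have [Sf|Sf] := pselect (smooth_fun f); last first.
  by rewrite Tright_inv_junk// /tmap asboolF.
have hi : src h = tgt (ginv g) by rewrite tgt_ginv.
rewrite tmapE//; have [F SF HF] := left_ext (smooth_fun_inv Sf) hi.
rewrite (TleftE hi Vv (smooth_fun_inv Sf) SF HF).
apply: (tmap_alongE (src_subm Gd) Tv v0 hg Sf SF).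
apply: filterS HF => y Fy yg; rewrite Fy ?tgt_ginv//=.
by rewrite ginvM ?ginvK// tgt_ginv.
Qed.

Lemma Tright_inv_ext g h v f F : src h = src g -> Vsrc h v ->
  smooth_fun f -> smooth_fun F ->
  (\forall y \near h, src y = src g -> F y = f (gmul (ginv y) g)) ->
  Tright_inv g h v f = v F.
Proof.
move=> hg [Tv v0] Sf SF HF.
exact: (tmap_alongE (src_subm Gd) Tv v0 hg Sf SF HF).
Qed.

Lemma right_invE X g : AG_section X ->
  right_inv X g = - tmap ginv (left_inv X (ginv g)).
Proof.
move=> [VX _]; rewrite /right_inv Tright_invE ?src_gid//.
by rewrite /left_inv tgt_ginv.
Qed.

Lemma right_inv_fun X f : AG_section X -> smooth_fun f ->
  (fun g => right_inv X g f) = - ((fun g => left_inv X g (f \o ginv)) \o ginv).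
Proof.
move=> AX Sf; apply/funext => g.
by rewrite right_invE// -[LHS]/(- (tmap _ _ f)) tmapE.
Qed.

Lemma right_inv_vertical X g : AG_section X -> Vtgt g (right_inv X g).
Proof.
move=> AX; have [Tl l0] := left_inv_vertical (ginv g) AX.
rewrite right_invE//; split.
  by apply: tangent_opp; rewrite -{1}(ginvK g); exact: tangent_tmap.
apply/funext => u; have [Su|Su] := pselect (smooth_fun u); last first.
  by rewrite /tmap asboolF.
rewrite tmapE// -[LHS]/(- (tmap _ _ _)) tmapE; last exact: smooth_fun_map.
rewrite (_ : (u \o tgt) \o ginv = u \o src); last first.
  by apply/funext => q /=; rewrite tgt_ginv.
by rewrite -tmapE// l0 oppr0.
Qed.

Lemma tangent_right_inv X g : AG_section X -> tangent g (right_inv X g).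
Proof. by move=> AX; have [] := right_inv_vertical g AX. Qed.

Lemma right_inv_smooth X f : AG_section X -> smooth_fun f ->
  smooth_fun (fun g => right_inv X g f).
Proof.
move=> AX Sf; rewrite right_inv_fun//; apply: smooth_funN.
by apply: smooth_fun_inv; apply: left_inv_smooth => //; exact: smooth_fun_inv.
Qed.

Lemma vector_field_right_inv X : AG_section X -> vector_field (right_inv X).
Proof.
by move=> AX; split=> [g|f Sf]; [exact: tangent_right_inv|exact: right_inv_smooth].
Qed.

(** ** Vertical vectors are values of invariant fields *)

Lemma Tleft_inv g v : Vsrc g v -> Tleft g (gid (tgt g)) (Tleft (ginv g) g v) = v.
Proof.
move=> Vv; have [Tv v0] := Vv.
have gi : src g = tgt (ginv g) by rewrite tgt_ginv.
have gt : src (gid (tgt g)) = tgt g by rewrite src_gid.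
have Vw := Tleft_vertical gi Vv; rewrite gmulVg in Vw.
apply/funext => f; have [Sf|Sf] := pselect (smooth_fun f); last first.
  by rewrite Tleft_junk// (tangent_junk Tv).
have [F SF HF] := left_ext Sf gt.
rewrite (TleftE gt Vw Sf SF HF); apply: (TleftE gi Vv SF Sf).
have HF' : nbhs (gmul (ginv g) g)
    (fun y => src y = tgt g -> F y = f (gmul g y)) by rewrite gmulVg.
apply: filterS (left_continuous gi HF') => y Hy yg.
rewrite Hy//; last by rewrite src_gmul ?src_ginv.
by rewrite gmulKV// yg tgt_ginv.
Qed.

(** The vector is translated to the unit and extended there to a vertical vector
    field of [G], whose restriction to the units is a section of [AG]. *)
Lemma left_inv_surj g v : Vsrc g v -> exists2 X, AG_section X & left_inv X g = v.
Proof.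
move=> Vv; have gi : src g = tgt (ginv g) by rewrite tgt_ginv.
have := Tleft_vertical gi Vv; rewrite gmulVg => -[Tw w0].
have [V [[TV SV] V0 Vp]] := exists_vertical_field (src_subm Gd) Tw w0.
exists (fun x => V (gid x)).
  split=> [x|f Sf]; first by split=> //; rewrite V0.
  exact: (smooth_fun_map Sgid (SV _ Sf)).
by rewrite /left_inv Vp Tleft_inv.
Qed.

Lemma AG_section_opp X : AG_section X -> AG_section (fun x => - X x).
Proof.
move=> [VX SX]; split=> [x|f Sf]; last exact: (smooth_funN (SX f Sf)).
have [Tv v0] := VX x; split; first exact: tangent_opp.
by rewrite tmapN v0 oppr0.
Qed.

Lemma left_inv_opp X g : AG_section X ->
  left_inv (fun x => - X x) g = - left_inv X g.
Proof.
move=> AX; have AN := AG_section_opp AX; apply/funext => f.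
have [Sf|Sf] := pselect (smooth_fun f); last first.
  by rewrite -[RHS]/(- (left_inv X g f)) !left_inv_junk// oppr0.
have gt : src (gid (tgt g)) = tgt g by rewrite src_gid.
have [F SF HF] := left_ext Sf gt.
by rewrite -[RHS]/(- (left_inv X g f)) (left_invE AX Sf SF HF) (left_invE AN Sf SF HF).
Qed.

Lemma right_inv_opp X g : AG_section X ->
  right_inv (fun x => - X x) g = - right_inv X g.
Proof.
move=> AX; rewrite !right_invE//; last exact: AG_section_opp.
by rewrite left_inv_opp// tmapN.
Qed.

Lemma right_inv_surj g v : Vtgt g v -> exists2 X, AG_section X & right_inv X g = v.
Proof.
move=> [Tv v0].
have Vw : Vsrc (ginv g) (tmap ginv v).
  split; first exact: tangent_tmap.
  apply/funext => u; have [Su|Su] := pselect (smooth_fun u); last first.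
    by rewrite /tmap asboolF.
  rewrite tmapE// tmapE; last exact: smooth_fun_map.
  rewrite (_ : (u \o src) \o ginv = u \o tgt); last first.
    by apply/funext => q /=; rewrite src_ginv.
  by rewrite -tmapE// v0.
have [X AX E] := left_inv_surj Vw.
exists (fun x => - X x); first exact: AG_section_opp.
by rewrite right_inv_opp// right_invE// E (tmap_invK Tv) opprK.
Qed.

(** ** Brackets of invariant fields *)

(** On the source fibre [left_inv Y (gmul g h) f] is [left_inv Y h F], since
    both differentiate [k |-> f (g h k)] at a unit. *)
Lemma left_inv2E X Y g f F : AG_section X -> AG_section Y ->
  smooth_fun f -> smooth_fun F ->
  (\forall y \near gid (tgt g), src y = tgt g -> F y = f (gmul g y)) ->
  left_inv X g (fun q => left_inv Y q f)
    = left_inv X (gid (tgt g)) (fun q => left_inv Y q F).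
Proof.
move=> AX AY Sf SF HF.
have SYf := left_inv_smooth AY Sf; have SYF := left_inv_smooth AY SF.
transitivity (X (tgt g) (fun q => left_inv Y q F)); last first.
  rewrite (left_invE AX SYF SYF) ?tgt_gid//.
  near=> y => yg; congr (left_inv Y _ F).
  by rewrite -{1}(gmul1g Gd y) yg.
apply: left_invE => //.
have : nbhs (gid (tgt g)) (fun y => src y = tgt g -> F y = f (gmul g y)) by [].
rewrite nbhsE => -[W [oW We] HW].
apply: filterS (open_nbhs_nbhs (conj oW We)) => h Wh hg.
have ht : src (gid (tgt h)) = tgt h by rewrite src_gid.
have [F2 SF2 H2] := left_ext SF ht.
rewrite (left_invE AY SF SF2 H2) (left_invE AY Sf SF2) ?tgt_gmul//.
have Wh' : nbhs (gmul h (gid (tgt h))) W.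
  by rewrite gmulg1; exact: open_nbhs_nbhs.
apply: filterS2 H2 (left_continuous ht Wh') => k h2 hW kh.
rewrite h2// HW ?src_gmul//; last exact: hW.
by rewrite gmulA.
Unshelve. all: by end_near. Qed.

Lemma left_inv_bracketE X Y g f F : AG_section X -> AG_section Y ->
  smooth_fun f -> smooth_fun F ->
  (\forall y \near gid (tgt g), src y = tgt g -> F y = f (gmul g y)) ->
  vf_bracket (left_inv X) (left_inv Y) g f
    = vf_bracket (left_inv X) (left_inv Y) (gid (tgt g)) F.
Proof.
move=> AX AY Sf SF HF.
by rewrite /vf_bracket (left_inv2E AX AY Sf SF HF) (left_inv2E AY AX Sf SF HF).
Qed.

(** The bracket of two left-invariant fields is left-invariant by
    [left_inv_bracketE]; its values at the units give the section [Z]. *)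
Lemma exists_AG_bracket X Y : AG_section X -> AG_section Y ->
  exists Z, AG_bracket X Y Z.
Proof.
move=> AX AY.
have [TB SB] := vector_field_bracket (vector_field_left_inv AX)
  (vector_field_left_inv AY).
pose Z x := vf_bracket (left_inv X) (left_inv Y) (gid x).
have AZ : AG_section Z.
  split=> [x|f Sf]; last exact: (smooth_fun_map Sgid (SB f Sf)).
  split; first exact: TB.
  apply/funext => u; have [Su|Su] := pselect (smooth_fun u); last first.
    by rewrite /tmap asboolF.
  rewrite tmapE// /Z /vf_bracket.
  have Z0 X' : AG_section X' -> (fun q => left_inv X' q (u \o src)) = 0.
    move=> AX'; apply/funext => q; have [_ l0] := left_inv_vertical q AX'.
    by rewrite -tmapE// l0.
  rewrite !Z0// (tangent0 (tangent_left_inv (gid x) AX)).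
  by rewrite (tangent0 (tangent_left_inv (gid x) AY)) subrr.
exists Z; split=> //; apply/funext => g; apply/funext => f.
have [Sf|Sf] := pselect (smooth_fun f); last first.
  by rewrite left_inv_junk// (tangent_junk (TB g)).
have gt : src (gid (tgt g)) = tgt g by rewrite src_gid.
have [F SF HF] := left_ext Sf gt.
by rewrite (left_inv_bracketE AX AY Sf SF HF) (left_invE AZ Sf SF HF).
Qed.

(** By [right_inv_fun] a right-invariant field is minus the image of a
    left-invariant one by the inversion: the two signs cancel in the second
    order terms, and one remains for [Z]. *)
Lemma right_inv_bracket X Y Z g f : AG_section X -> AG_section Y ->
  AG_bracket X Y Z -> smooth_fun f ->
  vf_bracket (right_inv X) (right_inv Y) g f = - right_inv Z g f.
Proof.
move=> AX AY [AZ EZ] Sf.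
have E2 X' Y' : AG_section X' -> AG_section Y' ->
    right_inv X' g (fun q => right_inv Y' q f)
      = left_inv X' (ginv g) (fun q => left_inv Y' q (f \o ginv)).
  move=> AX' AY'; rewrite right_inv_fun// right_invE//.
  set phi := fun q => left_inv Y' q (f \o ginv).
  have Sphi : smooth_fun phi by apply: left_inv_smooth => //; exact: smooth_fun_inv.
  rewrite -[LHS]/(- (tmap ginv _ _)) tmapE; last first.
    by apply: smooth_funN; exact: smooth_fun_inv.
  rewrite (_ : _ \o ginv = - phi); last first.
    by apply/funext => q /=; rewrite -[LHS]/(- (phi _)) ginvK.
  by rewrite (tangentN (tangent_left_inv (ginv g) AX'))// opprK.
rewrite /vf_bracket !E2//.
transitivity (left_inv Z (ginv g) (f \o ginv)); first by rewrite EZ.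
by rewrite right_invE// -[RHS]/(- - (tmap ginv _ f)) opprK tmapE.
Qed.

(** Left and right translations commute, and so do the invariant fields: both
    sides are mixed second derivatives of [f (h^-1 g k)], along the source
    fibre in [h] and in [k]. *)
Lemma right_left_comm X Y g f : AG_section X -> AG_section Y -> smooth_fun f ->
  right_inv X g (fun q => left_inv Y q f)
    = left_inv Y g (fun q => right_inv X q f).
Proof.
move=> AX AY Sf; have [VX _] := AX; have [VY _] := AY.
have SYf := left_inv_smooth AY Sf; have SXf := right_inv_smooth AX Sf.
have gq : tgt g = src (gid (tgt g)) by rewrite src_gid.
have [k [l [a [b [V [Phi [[Sa Sb] oV Vgq SPhi [A [B [Ag Bq HAB]]]]]]]]]] :=
  gmul_local Sf gq.
have ei : src (gid (src g)) = tgt (ginv g) by rewrite src_gid tgt_ginv.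
(* the functions [a i (h^-1 g)] of [h], extended from the source fibre *)
have /choice[a' Ha'] : forall i, exists F, smooth_fun F /\
    \forall h \near gid (src g), src h = tgt (ginv g) ->
      F h = (a i \o ginv) (gmul (ginv g) h).
  by move=> i; have [F SF HF] := left_ext (smooth_fun_inv (Sa i)) ei; exists F.
have Sa' i : smooth_fun (a' i) by have [] := Ha' i.
have Hinv h : src h = src g -> ginv (gmul (ginv g) h) = gmul (ginv h) g.
  by move=> hg; rewrite ginvM ?ginvK// tgt_ginv.
have Ha i : \forall h \near gid (src g), src h = src g ->
    a' i h = a i (gmul (ginv h) g).
  have [_ H] := Ha' i; apply: filterS H => h H hg.
  by rewrite H ?tgt_ginv//= Hinv.
have a'e : pairrow (a'^~ (gid (src g))) (b^~ (gid (tgt g)))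
    = pairrow (a^~ g) (b^~ (gid (tgt g))).
  congr (row_mx _ _); apply/rowP => i; rewrite !mxE.
  rewrite (nbhs_singleton (Ha i)) ?src_gid// -Hinv ?src_gid//.
  have := gmulg1 Gd (ginv g); rewrite tgt_ginv => ->.
  by rewrite ginvK.
have Vp : V (pairrow (a'^~ (gid (src g))) (b^~ (gid (tgt g)))) by rewrite a'e.
pose p0 := pairrow (a'^~ (gid (src g))) (b^~ (gid (tgt g))).
pose DL i := 'D_(delta_mx 0 (lshift l i)) Phi.
pose DR j := 'D_(delta_mx 0 (rshift k j)) Phi.
have SDL i : smooth_on V (DL i) by exact: smooth_on_derive.
have SDR j : smooth_on V (DR j) by exact: smooth_on_derive.
pose xi := X (src g); pose eta := Y (tgt g).
have Txi : tangent (gid (src g)) xi by have [] := VX (src g).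
have Teta : tangent (gid (tgt g)) eta by have [] := VY (tgt g).
(* for such [h], [f (h^-1 g k) = Phi (a' h, b k)] with [k] near a unit *)
have Hh : \forall h \near gid (src g), [/\
    (forall i, src h = src g -> a' i h = a i (gmul (ginv h) g)),
    (src h = src g -> A (gmul (ginv h) g)) &
    V (pairrow (a'^~ h) (b^~ (gid (tgt g))))].
  have h1 : \forall h \near gid (src g), forall i, src h = src g ->
      a' i h = a i (gmul (ginv h) g).
    exact: (@filter_forall _ _ (fun i h => src h = src g ->
      a' i h = a i (gmul (ginv h) g)) (nbhs (gid (src g))) _ Ha).
  have h2 : \forall h \near gid (src g), src h = src g -> A (gmul (ginv h) g).
    have NA : nbhs (gmul (ginv g) (gid (src g))) (ginv @^-1` A).
      have := gmulg1 Gd (ginv g); rewrite tgt_ginv => ->.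
      by apply: (smooth_map_continuous Sinv); rewrite ginvK.
    apply: filterS (left_continuous ei NA) => h + hg.
    by rewrite tgt_ginv /= Hinv//; exact.
  have h3 : \forall h \near gid (src g), V (pairrow (a'^~ h) (b^~ (gid (tgt g)))).
    apply: (@pair_near _ _ _ (gid (src g)) k l a'
      (fun j => cst (b j (gid (tgt g))))) => //.
      by move=> i; exact: (smooth_funP _).1.
    by move=> j; exact: smooth_near_cst.
  by apply: filterS3 h1 h2 h3.
have E1 : \forall h \near gid (src g), src h = src g ->
    left_inv Y (gmul (ginv h) g) f
      = \sum_j DR j (pairrow (a'^~ h) (b^~ (gid (tgt g)))) * eta (b j).
  apply: filterS Hh => h [h1 h2 h3] hg.
  have tgh : tgt (gmul (ginv h) g) = tgt g by rewrite tgt_gmul ?tgt_ginv.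
  have SF : smooth_near (gid (tgt g))
     (fun y => Phi (pairrow (fun i => cst (a' i h) y) (b^~ y))).
    apply: (smooth_near_pair oV) => //.
      by move=> i; exact: smooth_near_cst.
    by move=> j; exact: (smooth_funP _).1.
  have [F SmF HF] := smooth_near_germ SF.
  rewrite (left_invE AY Sf SmF) tgh; last first.
    apply: filterS2 HF Bq => y -> By yg; rewrite HAB//; last 2 first.
    - exact: h2.
    - by rewrite tgh.
    congr (Phi (row_mx _ _)); apply/rowP => i; rewrite !mxE /=; exact: h1.
  rewrite -[Y (tgt g) F]/(eta F).
  rewrite (tangent_chain_pair Teta oV h3 SPhi _ _ SmF HF)//; last first.
    by move=> i; exact: smooth_fun_cst.
  rewrite big1 ?add0r// => i _.
  by rewrite (tangent_cst _ Teta) mulr0.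
have E2 : \forall y \near gid (tgt g), src y = tgt g ->
    right_inv X (gmul g y) f
      = - \sum_i DL i (pairrow (a'^~ (gid (src g))) (b^~ y)) * xi (a' i).
  have h3 : \forall y \near gid (tgt g), V (pairrow (a'^~ (gid (src g))) (b^~ y)).
    apply: (@pair_near _ _ _ (gid (tgt g)) k l
      (fun i => cst (a' i (gid (src g)))) b) => //.
      by move=> i; exact: smooth_near_cst.
    by move=> j; exact: (smooth_funP _).1.
  apply: filterS2 Bq h3 => y By Vy yg.
  have gy : tgt g = src y by rewrite yg.
  have SF : smooth_near (gid (src g))
     (fun h => Phi (pairrow (a'^~ h) (fun j => cst (b j y) h))).
    apply: (smooth_near_pair oV) => //.
      by move=> i; exact: (smooth_funP _).1.
    by move=> j; exact: smooth_near_cst.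
  have [F SmF HF] := smooth_near_germ SF.
  rewrite /right_inv src_gmul//; congr (- _).
  transitivity (xi F).
    apply: Tright_inv_ext => //; first by rewrite src_gid src_gmul.
    rewrite src_gmul//; apply: filterS2 HF Hh => h Fh [h1 h2 _] hg.
    rewrite gmulA ?tgt_ginv// HAB ?tgt_gmul ?tgt_ginv//; last exact: h2.
    rewrite Fh; congr (Phi (row_mx _ _)); apply/rowP => i; rewrite !mxE /=.
    exact: h1.
  rewrite (tangent_chain_pair Txi oV Vy SPhi _ _ SmF HF)//; last first.
    by move=> i; exact: smooth_fun_cst.
  rewrite addrC big1 ?add0r// => i _.
  by rewrite (tangent_cst _ Txi) mulr0.
have /choice[D HD] : forall j, exists D, smooth_fun D /\
    \forall h \near gid (src g), D h = DR j (pairrow (a'^~ h) (b^~ (gid (tgt g)))).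
  move=> j.
  have : smooth_near (gid (src g)) (fun h => DR j
      (pairrow (a'^~ h) (fun j => cst (b j (gid (tgt g))) h))).
    apply: (smooth_near_pair (Phi := DR j) oV) => //.
      by move=> i; exact: (smooth_funP _).1.
    by move=> i; exact: smooth_near_cst.
  by move=> /smooth_near_germ[D SD HD]; exists D.
have /choice[C HC] : forall i, exists C, smooth_fun C /\
    \forall y \near gid (tgt g), C y = DL i (pairrow (a'^~ (gid (src g))) (b^~ y)).
  move=> i.
  have : smooth_near (gid (tgt g)) (fun y => DL i
      (pairrow (fun i => cst (a' i (gid (src g))) y) (b^~ y))).
    apply: (smooth_near_pair (Phi := DL i) oV) => //.
      by move=> j; exact: smooth_near_cst.
    by move=> j; exact: (smooth_funP _).1.
  by move=> /smooth_near_germ[C SC HC]; exists C.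
have SD j : smooth_fun (D j) by have [] := HD j.
have SC i : smooth_fun (C i) by have [] := HC i.
have SD' j : smooth_fun (eta (b j) *: D j) by exact: smooth_funZ.
have SC' i : smooth_fun (- xi (a' i) *: C i) by exact: smooth_funZ.
have xiD j : xi (D j) = \sum_i 'D_(delta_mx 0 (lshift l i)) (DR j) p0 * xi (a' i).
  have [_ HDj] := HD j.
  rewrite (@tangent_chain_pair _ _ _ _ xi k l a' (fun j => cst (b j (gid (tgt g))))
    V (DR j) (D j) Txi oV)//; last by move=> i; exact: smooth_fun_cst.
  rewrite addrC big1 ?add0r// => i _.
  by rewrite (tangent_cst _ Txi) mulr0.
have etaC i : eta (C i) = \sum_j 'D_(delta_mx 0 (rshift k j)) (DL i) p0 * eta (b j).
  have [_ HCi] := HC i.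
  rewrite (@tangent_chain_pair _ _ _ _ eta k l (fun i => cst (a' i (gid (src g)))) b
    V (DL i) (C i) Teta oV)//; last by move=> j; exact: smooth_fun_cst.
  rewrite big1 ?add0r// => j _.
  by rewrite (tangent_cst _ Teta) mulr0.
transitivity (- xi (\sum_j eta (b j) *: D j)).
  rewrite /right_inv -[LHS]/(- (Tright_inv _ _ _ _)); congr (- _).
  apply: Tright_inv_ext => //; rewrite ?src_gid//.
    exact: smooth_fun_sum.
  have h : \forall h \near gid (src g), forall j,
      D j h = DR j (pairrow (a'^~ h) (b^~ (gid (tgt g)))).
    apply: (@filter_forall _ _ (fun j h => D j h
      = DR j (pairrow (a'^~ h) (b^~ (gid (tgt g))))) (nbhs (gid (src g))) _) => j.
    by have [] := HD j.
  apply: filterS2 E1 h => h e1 e2 hg; rewrite e1// fct_sumE.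
  by apply: eq_bigr => j _; rewrite mulrC -e2.
transitivity (eta (\sum_i - xi (a' i) *: C i)); last first.
  apply/esym/left_invE => //; first exact: smooth_fun_sum.
  have h : \forall y \near gid (tgt g), forall i,
      C i y = DL i (pairrow (a'^~ (gid (src g))) (b^~ y)).
    apply: (@filter_forall _ _ (fun i y => C i y
      = DL i (pairrow (a'^~ (gid (src g))) (b^~ y))) (nbhs (gid (tgt g))) _) => i.
    by have [] := HC i.
  apply: filterS2 E2 h => y e1 e2 yg; rewrite e1// fct_sumE -sumrN.
  apply: eq_bigr => i _; rewrite -e2 -[LHS]/(- xi (a' i) * C i y).
  by rewrite mulNr mulrC.
rewrite (tangent_sum _ _ Txi)// (tangent_sum _ _ Teta)//.
under eq_bigr => j _ do rewrite (tangentZ _ Txi)// xiD mulr_sumr.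
under [RHS]eq_bigr => i _ do rewrite (tangentZ _ Teta)// etaC mulr_sumr.
rewrite exchange_big/= -sumrN; apply: eq_bigr => i _.
rewrite -sumrN; apply: eq_bigr => j _.
by rewrite (derive_comm _ _ oV Vp (SPhi 2)); ring.
Qed.

(** For a curve [k] through a unit, [(g k)^-1 (g h) = k^-1 h]. *)
Lemma Tright_inv_left_inv Y g h : AG_section Y -> tgt g = src h ->
  Tright_inv (gmul g h) g (left_inv Y g) = - right_inv Y h.
Proof.
move=> AY gh; rewrite /right_inv opprK.
have [VY _] := AY; have Vl := left_inv_vertical g AY.
have sg : src g = src (gmul g h) by rewrite src_gmul.
have sh : src (gid (src h)) = src h by rewrite src_gid.
apply/funext => f; have [Sf|Sf] := pselect (smooth_fun f); last first.
  by rewrite !Tright_inv_junk.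
have gi : src g = tgt (ginv (gmul g h)) by rewrite tgt_ginv src_gmul.
have hi : src (gid (src h)) = tgt (ginv h) by rewrite tgt_ginv src_gid.
have [F SF HF] := left_ext (smooth_fun_inv Sf) gi.
have HF' : \forall y \near g, src y = src g -> F y = f (gmul (ginv y) (gmul g h)).
  apply: filterS HF => y Fy yg; rewrite Fy ?yg//=.
  by rewrite ginvM ?ginvK// tgt_ginv src_gmul.
rewrite (@Tright_inv_ext _ _ _ _ F sg Vl Sf SF); last first.
  by apply: filterS HF' => y Fy; rewrite src_gmul.
have [F3 SF3 H3] := left_ext (smooth_fun_inv Sf) hi.
have H3' : \forall y \near gid (src h), src y = src h -> F3 y = f (gmul (ginv y) h).
  apply: filterS H3 => y Fy yg; rewrite Fy ?yg ?tgt_ginv//=.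
  by rewrite ginvM ?ginvK// tgt_ginv.
rewrite (Tright_inv_ext sh (VY _) Sf SF3 H3') -gh.
apply: left_invE => //; rewrite gh.
have gt : src (gid (tgt g)) = tgt g by rewrite src_gid.
have HF2 : nbhs (gmul g (gid (tgt g)))
    (fun y => src y = src g -> F y = f (gmul (ginv y) (gmul g h))).
  by rewrite gmulg1.
have := left_continuous gt HF2; rewrite gh => HG.
apply: filterS2 H3' HG => y h3 hF yh.
rewrite h3// hF// ?src_gmul ?gh ?yh//.
rewrite ginvM ?gh// -gmulA ?src_ginv ?tgt_ginv ?src_gmul ?gh ?yh//.
by rewrite gmulVK.
Qed.

(** ** The prolongation and its differential *)

Lemma prol_section_inv X Y : AG_section X -> AG_section Y ->
  prol_section (inv_section X Y).
Proof.
move=> AX AY; split.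
- by move=> g; split; [exact: right_inv_vertical|exact: left_inv_vertical].
- exact: vector_field_right_inv.
- exact: vector_field_left_inv.
Qed.

Lemma prol_section_scale f (Z : G -> pvec G) : smooth_fun f -> prol_section Z ->
  prol_section (fun g => f g *: Z g).
Proof.
move=> Sf [FZ V1 V2]; split.
- move=> g; have [[T1 z1] [T2 z2]] := FZ g; split; split => /=.
  + exact: tangent_scale.
  + by rewrite tmapZ z1 scaler0.
  + exact: tangent_scale.
  + by rewrite tmapZ z2 scaler0.
- exact: (vector_field_scale V1 Sf).
- exact: (vector_field_scale V2 Sf).
Qed.

Lemma prol_section_add (Z W : G -> pvec G) : prol_section Z -> prol_section W ->
  prol_section (Z + W).
Proof.
move=> [FZ V1 V2] [FW W1 W2]; split.
- move=> g; have [[T1 z1] [T2 z2]] := FZ g; have [[U1 w1] [U2 w2]] := FW g.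
  split; split => /=.
  + exact: tangent_add.
  + by rewrite tmapD z1 w1 addr0.
  + exact: tangent_add.
  + by rewrite tmapD z2 w2 addr0.
- exact: (vector_field_add V1 W1).
- exact: (vector_field_add V2 W2).
Qed.

Lemma prol_section_zero : prol_section 0.
Proof.
have t0 (k : nat) (N : manifold R k) (phi : G -> N) : tmap phi (0 : tvec G) = 0.
  by apply/funext => u; rewrite /tmap; case: asboolP.
split; [|exact: vector_field_zero|exact: vector_field_zero].
by move=> g; split; split=> /=; [exact: tangent_zero|exact: t0|exact: tangent_zero|exact: t0].
Qed.

Lemma prol_section_fst (V : G -> tvec G) : vector_field V ->
  (forall q, tmap tgt (V q) = 0) -> prol_section (fun q => (V q, 0)).
Proof.
move=> VV V0; have [FZ _ _] := prol_section_zero; split=> //.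
- move=> g; have [_ z2] := FZ g; split=> //; split; last exact: V0.
  by have [h _] := VV; exact: h.
- exact: vector_field_zero.
Qed.

Lemma prol_section_snd (V : G -> tvec G) : vector_field V ->
  (forall q, tmap src (V q) = 0) -> prol_section (fun q => (0, V q)).
Proof.
move=> VV V0; have [FZ _ _] := prol_section_zero; split=> //.
- move=> g; have [z1 _] := FZ g; split=> //; split; last exact: V0.
  by have [h _] := VV; exact: h.
- exact: vector_field_zero.
Qed.

Lemma anchorE (a : pvec G) f : anchor a f = a.1 f + a.2 f.
Proof. by []. Qed.

Lemma tangent_anchor (Z : G -> pvec G) g : prol_section Z -> tangent g (anchor (Z g)).
Proof. by move=> [FZ _ _]; have [[T1 _] [T2 _]] := FZ g; exact: tangent_add. Qed.

Section Differential.
Implicit Types (Z W : G -> pvec G).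
Variable br : (G -> pvec G) -> (G -> pvec G) -> (G -> pvec G).
Hypothesis Hbr : is_prol_bracket Gd br.
Variable L : G -> R.
Hypothesis SL : smooth_fun L.
Variable g : G.
Local Notation S Z W := (d1_sections br (Theta_plus L) Z W g).

Let SZL Z : prol_section Z -> smooth_fun (fun h => (Z h).2 L).
Proof. by move=> [_ _ [_ H]]; exact: H. Qed.

Let SE Z W : S Z W = anchor (Z g) (fun h => (W h).2 L)
  - anchor (W g) (fun h => (Z h).2 L) - (br Z W g).2 L.
Proof. by []. Qed.

Lemma d1_sections_skew Z W : prol_section Z -> prol_section W -> S Z W = - S W Z.
Proof.
move=> PZ PW; rewrite !SE (br_skew Hbr PZ PW).
rewrite -[X in _ - X]/(- ((br W Z g).2 L)); ring.
Qed.

Lemma d1_sections_linear (a : R) Z Z' W :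
  prol_section Z -> prol_section Z' -> prol_section W ->
  S (a *: Z + Z') W = a * S Z W + S Z' W.
Proof.
move=> PZ PZ' PW; rewrite !SE (br_linear Hbr a PZ PZ' PW).
have -> : (fun h => ((a *: Z + Z') h).2 L)
    = a *: (fun h => (Z h).2 L) + (fun h => (Z' h).2 L) by [].
rewrite (tangent_linear (tangent_anchor g PW)); [|exact: SZL|exact: SZL].
have -> : anchor ((a *: Z + Z') g) (fun h => (W h).2 L) =
   a * anchor (Z g) (fun h => (W h).2 L) + anchor (Z' g) (fun h => (W h).2 L).
  set phi := fun h => _.
  rewrite !anchorE -[((a *: Z + Z') g).1 phi]/(a * (Z g).1 phi + (Z' g).1 phi).
  rewrite -[((a *: Z + Z') g).2 phi]/(a * (Z g).2 phi + (Z' g).2 phi).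
  by ring.
have -> : ((a *: br Z W + br Z' W) g).2 L
    = a * (br Z W g).2 L + (br Z' W g).2 L by [].
by ring.
Qed.

Lemma d1_sections_scale f Z W : smooth_fun f ->
  prol_section Z -> prol_section W ->
  S (fun h => f h *: Z h) W = f g * S Z W.
Proof.
move=> Sf PZ PW; have PfZ := prol_section_scale Sf PZ.
rewrite !SE (br_skew Hbr PfZ PW) (br_leibniz Hbr PW PZ Sf) (br_skew Hbr PW PZ).
have -> : (fun h => (f h *: Z h).2 L) = f * (fun h => (Z h).2 L) by [].
rewrite (tangent_leibniz (tangent_anchor g PW) Sf (SZL PZ)).
have -> : anchor (f g *: Z g) (fun h => (W h).2 L)
    = f g * anchor (Z g) (fun h => (W h).2 L).
  set phi := fun h => _.
  by rewrite !anchorE mulrDr.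
rewrite -[X in _ - X = _]/(- (f g * - ((br Z W g).2 L) + anchor (W g) f * (Z g).2 L)).
by rewrite /=; ring.
Qed.

Lemma d1_sections_zero W : prol_section W -> S 0 W = 0.
Proof.
move=> PW; have S0 := smooth_fun_cst (M := G) 0.
have := d1_sections_scale S0 prol_section_zero PW.
rewrite (_ : (fun h => cst 0 h *: (0 : G -> pvec G) h) = 0); last first.
  by apply/funext => h; rewrite scaler0.
by move=> ->; rewrite /= mul0r.
Qed.

Lemma prol_section_sum (I : Type) (r : seq I) (f : I -> G -> R) (Z : I -> G -> pvec G) :
  (forall i, smooth_fun (f i)) -> (forall i, prol_section (Z i)) ->
  prol_section (fun h => \sum_(i <- r) f i h *: Z i h).
Proof.
move=> Sf PZ; elim: r => [|i r IH].
  rewrite (_ : (fun _ => _) = 0); first exact: prol_section_zero.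
  by apply/funext => h; rewrite big_nil.
rewrite (_ : (fun _ => _) = (fun h => f i h *: Z i h)
    + (fun h => \sum_(i <- r) f i h *: Z i h)).
  by apply: prol_section_add => //; exact: prol_section_scale.
by apply/funext => h; rewrite big_cons.
Qed.

Lemma d1_sections_sum (I : Type) (r : seq I) (f : I -> G -> R)
    (Z : I -> G -> pvec G) W :
  (forall i, smooth_fun (f i)) -> (forall i, prol_section (Z i)) -> prol_section W ->
  S (fun h => \sum_(i <- r) f i h *: Z i h) W = \sum_(i <- r) f i g * S (Z i) W.
Proof.
move=> Sf PZ PW; elim: r => [|i r IH].
  rewrite big_nil (_ : (fun _ => _) = 0); first exact: d1_sections_zero.
  by apply/funext => h; rewrite big_nil.
rewrite (_ : (fun _ => _) = 1 *: (fun h => f i h *: Z i h)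
    + (fun h => \sum_(i <- r) f i h *: Z i h)); last first.
  by apply/funext => h; rewrite big_cons scale1r.
rewrite d1_sections_linear//; [|exact: prol_section_scale|exact: prol_section_sum].
by rewrite mul1r d1_sections_scale// IH big_cons.
Qed.

(** Tensoriality: near [g] a section vanishing at [g] is a combination of
    sections whose coefficients vanish at [g]. *)
Lemma d1_sections_vanish Z W : prol_section Z -> prol_section W ->
  Z g = 0 -> S Z W = 0.
Proof.
move=> PZ PW Z0; have [FZ [_ VZ1] [_ VZ2]] := PZ.
have [x1 [Z1 [b1 [Sx1 HZ1 Sb1 b1g H1]]]] := exists_vertical_frame (tgt_subm Gd) g.
have [x2 [Z2 [b2 [Sx2 HZ2 Sb2 b2g H2]]]] := exists_vertical_frame (src_subm Gd) g.
pose c1 i h := b2 h * (Z h).1 (x1 i); pose c2 i h := b1 h * (Z h).2 (x2 i).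
have Sc1 i : smooth_fun (c1 i).
  by apply: (smooth_funM (g := fun h => (Z h).1 (x1 i))) => //; exact: VZ1.
have Sc2 i : smooth_fun (c2 i).
  by apply: (smooth_funM (g := fun h => (Z h).2 (x2 i))) => //; exact: VZ2.
have PA i : prol_section (fun h => (Z1 i h, 0)).
  by have [? ?] := HZ1 i; exact: prol_section_fst.
have PB i : prol_section (fun h => (0, Z2 i h)).
  by have [? ?] := HZ2 i; exact: prol_section_snd.
have E : (fun h => (b1 * b2) h *: Z h)
    = 1 *: (fun h => \sum_i c1 i h *: ((Z1 i h, 0) : pvec G))
      + (fun h => \sum_i c2 i h *: ((0, Z2 i h) : pvec G)).
  apply/funext => h; have [[T1 z1] [T2 z2]] := FZ h.
  have E1 : b1 h *: (Z h).1 = \sum_i (Z h).1 (x1 i) *: Z1 i h by exact: H1.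
  have E2 : b2 h *: (Z h).2 = \sum_i (Z h).2 (x2 i) *: Z2 i h by exact: H2.
  have sum1 : \sum_i c1 i h *: ((Z1 i h, 0) : pvec G)
      = (b2 h *: \sum_i (Z h).1 (x1 i) *: Z1 i h, 0).
    rewrite scaler_sumr; elim: (index_enum _) => [|i r IH]; first by rewrite !big_nil.
    by rewrite !big_cons IH; apply: injective_projections; rewrite /= ?scalerA ?scaler0 ?addr0.
  have sum2 : \sum_i c2 i h *: ((0, Z2 i h) : pvec G)
      = (0, b1 h *: \sum_i (Z h).2 (x2 i) *: Z2 i h).
    rewrite scaler_sumr; elim: (index_enum _) => [|i r IH]; first by rewrite !big_nil.
    by rewrite !big_cons IH; apply: injective_projections; rewrite /= ?scalerA ?scaler0 ?addr0.
  rewrite scale1r -[RHS]/(_ h + _ h) /= sum1 sum2 -E1 -E2 !scalerA.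
  rewrite -[(b1 * b2) h]/(b1 h * b2 h).
  by apply: injective_projections; rewrite /= ?addr0 ?add0r 1?mulrC.
have Sb : smooth_fun (b1 * b2) by exact: smooth_funM.
have := d1_sections_scale Sb PZ PW.
rewrite fctE b1g b2g !mul1r => <-; rewrite E.
rewrite d1_sections_linear//; [|exact: prol_section_sum|exact: prol_section_sum].
rewrite !d1_sections_sum// !big1 ?mulr0 ?addr0// => i _.
  by rewrite /c2 Z0 mulr0 mul0r.
by rewrite /c1 Z0 mulr0 mul0r.
Qed.

Lemma d1_sections_eql Z Z' W : prol_section Z -> prol_section Z' ->
  prol_section W -> Z g = Z' g -> S Z W = S Z' W.
Proof.
move=> PZ PZ' PW E; apply/eqP; rewrite -subr_eq0 addrC -mulN1r; apply/eqP.
rewrite -d1_sections_linear//; apply: d1_sections_vanish => //.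
  apply: prol_section_add => //.
  have S1 := smooth_fun_cst (M := G) (-1).
  exact: (prol_section_scale S1 PZ').
rewrite -[LHS]/(-1 *: Z' g + Z g) E scaleN1r addrC subrr//.
Qed.

Lemma d1_sections_eq Z Z' W W' : prol_section Z -> prol_section Z' ->
  prol_section W -> prol_section W' -> Z g = Z' g -> W g = W' g ->
  S Z W = S Z' W'.
Proof.
move=> PZ PZ' PW PW' EZ EW; rewrite (d1_sections_eql PZ PZ' PW EZ).
rewrite (d1_sections_skew PZ' PW) (d1_sections_skew PZ' PW').
by rewrite (d1_sections_eql PW PW' PZ' EW).
Qed.

Lemma d1E Z W : prol_section Z -> prol_section W ->
  d1 Gd br (Theta_plus L) g (Z g) (W g) = S Z W.
Proof.
move=> PZ PW; rewrite /d1; set P := [set r | _].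
have [Z' [W' [PZ' PW' EZ EW ->]]] : P (get P).
  by apply: (getPex (ex_intro P (S Z W) _)); exists Z, W; split.
exact: d1_sections_eq.
Qed.

(** The bracket of [left_inv Y] and [left_inv Y'] contained in the prolongation
    bracket cancels the corresponding terms of the differential; what remains
    are mixed derivatives of [L]. *)
Lemma Omega_inv_section X Y X' Y' : AG_section X -> AG_section Y ->
  AG_section X' -> AG_section Y' ->
  Omega br L g (inv_section X Y g) (inv_section X' Y' g)
    = right_inv X' g (fun h => left_inv Y h L)
      - right_inv X g (fun h => left_inv Y' h L).
Proof.
move=> AX AY AX' AY'; rewrite /Omega d1E; [|exact: prol_section_inv|exact: prol_section_inv].
have [XX HX] := exists_AG_bracket AX AX'; have [YY HY] := exists_AG_bracket AY AY'.
rewrite /d1_sections (br_inv_section Hbr AX AY AX' AY' HX HY).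
have [_ EY] := HY.
rewrite /Theta_plus /= EY /vf_bracket /anchor /=.
set phi := fun h => left_inv Y' h L; set psi := fun h => left_inv Y h L.
rewrite -[(right_inv X g + left_inv Y g) phi]/(right_inv X g phi + left_inv Y g phi).
rewrite -[(right_inv X' g + left_inv Y' g) psi]/(right_inv X' g psi + left_inv Y' g psi).
by ring.
Qed.

End Differential.

(** ** The prolongation of a second order operator *)

(** Since [tgt (g k) = tgt k], this is the anchor of [Y] at [tgt g]. *)
Lemma tmap_tgt_left_inv Y g : AG_section Y ->
  tmap tgt (left_inv Y g) = tmap tgt (Y (tgt g)).
Proof.
move=> AY; apply/funext => u; have [Su|Su] := pselect (smooth_fun u); last first.
  by rewrite /tmap asboolF.
have Sut : smooth_fun (u \o tgt) by exact: smooth_fun_map.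
rewrite !tmapE// (left_invE AY Sut Sut)//.
by near=> y => yg /=; rewrite tgt_gmul.
Unshelve. all: by end_near. Qed.

Lemma tmap_src_right_inv Y g : AG_section Y ->
  tmap src (right_inv Y g) = - tmap tgt (Y (src g)).
Proof.
move=> AY; rewrite right_invE// tmapN -(tgt_ginv Gd g) -tmap_tgt_left_inv//.
congr (- _); apply/funext => u; have [Su|Su] := pselect (smooth_fun u); last first.
  by rewrite /tmap asboolF.
rewrite !tmapE//; last exact: smooth_fun_map.
by congr (left_inv _ _ _); apply/funext => q /=; rewrite src_ginv.
Qed.

Section Evolution.
Variable xi : G -> G.
Hypothesis Hxi : second_order Gd xi.

Let Sxi : smooth_map xi. Proof. by have [] := Hxi. Qed.
Let xiP g : tgt g = src (xi g). Proof. by have [_] := Hxi; exact. Qed.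

Lemma prol_map_fst g (v : tvec G) Y : AG_section Y -> 
  (prol_map xi g (v, left_inv Y g)).1 = - right_inv Y (xi g).
Proof. by move=> AY; rewrite /= Tright_inv_left_inv. Qed.

Lemma prol_map_snd g (v : tvec G) Y : AG_section Y ->
  (prol_map xi g (v, left_inv Y g)).2
    = tmap xi (v + left_inv Y g) + right_inv Y (xi g).
Proof. by move=> AY; rewrite /= Tright_inv_left_inv// opprK tmapD. Qed.

(** The two terms of [prol_map_snd] have opposite projections by [src]: since
    [src \o xi = tgt], both are the anchor of [Y] up to sign. *)
Lemma prol_map_fibre g a : prol_fibre g a -> prol_fibre (xi g) (prol_map xi g a).
Proof.
case: a => v w [/= [Tv v0] Vw].
have [Y AY Yw] := left_inv_surj Vw.
have [Tr r0] := right_inv_vertical (xi g) AY.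
split.
  rewrite -Yw prol_map_fst//; split; first exact: tangent_opp.
  by rewrite tmapN r0 oppr0.
rewrite -Yw prol_map_snd//; have Tl := tangent_left_inv g AY.
have Tvl := tangent_add Tv Tl.
split.
  by apply: tangent_add => //; exact: tangent_tmap.
rewrite tmapD tmap_src_right_inv// -xiP -tmap_tgt_left_inv//.
rewrite (_ : tmap src _ = tmap tgt (v + left_inv Y g)); last first.
  apply/funext => u; have [Su|Su] := pselect (smooth_fun u); last first.
    by rewrite /tmap asboolF.
  rewrite !tmapE//; last exact: smooth_fun_map.
  by congr ((v + _) _); apply/funext => q /=; rewrite xiP.
by rewrite tmapD v0 add0r subrr.
Qed.

(** On [(v, left_inv Y g)] the two forms take the values [right_inv Y (xi g) L]
    and [left_inv Y g L], whose equality is the equation at [g] for [Y]; every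
    vertical vector is a value [left_inv Y g]. *)
Lemma evolution_operatorP L : smooth_fun L -> evolution_operator Gd L xi <->
  eq_form1 Gd (pullback1 (prol_map xi) xi (Theta_minus L)) (Theta_plus L).
Proof.
move=> SL; split.
  move=> [_ H] g [v w] [/= [Tv v0] Vw]; have [Y AY <-] := left_inv_surj Vw.
  rewrite /pullback1 /Theta_minus prol_map_fst// /Theta_plus /=.
  rewrite -[LHS]/(- - (right_inv Y (xi g) L)) opprK.
  by have [_ /(_ Y AY)/eqP] := H g; rewrite subr_eq0 => /eqP.
move=> H; split=> // g; split; first exact: xiP.
move=> X AX; apply/eqP; rewrite subr_eq0 eq_sym; apply/eqP.
have [[T0 z0] _] : prol_fibre g 0 by have [h _ _] := prol_section_zero; exact: h.
have := H g (0, left_inv X g) (conj (conj T0 z0) (left_inv_vertical g AX)).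
rewrite /pullback1 /Theta_minus prol_map_fst// /Theta_plus /=.
by rewrite -[X in X = _]/(- - (right_inv X (xi g) L)) opprK.
Qed.

(** Vectors at [g] and their images at [xi g] are values of invariant sections,
    so [Omega_inv_section] computes both sides. The equations
    [right_inv Y (xi g) L = left_inv Y g L], differentiated along
    [anchor a] and [anchor b], turn the left-hand side into the right-hand one,
    up to the difference of the brackets of [right_inv Y, right_inv Y'] at
    [xi g] and of [left_inv Y, left_inv Y'] at [g]; this is again an instance
    of these equations. *)
Lemma evolution_operator_Omega br L : is_prol_bracket Gd br -> smooth_fun L ->
  evolution_operator Gd L xi ->
  eq_form2 Gd (pullback2 (prol_map xi) xi (Omega br L)) (Omega br L).
Proof.
move=> Hbr SL [_ H] g a b Fa Fb; rewrite /pullback2.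
have EL Y : AG_section Y ->
    (fun h => right_inv Y h L) \o xi = (fun h => left_inv Y h L).
  move=> AY; apply/funext => h /=; have [_ /(_ Y AY)/eqP] := H h.
  by rewrite subr_eq0 => /eqP.
have [Fa1 Fa2] := prol_map_fibre Fa; have [Fb1 Fb2] := prol_map_fibre Fb.
have [X AX Xa] := right_inv_surj Fa.1; have [Y AY Ya] := left_inv_surj Fa.2.
have [X' AX' Xb] := right_inv_surj Fb.1; have [Y' AY' Yb] := left_inv_surj Fb.2.
have [W AW Wa] := left_inv_surj Fa2; have [W' AW' Wb] := left_inv_surj Fb2.
have ea : a = inv_section X Y g by rewrite /inv_section Xa Ya; case: (a).
have eb : b = inv_section X' Y' g by rewrite /inv_section Xb Yb; case: (b).
have AN := AG_section_opp AY; have AN' := AG_section_opp AY'.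
have pE c V K : left_inv V g = c.2 -> AG_section V ->
    left_inv K (xi g) = (prol_map xi g c).2 ->
    prol_map xi g c = inv_section (fun x => - V x) K (xi g).
  case: c => c1 c2 /= <- AV EK; rewrite /inv_section EK right_inv_opp//.
  by rewrite -(prol_map_fst g c1 AV) -surjective_pairing.
have pa := pE a Y W Ya AY Wa; have pb := pE b Y' W' Yb AY' Wb.
rewrite pa pb (Omega_inv_section Hbr SL _ AN AW AN' AW').
rewrite ea eb (Omega_inv_section Hbr SL _ AX AY AX' AY').
rewrite !right_inv_opp//.
rewrite -[LHS]/(- right_inv Y' (xi g) (fun h => left_inv W h L)
   - - right_inv Y (xi g) (fun h => left_inv W' h L)).
rewrite !right_left_comm//.
have snd (V U : M -> tvec G) c : AG_section V -> AG_section U -> c.2 = left_inv U g ->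
   left_inv V (xi g) = (prol_map xi g c).2 ->
   forall K, AG_section K ->
   left_inv V (xi g) (fun h => right_inv K h L)
     = c.1 (fun h => left_inv K h L) + left_inv U g (fun h => left_inv K h L)
       + right_inv U (xi g) (fun h => right_inv K h L).
  move=> AV AU c2 -> K AK.
  rewrite [c]surjective_pairing c2 prol_map_snd// -[LHS]/(tmap _ _ _ + _).
  by rewrite tmapE ?EL//; exact: right_inv_smooth.
rewrite (snd W Y a AW AY (esym Ya) Wa _ AY').
rewrite (snd W' Y' b AW' AY' (esym Yb) Wb _ AY).
rewrite -Xa -Xb.
have [YY HY] := exists_AG_bracket AY AY'.
have := right_inv_bracket (xi g) AY AY' HY SL.
have -> : right_inv YY (xi g) L = left_inv YY g L.
  by have [AYY _] := HY; have := EL YY AYY => /(congr1 (fun f => f g)).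
have [_ ->] := HY; rewrite /vf_bracket => E.
rewrite -(right_left_comm g AX' AY SL) -(right_left_comm g AX AY' SL); move: E.
move: (right_inv Y (xi g) _) (right_inv Y' (xi g) _) (left_inv Y g _)
  (left_inv Y' g _) (right_inv X g _) (right_inv X' g _) => r1 r2 l1 l2 x1 x2 E.
have -> : r1 = r2 - (l1 - l2) by rewrite -E; ring.
by ring.
Qed.

End Evolution.
End Groupoid.

Theorem theorem4p4 (R : realType) (n m : nat)
    (G : manifold R n) (M : manifold R m) (Gd : lieGroupoid G M)
    (L : G -> R) (hL : smooth_fun L)
    (xi : G -> G) (hxi : second_order Gd xi) :
  (evolution_operator Gd L xi <->
     eq_form1 Gd (pullback1 (prol_map Gd xi) xi (Theta_minus L))
                 (Theta_plus L)) /\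
  (evolution_operator Gd L xi <->
     eq_form1 Gd
       (fun g a => (pullback1 (prol_map Gd xi) xi (Theta_minus L) g a
                    - Theta_minus L g a)%R)
       (d0 L)) /\
  (forall br, is_prol_bracket Gd br ->
     evolution_operator Gd L xi ->
     eq_form2 Gd (pullback2 (prol_map Gd xi) xi (Omega Gd br L))
                 (Omega Gd br L)).
Proof.
have H := evolution_operatorP hxi hL.
split=> //; split; last first.
  by move=> br Hbr; exact: evolution_operator_Omega.
rewrite H; split=> E g a Fa.
  by rewrite E// /Theta_minus /Theta_plus opprK addrC.
have := E g a Fa; rewrite /Theta_minus opprK /d0 -[RHS]/(a.1 L + a.2 L).
by rewrite addrC => /addrI.
Qed.
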